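(* Suppose Assumptions 1–4 below hold, with $\mu>0$. Run Algorithm 2Direction with $$\bar L=660508\cdot\max\Big\{\frac L\alpha,\frac{Lp}{\alpha\tau},\frac{\sqrt{LL_{\max}}\,p\sqrt{\omega\tau}}{\alpha\beta\sqrt n},\frac{\sqrt{LL_{\max}}\sqrt p\sqrt{\omega\tau}}{\alpha\sqrt\beta\sqrt n},\frac{L_{\max}\omega p^2}{\beta^2n},\frac{L_{\max}\omega}{n}\Big\},$$ $\beta=\frac1{\omega+1}$, $\theta_{\min}=\frac14\min\{1,\frac\alpha p,\frac\tau p,\frac\beta p\}$, $h_i^0=\nabla f_i(z^0)$ for all $i$, $w^0=u^0$, $k^0=\nabla f(z^0)$, $v^0=\nabla f(z^0)$, and $\Gamma_0\ge1$. Then for every $T\ge0$, $$\mathbb E[f(z^T)-f(x^* )]+\frac\mu2\mathbb E\|u^T-x^*\|^2\le2\exp\Big(-\frac TQ\Big)\Big((f(z^0)-f(x^* ))+\Big(\frac{\bar L}{\Gamma_0}+\mu\Big)\|u^0-x^*\|^2\Big),$$ where $$Q=2\sqrt{660508}\cdot\max\Big\{\sqrt{\tfrac{L}{\alpha p\mu}},\sqrt{\tfrac{L}{\alpha\tau\mu}},\sqrt{\tfrac{\sqrt{LL_{\max}}(\omega+1)\sqrt{\omega\tau}}{\alpha\sqrt n\,\mu}},\sqrt{\tfrac{\sqrt{LL_{\max}}\sqrt{\omega+1}\sqrt{\omega\tau}}{\alpha\sqrt p\sqrt n\,\mu}},\sqrt{\tfrac{L_{\max}\omega(\omega+1)^2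p}{n\mu}},\sqrt{\tfrac{L_{\max}\omega}{np\mu}},\tfrac1\alpha,\tfrac1\tau,\omega+1,\tfrac1p\Big\}.$$
   Context: Setting: $f=\frac1n\sum_{i=1}^nf_i$, $f_i:\mathbb R^d\to\mathbb R$. Assumption 1: each $f_i$ is $L_i$-smooth, $L_{\max}=\max_iL_i$, and $\widehat L>0$ satisfies $\frac1n\sum_i\|\nabla f_i(x)-\nabla f_i(y)\|^2\le\widehat L^2\|x-y\|^2$ for all $x,y$. Assumption 2: $f$ is $L$-smooth. Assumption 3: each $f_i$ is convex and $f$ is $\mu$-strongly convex ($\mu\ge0$) with minimizer $x^*$. Assumption 4: the randomness of all compressors is drawn independently (of each other, of the coins $c^t$, and of the past). Compressor classes: $\mathbb U(\omega)$ ($\omega\ge0$) = stochastic maps $\mathcal C$ with $\mathbb E\mathcal C(x)=x$, $\mathbb E\|\mathcal C(x)-x\|^2\le\omega\|x\|^2$; $\mathbb B(\alpha)$ ($\alpha\in(0,1]$) = possibly stochastic maps with $\mathbb E\|\mathcal C(x)-x\|^2\le(1-\alpha)\|x\|^2$. Algorithm 2Direction: compressors $\mathcal C_i^{D,y},\mathcal C_i^{D,z}\in\mathbb U(\omega)$ (workers), $\mathcal C^P\in\mathbb B(\alpha)$ (server); parameters $\bar L>0$, $\mu$ (the strong convexity constant), $p\in(0,1]$, $\Gamma_0\ge1$, $\tau\in(0,1]$, $x^0,h_1^0,\dots,h_n^0,k^0,v^0\in\mathbb R^d$. Set $w^0=z^0=u^0=x^0$, $h^0=\frac1n\sum_ih_i^0$.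 For $t=0,1,\dots$: let $\bar\theta_{t+1}$ be the largest root of $p\bar L\Gamma_t\theta^2+p(\bar L+\Gamma_t\mu)\theta-(\bar L+\Gamma_t\mu)=0$, $\theta_{t+1}=\min\{\bar\theta_{t+1},\theta_{\min}\}$, $\gamma_{t+1}=p\theta_{t+1}\Gamma_t/(1-p\theta_{t+1})$, $\Gamma_{t+1}=\Gamma_t+\gamma_{t+1}$; $y^{t+1}=\theta_{t+1}w^t+(1-\theta_{t+1})z^t$; $m_i^{t,y}=\mathcal C_i^{D,y}(\nabla f_i(y^{t+1})-h_i^t)$; $g^{t+1}=h^t+\frac1n\sum_im_i^{t,y}$; $u^{t+1}=\arg\min_x\{\langle g^{t+1},x\rangle+\frac{\bar L+\Gamma_t\mu}{2\gamma_{t+1}}\|x-u^t\|^2+\frac\mu2\|x-y^{t+1}\|^2\}$; $q^{t+1}=\arg\min_x\{\langle k^t,x\rangle+\frac{\bar L+\Gamma_t\mu}{2\gamma_{t+1}}\|x-w^t\|^2+\frac\mu2\|x-y^{t+1}\|^2\}$; $w^{t+1}=q^{t+1}+\mathcal C^P(u^{t+1}-q^{t+1})$; $x^{t+1}=\theta_{t+1}u^{t+1}+(1-\theta_{t+1})z^t$; draw $c^t\sim\mathrm{Bernoulli}(p)$, and set $(k^{t+1},z^{t+1})=(v^t,x^{t+1})$ if $c^t=1$, $(k^{t+1},z^{t+1})=(k^t,z^t)$ if $c^t=0$; $m_i^{t,z}=\mathcal C_i^{D,z}(\nabla f_i(z^{t+1})-h_i^t)$; $h_i^{t+1}=h_i^t+\beta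 m_i^{t,z}$; $v^{t+1}=(1-\tau)v^t+\tau(h^t+\frac1n\sum_im_i^{t,z})$; $h^{t+1}=h^t+\frac\beta n\sum_im_i^{t,z}$. $\mathbb E$ is full expectation. *)

(* Defs.v *)
From HB Require Import structures.
From mathcomp Require Import all_boot all_order all_algebra.
From mathcomp Require Import all_classical all_reals all_analysis.
From Stdlib Require List.
Set Implicit Arguments. Unset Strict Implicit. Unset Printing Implicit Defensive.
Import Order.TTheory GRing.Theory Num.Theory.
Import numFieldNormedType.Exports.
Local Open Scope classical_set_scope.
Local Open Scope ring_scope.

Section Defs.
Variable R : realType.

Definition dotv d (x y : 'rV[R]_d) : R := \sum_(j < d) x 0 j * y 0 j.
Definition sqn d (x : 'rV[R]_d) : R := dotv x x.
Definition enorm d (x : 'rV[R]_d) : R := Num.sqrt (sqn x).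

Definition is_gradient d (f : 'rV[R]_d -> R) (g : 'rV[R]_d -> 'rV[R]_d) :=
  forall x, differentiable f x /\ ('d f x : 'rV[R]_d -> R) = (fun h => dotv (g x) h).

Definition smooth_with d (f : 'rV[R]_d -> R) (g : 'rV[R]_d -> 'rV[R]_d) (L : R) :=
  is_gradient f g /\ forall x y, enorm (g x - g y) <= L * enorm (x - y).

Definition convex_fun d (f : 'rV[R]_d -> R) :=
  forall (x y : 'rV[R]_d) (l : R), 0 <= l <= 1 ->
    f (l *: x + (1 - l) *: y) <= l * f x + (1 - l) * f y.

Definition strongly_convex d (mu : R) (f : 'rV[R]_d -> R) :=
  forall (x y : 'rV[R]_d) (l : R), 0 <= l <= 1 ->
    f (l *: x + (1 - l) *: y) <= l * f x + (1 - l) * f y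
                                 - mu / 2 * l * (1 - l) * sqn (x - y).

Definition avgf n d (f : 'I_n -> 'rV[R]_d -> R) (x : 'rV[R]_d) : R :=
  n%:R^-1 * \sum_(i < n) f i x.
Definition avgv n d (g : 'I_n -> 'rV[R]_d) : 'rV[R]_d :=
  n%:R^-1 *: \sum_(i < n) g i.

Definition Lmax_of n (L : 'I_n -> R) : R := \big[Num.max/0]_(i < n) L i.

Definition argmin d (F : 'rV[R]_d -> R) : 'rV[R]_d :=
  xget 0 [set x | forall y, F x <= F y].

Definition largest_root (a b c : R) : R :=
  xget 0 [set th : R | a * th ^+ 2 + b * th - c = 0 /\
                       forall th', a * th' ^+ 2 + b * th' - c = 0 -> th' <= th].

(* A (stochastic) compressor is a pair (law of its random seed, map).  The
   d-dimensional vectors are identified with d.-tuples (product Borel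
   sigma-algebra) for the purpose of joint measurability. *)
Definition rv_of_tuple d (t : d.-tuple R) : 'rV[R]_d := \row_j tnth t j.

Definition compressor_measurable (dS : measure_display) (S : measurableType dS) d
  (C : S -> 'rV[R]_d -> 'rV[R]_d) :=
  forall j : 'I_d,
    measurable_fun [set: S * d.-tuple R] (fun p => C p.1 (rv_of_tuple p.2) 0 j).

Definition in_U (dS : measure_display) (S : measurableType dS) d
  (mu : probability S R) (C : S -> 'rV[R]_d -> 'rV[R]_d) (om : R) :=
  forall x : 'rV[R]_d,
    (forall j, mu.-integrable [set: S] (fun s => (C s x 0 j)%:E) /\
               (\int[mu]_s (C s x 0 j)%:E = (x 0 j)%:E)%E) /\
    (\int[mu]_s (sqn (C s x - x))%:E <= (om * sqn x)%:E)%E.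

Definition in_B (dS : measure_display) (S : measurableType dS) d
  (mu : probability S R) (C : S -> 'rV[R]_d -> 'rV[R]_d) (al : R) :=
  forall x : 'rV[R]_d,
    (\int[mu]_s (sqn (C s x - x))%:E <= ((1 - al) * sqn x)%:E)%E.

Definition sigma_of (dO : measure_display) (O : measurableType dO)
  (dS : measure_display) (S : measurableType dS) (X : O -> S) : set (set O) :=
  [set X @^-1` A | A in [set A : set S | measurable A]].

Definition mutually_independent (dO : measure_display) (O : measurableType dO)
  (P : probability O R) (I : Type) (G : I -> set (set O)) :=
  forall (J : seq I) (A : I -> set O), List.NoDup J ->
    (forall j, List.In j J -> G j (A j)) ->
    P (\bigcap_(j in [set j | List.In j J]) A j) = (\prod_(j <- J) P (A j))%E.

End Defs.

Inductive rsource (n : nat) :=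
| SrcY of nat & 'I_n     (* seed of C_i^{D,y} at iteration t *)
| SrcZ of nat & 'I_n     (* seed of C_i^{D,z} at iteration t *)
| SrcP of nat            (* seed of C^P at iteration t *)
| SrcCoin of nat.

Record state (R : realType) (n d : nat) := State {
  st_w : 'rV[R]_d; st_z : 'rV[R]_d; st_u : 'rV[R]_d; st_x : 'rV[R]_d;
  st_hi : 'I_n -> 'rV[R]_d; st_h : 'rV[R]_d;
  st_k : 'rV[R]_d; st_v : 'rV[R]_d; st_Gam : R }.

Section Algo.
Variables (R : realType) (n d : nat).
Variables (Sy Sz SP : Type).
Variables (Cy : 'I_n -> Sy -> 'rV[R]_d -> 'rV[R]_d)
          (Cz : 'I_n -> Sz -> 'rV[R]_d -> 'rV[R]_d)
          (CP : SP -> 'rV[R]_d -> 'rV[R]_d).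
Variable grad : 'I_n -> 'rV[R]_d -> 'rV[R]_d.
Variables (Lbar mu p tau beta thmin : R).

Definition step (sy : 'I_n -> Sy) (sz : 'I_n -> Sz) (sp : SP) (c : bool)
  (s : state R n d) : state R n d :=
  let Gam := st_Gam s in
  let thbar := largest_root (p * Lbar * Gam) (p * (Lbar + Gam * mu)) (Lbar + Gam * mu) in
  let th := Num.min thbar thmin in
  let gam := p * th * Gam / (1 - p * th) in
  let Gam' := Gam + gam in
  let y := th *: st_w s + (1 - th) *: st_z s in
  let my := fun i => Cy i (sy i) (grad i y - st_hi s i) in
  let g := st_h s + n%:R^-1 *: \sum_(i < n) my i in
  let a := (Lbar + Gam * mu) / gam in
  let u' := argmin (fun x => dotv g x + a / 2 * sqn (x - st_u s) + mu / 2 * sqn (x - y)) in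
  let q := argmin (fun x => dotv (st_k s) x + a / 2 * sqn (x - st_w s) + mu / 2 * sqn (x - y)) in
  let w' := q + CP sp (u' - q) in
  let x' := th *: u' + (1 - th) *: st_z s in
  let k' := if c then st_v s else st_k s in
  let z' := if c then x' else st_z s in
  let mz := fun i => Cz i (sz i) (grad i z' - st_hi s i) in
  let hi' := fun i => st_hi s i + beta *: mz i in
  let v' := (1 - tau) *: st_v s + tau *: (st_h s + n%:R^-1 *: \sum_(i < n) mz i) in
  let h' := st_h s + (beta / n%:R) *: \sum_(i < n) mz i in
  State w' z' u' x' hi' h' k' v' Gam'.

Fixpoint run (Om : Type) (xiy : nat -> 'I_n -> Om -> Sy) (xiz : nat -> 'I_n -> Om -> Sz)
  (xip : nat -> Om -> SP) (coin : nat -> Om -> bool) (s0 : state R n d)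
  (t : nat) (om : Om) : state R n d :=
  match t with
  | 0 => s0
  | t'.+1 => step (fun i => xiy t' i om) (fun i => xiz t' i om) (xip t' om) (coin t' om)
                  (run xiy xiz xip coin s0 t' om)
  end.
End Algo.

Local Open Scope ring_scope.
(* the constant 660508 (written so as to avoid a unary numeral) *)
Definition c660508 (R : realType) : R := 660 * 1000 + 508.

Definition Lbar_thm7 (R : realType) (L Lmax om al p tau beta : R) (n : nat) : R :=
  c660508 R * Num.max (L / al) (Num.max (L * p / (al * tau))
   (Num.max (Num.sqrt (L * Lmax) * p * Num.sqrt (om * tau) / (al * beta * Num.sqrt n%:R))
   (Num.max (Num.sqrt (L * Lmax) * Num.sqrt p * Num.sqrt (om * tau)
              / (al * Num.sqrt beta * Num.sqrt n%:R))
   (Num.max (Lmax * om * p ^+ 2 / (beta ^+ 2 * n%:R)) (Lmax * om / n%:R))))).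

Definition thmin_thm7 (R : realType) (al p tau beta : R) : R :=
  4^-1 * Num.min 1 (Num.min (al / p) (Num.min (tau / p) (beta / p))).

Definition Q_thm7 (R : realType) (L Lmax om al p tau mu : R) (n : nat) : R :=
  2 * Num.sqrt (c660508 R) *
  Num.max (Num.sqrt (L / (al * p * mu)))
  (Num.max (Num.sqrt (L / (al * tau * mu)))
  (Num.max (Num.sqrt (Num.sqrt (L * Lmax) * (om + 1) * Num.sqrt (om * tau)
                        / (al * Num.sqrt n%:R * mu)))
  (Num.max (Num.sqrt (Num.sqrt (L * Lmax) * Num.sqrt (om + 1) * Num.sqrt (om * tau)
                        / (al * Num.sqrt p * Num.sqrt n%:R * mu)))
  (Num.max (Num.sqrt (Lmax * om * (om + 1) ^+ 2 * p / (n%:R * mu)))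
  (Num.max (Num.sqrt (Lmax * om / (n%:R * p * mu)))
  (Num.max al^-1 (Num.max tau^-1 (Num.max (om + 1) p^-1)))))))).

Definition source_sigma (n : nat) (dO : measure_display) (Om : measurableType dO)
  (dy dz dp : measure_display) (Sy : measurableType dy) (Sz : measurableType dz)
  (SP : measurableType dp)
  (xiy : nat -> 'I_n -> Om -> Sy) (xiz : nat -> 'I_n -> Om -> Sz)
  (xip : nat -> Om -> SP) (coin : nat -> Om -> bool) (s : rsource n) : set (set Om) :=
  match s with
  | SrcY t i => sigma_of (xiy t i)
  | SrcZ t i => sigma_of (xiz t i)
  | SrcP t => sigma_of (xip t)
  | SrcCoin t => sigma_of (coin t)
  end.

Definition init_thm7 (R : realType) (n d : nat) (grad : 'I_n -> 'rV[R]_d -> 'rV[R]_d)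
  (x0 : 'rV[R]_d) (Gam0 : R) : state R n d :=
  State x0 x0 x0 x0 (fun i => grad i x0) (avgv (fun i => grad i x0))
        (avgv (fun i => grad i x0)) (avgv (fun i => grad i x0)) Gam0.

(* Main.v *)
(* With Gamma = Gamma_t, A = Lbar + Gamma mu and D_f the Bregman divergence of f, the quantity
     Gamma E(f(z) - min f) + A/2 E|u - x*|^2 + r_W A E|u - w|^2
       + Gamma (r_H E (1/n) sum_i |h_i - grad f_i(z)|^2 + r_K E|grad f(z) - k|^2
                + r_V E|v - grad f(z)|^2)
   is nonincreasing along the iterations for suitable weights r. The linear coupling
   x' = theta u' + (1 - theta) z gives the accelerated descent of the first two terms up to
   L theta^2/2 |u' - w|^2 and the variance of the gradient estimate, and leaves a negative
   multiple of D_f(z, y). The last four terms contract at rates of order alpha, beta, p and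
   tau; by cocoercivity their drifts are bounded by D_f(z, y) and theta^2 |u' - w|^2, hence
   absorbed as soon as Lbar is a large multiple of the six terms of the maximum. They
   vanish at t = 0, and Gamma_{t+1} = Gamma_t / (1 - p theta) grows by at least
   exp(1/Q) at each step.

   No conditional expectation is used: a compression error is orthogonal in L^2 to every
   random vector measurable with respect to the other random seeds, by Fubini. *)
Require Import Defs.
From HB Require Import structures.
From mathcomp Require Import all_boot all_order all_algebra.
From mathcomp Require Import all_classical all_reals all_analysis.
From mathcomp Require Import measurable_realfun ring lra.
Set Implicit Arguments.
Unset Strict Implicit.
Unset Printing Implicit Defensive.
Import Order.TTheory GRing.Theory Num.Theory.
Import numFieldNormedType.Exports.
Local Open Scope classical_set_scope.
Local Open Scope ring_scope.

(** * Smooth convex functions *)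

(** The coupling error L theta^2/2 |u' - w|^2 has to be paid partly by A/2 |u' - u|^2 and partly by
    |u - w|^2. What makes this affordable is p Gamma' theta^2 <= A / Lbar, which is the defining
    quadratic of theta after division by 1 - p theta; it is an equality at the root and an
    inequality once theta is capped. The error terms influence one another in one direction only: |u
    - w| depends on k and h, k on v, v on h, and h on none of the others. Hence the weights can be
    fixed one after the other, in the order W, K, V, H, and no cyclic system has to be solved. With
    this choice the total coefficients of D_f(z, y) and |u' - w|^2 become polynomials in the six
    terms of the maximum divided by Lbar (the two with square roots entering squared) and in two
    quantities that these dominate. The constant 660508 acts through the lower bound 500000, and
    cancels when Lbar is compared with p mu Q^2. All randomness is first reduced to inequalities
    between second moments; the decrease itself is then proved for real numbers. *)

Section EuclideanVectors.
Variables (R : realType) (d : nat).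
Implicit Types (x y z : 'rV[R]_d) (a b s : R).

Lemma dotvC x y : dotv x y = dotv y x.
Proof. by apply: eq_bigr => j _; rewrite mulrC. Qed.

Lemma dotvDl x y z : dotv (x + y) z = dotv x z + dotv y z.
Proof. by rewrite -big_split; apply: eq_bigr => j _; rewrite !mxE mulrDl. Qed.

Lemma dotvZl a x y : dotv (a *: x) y = a * dotv x y.
Proof. by rewrite mulr_sumr; apply: eq_bigr => j _; rewrite !mxE mulrA. Qed.

Lemma dotvNl x y : dotv (- x) y = - dotv x y.
Proof. by rewrite -scaleN1r dotvZl mulN1r. Qed.

Lemma dotv0l y : dotv 0 y = 0.
Proof. by rewrite -(scale0r (0 : 'rV[R]_d)) dotvZl mul0r. Qed.

Lemma dotvDr x y z : dotv x (y + z) = dotv x y + dotv x z.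
Proof. by rewrite dotvC dotvDl !(dotvC _ x). Qed.

Lemma dotvZr a x y : dotv x (a *: y) = a * dotv x y.
Proof. by rewrite dotvC dotvZl dotvC. Qed.

Lemma dotvNr x y : dotv x (- y) = - dotv x y.
Proof. by rewrite dotvC dotvNl dotvC. Qed.

Lemma dotv_suml (I : finType) (F : I -> 'rV[R]_d) y :
  dotv (\sum_i F i) y = \sum_i dotv (F i) y.
Proof.
elim/big_rec2: _ => [|i a x _ <-]; first exact: dotv0l.
by rewrite dotvDl.
Qed.

Lemma dotv_sumr (I : finType) (F : I -> 'rV[R]_d) y :
  dotv y (\sum_i F i) = \sum_i dotv y (F i).
Proof. by rewrite dotvC dotv_suml; apply: eq_bigr => i _; rewrite dotvC. Qed.

Lemma sqn_ge0 x : 0 <= sqn x.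
Proof. by apply: sumr_ge0 => j _; rewrite -expr2 sqr_ge0. Qed.

Lemma sqn0 : sqn (0 : 'rV[R]_d) = 0.
Proof. exact: dotv0l. Qed.

Lemma sqnN x : sqn (- x) = sqn x.
Proof. by rewrite /sqn dotvNl dotvNr opprK. Qed.

Lemma sqnZ a x : sqn (a *: x) = a ^+ 2 * sqn x.
Proof. by rewrite /sqn dotvZl dotvZr mulrA expr2. Qed.

Lemma sqnD x y : sqn (x + y) = sqn x + 2 * dotv x y + sqn y.
Proof. by rewrite /sqn !dotvDl !dotvDr (dotvC y x); ring. Qed.

Lemma sqnBC x y : sqn (x - y) = sqn (y - x).
Proof. by rewrite -sqnN opprB. Qed.

Lemma sqn_eq0 x : (sqn x == 0) = (x == 0).
Proof.
apply/eqP/eqP => [|->]; last exact: sqn0.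
move/eqP; rewrite psumr_eq0 => [/allP h|j _]; last by rewrite -expr2 sqr_ge0.
apply/rowP => j; rewrite mxE; apply/eqP.
by have := h j (mem_index_enum j); rewrite /= -expr2 sqrf_eq0.
Qed.

Lemma sqr_le_sqn x (j : 'I_d) : x 0 j ^+ 2 <= sqn x.
Proof.
rewrite /sqn /dotv (bigD1 j)//= expr2 lerDl.
by apply: sumr_ge0 => k _; rewrite -expr2 sqr_ge0.
Qed.

(** Expand |s x - y|^2 >= 0 and divide by s. The free parameter is later tuned to the contraction
    rate at hand. *)
Lemma sqnD_young s x y : 0 < s ->
  sqn (x + y) <= (1 + s) * sqn x + (1 + s^-1) * sqn y.
Proof.
move=> s0; have := sqn_ge0 (s *: x - y).
rewrite sqnD sqnD sqnZ sqnN dotvNr dotvZl => h.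
have -> : (1 + s) * sqn x + (1 + s^-1) * sqn y =
   sqn x + 2 * dotv x y + sqn y
   + s^-1 * (s ^+ 2 * sqn x + 2 * - (s * dotv x y) + sqn y).
  by field; rewrite gt_eqF.
by rewrite lerDl mulr_ge0// invr_ge0 ltW.
Qed.

Lemma sqnD_le2 x y : sqn (x + y) <= 2 * sqn x + 2 * sqn y.
Proof. by have := @sqnD_young 1 x y ltr01; rewrite invr1. Qed.

Lemma sqnE x : sqn x = enorm x ^+ 2.
Proof. by rewrite sqr_sqrtr// sqn_ge0. Qed.

Lemma cauchy_schwarz x y : dotv x y <= enorm x * enorm y.
Proof.
have [x0|x0] := eqVneq (sqn x) 0.
  have /eqP -> : x == 0 by rewrite -sqn_eq0 x0.
  by rewrite dotv0l /enorm sqn0 sqrtr0 mul0r.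
have [y0|y0] := eqVneq (sqn y) 0.
  have /eqP -> : y == 0 by rewrite -sqn_eq0 y0.
  by rewrite dotvC dotv0l /enorm sqn0 sqrtr0 mulr0.
have p z : sqn z != 0 -> 0 < enorm z by move=> h; rewrite sqrtr_gt0 lt_def h sqn_ge0.
have := sqn_ge0 (enorm y *: x - enorm x *: y).
rewrite sqnD sqnN !sqnZ dotvNr dotvZl dotvZr !sqnE => h.
have := p _ x0; have := p _ y0; set u := enorm x in h *; set v := enorm y in h * => v0 u0.
have : (v * u) * dotv x y <= (v * u) * (u * v) by nra.
by rewrite ler_pM2l// mulr_gt0.
Qed.

Lemma enorm_le_sqn (L : R) x y : 0 <= L ->
  enorm x <= L * enorm y -> sqn x <= L ^+ 2 * sqn y.
Proof.
move=> L0 h; by rewrite !sqnE -exprMn lerXn2r ?nnegrE ?mulr_ge0 ?sqrtr_ge0.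
Qed.

End EuclideanVectors.

Section SmoothConvex.
Variables (R : realType) (d : nat).
Implicit Types (f : 'rV[R]_d -> R) (g : 'rV[R]_d -> 'rV[R]_d) (x y : 'rV[R]_d).

Lemma is_derive_line f g x y (t : R) : is_gradient f g ->
  is_derive t 1 (fun s : R => f (x + s *: y)) (dotv (g (x + t *: y)) y).
Proof.
move=> fg; have [df dfE] := fg (x + t *: y).
have dl : is_diff t (fun s : R => x + s *: y) (fun s : R => s *: y).
  have h1 : is_diff t (fun s : R => s *: y) (fun s : R => s *: y).
    exact: is_diff_scalel.
  have h2 : is_diff t (cst x : R -> 'rV[R]_d) (cst 0) by exact: is_diff_cst.
  have := is_diffD h2 h1.
  rewrite (_ : cst 0 + _ = (fun s : R => s *: y))//.
  by apply/funext => s; rewrite fctE /= add0r.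
have df' : is_diff (x + t *: y) f (fun h => dotv (g (x + t *: y)) h).
  by apply: DiffDef.
have hc := @is_diff_comp _ _ _ _ (fun s : R => x + s *: y) _ f _ t dl df'.
have hd : differentiable (f \o (fun s : R => x + s *: y)) t by case: hc.
apply: DeriveDef; first exact/derivable1_diffP.
by rewrite deriveE// (@diff_val _ _ _ _ _ _ _ hc) /= scale1r.
Qed.

Definition bregman f g x y : R := f x - f y - dotv (g y) (x - y).

Lemma smooth_le f g (L : R) x y : smooth_with f g L ->
  bregman f g y x <= L / 2 * sqn (y - x).
Proof.
move=> [fg lip]; set v := y - x.
(* [phi] is the error of the quadratic model along the segment. Subtracting the quadratic makes its
   derivative nonpositive for s >= 0, so a single mean value point replaces the usual integral. *)
pose phi (s : R) := f (x + s *: v) - (s * dotv (g x) v + s ^+ 2 * (L / 2 * sqn v)).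
pose dphi (s : R) := dotv (g (x + s *: v)) v - (dotv (g x) v + 2 * s * (L / 2 * sqn v)).
have dphiE (s : R) : is_derive s 1 phi (dphi s).
  have h1 : is_derive s 1 (fun r : R => r * dotv (g x) v) (dotv (g x) v).
    have := is_deriveM (is_derive_id s 1) (is_derive_cst (dotv (g x) v) s 1).
    by move=> h; apply: (is_derive_eq h); rewrite scaler0 add0r /GRing.scale /= mulr1.
  have h2 : is_derive s 1 (fun r : R => r ^+ 2 * (L / 2 * sqn v)) (2 * s * (L / 2 * sqn v)).
    have := is_deriveM (is_deriveX 2 (is_derive_id s 1)) (is_derive_cst (L / 2 * sqn v) s 1).
    by move=> h; apply: (is_derive_eq h); rewrite scaler0 add0r /GRing.scale /= expr1; ring.
  have h3 := is_deriveB (is_derive_line x v s fg) (is_deriveD h1 h2).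
  exact: h3.
have [|c c01] := @MVT R phi dphi 0 1 ltr01 (fun s _ => dphiE s).
  apply: continuous_subspaceT => s.
  by apply: differentiable_continuous; apply/derivable1_diffP.
rewrite subr0 mulr1 /phi /dphi scale0r scale1r addr0 => h.
have : dotv (g (x + c *: v) - g x) v <= L * c * sqn v.
  apply: le_trans (cauchy_schwarz _ _) _.
  apply: le_trans (ler_wpM2r (sqrtr_ge0 _) (lip _ _)) _.
  rewrite addrAC subrr add0r.
  have -> : enorm (c *: v) = c * enorm v.
    have c0 : 0 <= c by move: c01; rewrite in_itv/= => /andP[/ltW].
    by rewrite /enorm sqnZ sqrtrM ?sqr_ge0// sqrtr_sqr ger0_norm.
  by rewrite [in leRHS]sqnE expr2 !mulrA.
rewrite dotvDl dotvNl => h2.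
have xv : x + v = y by rewrite /v addrC subrK.
move: h; rewrite xv /bregman -/v => h; nra.
Qed.

Lemma smooth_ge f g (L : R) x y : smooth_with f g L ->
  - (L / 2 * sqn (y - x)) <= bregman f g y x.
Proof.
move=> [fg lip].
have : smooth_with (fun z => - f z) (fun z => - g z) L.
  split=> [z|z1 z2]; last first.
    by rewrite -opprD /enorm sqnN; exact: lip.
  have [df dfE] := fg z; split; first exact: differentiableN.
  have := diffN df; rewrite dfE => h.
  rewrite [LHS]h; apply/funext => w.
  by rewrite dotvNl.
move=> /(@smooth_le _ _ _ x y); rewrite /bregman dotvNl; lra.
Qed.

(* Both one-sided bounds of smoothness are used: the lower bound at step size s
   replaces a limit of difference quotients. *)
Lemma strongly_convex_bregman f g (L mu : R) x y : 0 <= L -> smooth_with f g L ->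
  strongly_convex mu f -> mu / 2 * sqn (y - x) <= bregman f g y x.
Proof.
move=> L0 fL fmu; set Q := sqn (y - x); have Q0 : 0 <= Q by exact: sqn_ge0.
have key (s : R) : 0 < s <= 1 ->
    mu / 2 * Q - bregman f g y x <= s * ((L + mu) / 2 * Q).
  move=> /andP[s0 s1].
  have := @fmu y x s; rewrite (ltW s0) s1 => /(_ isT).
  have := @smooth_ge _ _ _ x (x + s *: (y - x)) fL.
  have -> : s *: y + (1 - s) *: x = x + s *: (y - x).
    by rewrite scalerBl scale1r scalerBr addrCA.
  rewrite /bregman addrAC subrr add0r dotvZr sqnZ -/Q.
  set F := f (x + _); set D := dotv _ _ => h1 h2.
  have : s * (mu / 2 * Q - (f y - f x - D)) <= s * (s * ((L + mu) / 2 * Q)) by nra.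
  by rewrite ler_pM2l.
have [h|h] := leP (mu / 2 * Q - bregman f g y x) 0; first by lra.
set M := (L + mu) / 2 * Q in key.
have M0 : 0 < M by have := key 1; rewrite ltr01 lexx mul1r => /(_ isT); lra.
set e := mu / 2 * Q - _ in h key.
have eM : e <= M by have := key 1; rewrite ltr01 lexx mul1r => /(_ isT).
have M2 : 0 < 2 * M by lra.
have /key : 0 < e / (2 * M) <= 1 by rewrite divr_gt0//= ler_pdivrMr//; lra.
have -> : e / (2 * M) * M = e / 2 by field; rewrite gt_eqF.
by lra.
Qed.

Lemma convex_bregman_ge0 f g (L : R) x y : 0 <= L -> smooth_with f g L ->
  convex_fun f -> 0 <= bregman f g y x.
Proof.
move=> L0 fL fc; rewrite (_ : 0 = 0 / 2 * sqn (y - x)); last by rewrite mul0r mul0r.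
apply: strongly_convex_bregman L0 fL _ => u v l /fc.
by rewrite !mul0r subr0.
Qed.

(** Evaluate f at the gradient step [v] from y: convexity bounds f v from below by the tangent at x,
    smoothness bounds it from above by the model at y, and comparing the two leaves |D|^2 / (2 L).
    For L = 0 the gradient is constant. *)
Lemma cocoercive f g (L : R) x y : 0 <= L -> smooth_with f g L -> convex_fun f ->
  sqn (g y - g x) <= 2 * L * bregman f g y x.
Proof.
move=> L0 fL fc; have [L00|Lneq0] := eqVneq L 0.
  have [_ lip] := fL; have := enorm_le_sqn L0 (lip y x).
  by rewrite L00 mulr0 expr0n !mul0r.
have {Lneq0}L1 : 0 < L by rewrite lt_def Lneq0.
set D := g y - g x; pose v := y - L^-1 *: D.
have := smooth_le y v fL; have := convex_bregman_ge0 x v L0 fL fc.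
rewrite /bregman.
have -> : v - x = (y - x) - L^-1 *: D by rewrite /v addrAC.
have -> : v - y = - (L^-1 *: D) by rewrite /v addrAC subrr add0r.
have DE : sqn D = dotv (g y) D - dotv (g x) D by rewrite -dotvNl -dotvDl.
rewrite dotvDr !dotvNr !dotvZr sqnN sqnZ => h1 h2.
have {}h2 : f v - f y + L^-1 * dotv (g y) D <= L^-1 * sqn D / 2.
  suff -> : L^-1 * sqn D / 2 = L / 2 * (L^-1 ^+ 2 * sqn D) by move: h2; lra.
  by field; rewrite gt_eqF.
have : L^-1 * sqn D / 2 <= f y - f x - dotv (g x) (y - x).
  rewrite {1}(_ : L^-1 * sqn D / 2 = L^-1 * sqn D - L^-1 * sqn D / 2); last by field; rewrite gt_eqF.
  rewrite {1}DE; lra.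
move=> h; rewrite (_ : sqn D = 2 * L * (L^-1 * sqn D / 2)); last by field; rewrite gt_eqF.
by rewrite ler_pM2l// mulr_gt0.
Qed.

End SmoothConvex.

(** * Independence *)

Section Freezing.
Variables (R : realType) (dO dT dS : measure_display) (Om : measurableType dO).
Variables (T : measurableType dT) (S : measurableType dS) (P : probability Om R).
Variables (X : Om -> T) (xi : Om -> S) (nu : probability S R).
Hypothesis X_meas : measurable_fun setT X.
Hypothesis xi_meas : measurable_fun setT xi.
Hypothesis X_xi_indep : forall A B, measurable A -> measurable B ->
  P (X @^-1` A `&` xi @^-1` B) = (P (X @^-1` A) * nu B)%E.

Let joint (o : Om) : T * S := (X o, xi o).
Let joint_meas : measurable_fun setT joint.
Proof. exact/measurable_fun_pair. Qed.

HB.instance Definition _ := isMeasurableFun.Build _ _ _ _ X X_meas.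
HB.instance Definition _ := isMeasurableFun.Build _ _ _ _ joint joint_meas.

Let PX := distribution P X.
Let PXxi := distribution P joint.

Lemma joint_law (A : set (T * S)) : measurable A -> (PX \x nu)%E A = PXxi A.
Proof.
apply: product_measure_unique => B C mB mC.
by rewrite -[RHS]/(P (X @^-1` B) * nu C)%E -X_xi_indep.
Qed.

Local Open Scope ereal_scope.

(** With X held fixed, the independent variable is integrated under its own law. The integral is
    pushed forward to the joint law, which [joint_law] identifies as a product. *)
Lemma freezing_ge0 (phi : T * S -> \bar R) : measurable_fun setT phi ->
  (forall x, 0 <= phi x) ->
  \int[P]_o phi (X o, xi o) = \int[P]_o \int[nu]_s phi (X o, s).
Proof.
move=> mphi phi0.
transitivity (\int[PXxi]_x phi x).
  by rewrite ge0_integral_pushforward// => x _.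
transitivity (\int[PX \x nu]_x phi x).
  by apply: eq_measure_integral => A mA _; exact/esym/joint_law.
rewrite fubini_tonelli1// ge0_integral_pushforward//.
- exact: measurable_fun_fubini_tonelli_F.
- by move=> x _; apply: integral_ge0 => s _.
Qed.

Lemma freezing_integrable (phi : T * S -> \bar R) : measurable_fun setT phi ->
  P.-integrable setT (fun o => phi (X o, xi o)) ->
  \int[P]_o phi (X o, xi o) = \int[P]_o \int[nu]_s phi (X o, s).
Proof.
move=> mphi iphi.
have mN : measurable_fun setT (fun x => `|phi x|) by exact: measurableT_comp.
transitivity (\int[PXxi]_x phi x).
  by rewrite integral_pushforward.
transitivity (\int[PX \x nu]_x phi x).
  by apply: eq_measure_integral => A mA _; exact/esym/joint_law.
(* Integrability is given on Om only; the nonnegative case applied to |phi| carries it to the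
   product space. *)
have ip : (PX \x nu).-integrable setT phi.
  apply/integrableP; split=> //; case/integrableP : iphi => _.
  rewrite fubini_tonelli1// ge0_integral_pushforward//.
  - have e := freezing_ge0 mN (fun x => abse_ge0 (phi x)).
    by move=> h; rewrite preimage_setT; move: h; rewrite e.
  - exact: measurable_fun_fubini_tonelli_F.
  - by move=> x _; apply: integral_ge0 => s _.
rewrite -integral12_prod_meas1//.
have /integrableP[mF iF] := integrable_fubini_F ip.
rewrite integral_pushforward// preimage_setT; apply/integrableP; split.
  exact: measurableT_comp.
move: iF; rewrite ge0_integral_pushforward//.
exact: measurableT_comp.
Qed.

End Freezing.

Section Independence.
Variables (R : realType) (dO : measure_display) (Om : measurableType dO).
Variables (P : probability Om R) (I : Type) (G : I -> set (set Om)).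
Hypothesis G_algebra : forall i, sigma_algebra setT (G i).
Hypothesis G_measurable : forall i, G i `<=` measurable.
Hypothesis G_indep : mutually_independent P G.

Definition sources (J : set I) : set (set Om) := \bigcup_(i in J) G i.

Lemma sources_sub_measurable (J : set I) : <<s sources J >> `<=` measurable.
Proof.
apply: smallest_sub; first exact: sigma_algebra_measurable.
by move=> A [i _]; exact: G_measurable.
Qed.

Lemma sources_mono (J J' : set I) : J `<=` J' -> <<s sources J >> `<=` <<s sources J' >>.
Proof.
move=> JJ'; apply: smallest_sub; first exact: smallest_sigma_algebra.
move=> A [i Ji GA]; apply: sub_sigma_algebra.
by exists i => //; exact: JJ'.
Qed.

Let G_setI i A B : G i A -> G i B -> G i (A `&` B).
Proof.
move=> GA GB; rewrite -(sigma_algebra_id (G_algebra i)).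
by apply: (@measurableI _ (g_sigma_algebraType (G i))); exact: sub_sigma_algebra.
Qed.

Let G_setT i : G i setT.
Proof.
rewrite -(sigma_algebra_id (G_algebra i)).
exact: (@measurableT _ (g_sigma_algebraType (G i))).
Qed.

(* Both sides are finite measures in A, and they agree on the pi-system of cylinders over
   finitely many sources different from i. *)
Lemma independent_of_others (i : I) (A B : set Om) :
  <<s sources (~` [set i]) >> A -> G i B -> P (A `&` B) = (P A * P B)%E.
Proof.
move=> sA GB; have mB := G_measurable GB.
pose dec : forall x y : I, {x = y} + {x <> y} := fun x y => pselect (x = y).
pose cap (J : seq I) (F : I -> set Om) := \bigcap_(j in [set j | List.In j J]) F j.
pose cyl := [set C | exists J F, [/\ List.NoDup J, ~ List.In i J,
  (forall j, List.In j J -> G j (F j)) & C = cap J F]].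
have cylE J F : ~ List.In i J -> cap (i :: J) (fun j => if pselect (j = i) then B else F j) = cap J F `&` B.
  move=> iJ; apply/seteqP; split=> o /=.
    move=> h; split; last by have := h i (or_introl erefl); case: pselect.
    move=> j Jj; have := h j (or_intror Jj); case: pselect => // ji.
    by move: Jj; rewrite /= ji.
  by move=> [h Bo] j [<-|Jj]; case: pselect => // ji; exact: h.
have cylI : setI_closed cyl.
  move=> _ _ [J [F [J1 iJ GF ->]]] [K [H [K1 iK GH ->]]].
  (* Independence is stated for lists without repetition: the two index lists are merged and
     deduplicated, and each family is extended by [setT] outside its own list. *)
  exists (List.nodup dec (J ++ K)).
  exists (fun j => (if pselect (List.In j J) then F j else setT) `&`
                   (if pselect (List.In j K) then H j else setT)).
  split.
  - exact: List.NoDup_nodup.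
  - by rewrite List.nodup_In List.in_app_iff => -[].
  - by move=> j _; apply: G_setI; case: pselect => h; auto.
  - apply/seteqP; split=> o /=.
      move=> [h1 h2] j /= _; split; case: pselect => // h; first exact: h1.
      exact: h2.
    move=> h; split=> j /= Jj; have := h j;
      rewrite /= List.nodup_In List.in_app_iff => /(_ ltac:(tauto)) [];
      by do 2![case: pselect => //].
have cylm : cyl `<=` measurable.
  move=> _ [J [F [_ _ GF ->]]]; rewrite /cap.
  elim: J GF => [|j J ih] GF.
    by rewrite (_ : [set _ | _] = set0) ?bigcap_set0//; apply/seteqP; split.
  rewrite (_ : [set _ | _] = j |` [set j | List.In j J]); last first.
    by apply/seteqP; split=> k /= [|]; auto.
  rewrite bigcap_setU1; apply: measurableI; first by apply/G_measurable/GF; left.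
  by apply: ih => k Jk; apply: GF; right.
have cylT : cyl setT.
  exists [::], (fun=> setT); split=> //; first exact: List.NoDup_nil.
  by apply/seteqP; split.
have sub : <<s sources (~` [set i]) >> `<=` <<s cyl >>.
  apply: smallest_sub; first exact: smallest_sigma_algebra.
  move=> C [j ji GC]; apply: sub_sigma_algebra.
  exists [:: j], (fun=> C); split.
  - by apply: List.NoDup_cons => //; exact: List.NoDup_nil.
  - by move=> [].
  - by move=> k [<-|].
  - by apply/seteqP; split=> o /=; [move=> Co k _|apply; left].
(* P B is packed as a nonnegative real, so that A |-> P A * P B becomes the scaled measure
   [mscale r P], to be compared with the restriction of P to B. *)
pose r := NngNum (fine_ge0 (measure_ge0 P B)).
have rE : (r%:num)%:E = P B by rewrite /= fineK// fin_num_measure.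
have m12 C : cyl C -> mrestr P mB C = mscale r P C.
  move=> [J [F [J1 iJ GF ->]]]; rewrite /mrestr /mscale rE.
  pose H j := if pselect (j = i) then B else F j.
  have GH j : List.In j (i :: J) -> G j (H j).
    by rewrite /H => -[<-|Jj]; case: pselect => //= ji; [rewrite ji|exact: GF].
  rewrite -cylE// G_indep//; last exact: List.NoDup_cons.
  rewrite big_cons -/(H i); have -> : H i = B by rewrite /H; case: pselect.
  congr (_ * _)%E; rewrite -G_indep//; last by move=> j Jj; apply: GH; right.
  congr (P _); apply/seteqP; split=> o h j Jj; have := h j Jj; rewrite /H;
    case: pselect => // ji; by move: Jj; rewrite /= ji.
have oo (k : nat) : (mrestr P mB setT < +oo)%E.
  by rewrite /mrestr setTI ltey_eq fin_num_measure.
have Tcover : \bigcup_(k : nat) (setT : set Om) = setT by rewrite bigcup_const//; exists 0%N.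
have := @g_sigma_algebra_measure_unique _ R _ cyl cylm (fun=> setT) (fun=> cylT)
  Tcover _ _ cylI m12 oo A (sub _ sA).
by rewrite -[LHS]/(P (A `&` B)) -[RHS]/((r%:num)%:E * P A)%E rE muleC.
Qed.

End Independence.

(** * Continuous functions of random vectors *)

Section VectorMeasurability.
Variables (R : realType) (dT : measure_display) (T : measurableType dT) (d : nat).
Implicit Types (X Y : T -> 'rV[R]_d).

Definition vmeasurable X := forall j, measurable_fun setT (fun o => X o 0 j).

(** Random vectors are measured coordinatewise, so the open set {F > a} is written as the countable
    union of those boxes with rational data on which F exceeds a. *)
Lemma vmeasurable_continuous (F : 'rV[R]_d -> R) X :
  continuous F -> vmeasurable X -> measurable_fun setT (F \o X).
Proof.
move=> cF mX.
apply: (measurability _ (RGenOInfty.measurableE R)) => //.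
move=> _ [_ [a ->] <-]; rewrite setTI preimage_itvoy.
pose box (c : 'rV[rat]_d * nat) := [set x : 'rV[R]_d | forall j, `|x 0 j - ratr (c.1 0 j)| < c.2.+1%:R^-1].
pose inside c := `[< forall x, box c x -> a < F x >].
rewrite (_ : [set _ | _] = \bigcup_c (if inside c then X @^-1` box c else set0)).
  apply: countable_bigcupT_measurable => [|c]; first exact: countableP.
  case: ifP => // _; rewrite (_ : _ @^-1` _ =
    \bigcap_(j in [set: 'I_d]) [set o | `|X o 0 j - ratr (c.1 0 j)| < c.2.+1%:R^-1]).
    apply: fin_bigcap_measurable => [|j _]; first exact: finite_finset.
    rewrite -[X in measurable X]setTI; apply: (measurable_fun_ltr _ _ measurableT) => //.
      apply: (@measurableT_comp _ _ _ _ _ _ (fun x : R => `|x|)) => //.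
      by apply: measurable_funB => //; exact: mX.
  by apply/seteqP; split=> o h j; [move=> _; exact: (h j)|exact: (h j I)].
apply/seteqP; split=> o /=.
  rewrite ?in_itv/= ?andbT => aF.
  have aF' : nbhs (F (X o)) [set y | a < y].
    by apply: open_nbhs_nbhs; split=> //; exact: open_gt.
  have : nbhs (X o) [set x | a < F x] by exact: (cF (X o) _ aF').
  move=> /nbhs_ballP[e /= e0 eF].
  (* The radius is below e / 2: X o and any other point of the box both lie within 1 / (k + 1) of
     the rational centre. *)
  pose k := Num.truncn (2 / e); have ke : 2 * k.+1%:R^-1 < e.
    rewrite ltr_pdivrMr// mulrC -ltr_pdivrMr//.
    exact: truncnS_gt.
  have k0 : 0 < (k.+1%:R^-1 : R) by rewrite invr_gt0.
  have q j : exists q : rat, `|X o 0 j - ratr q| < k.+1%:R^-1.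
    have /rat_in_itvoo[q] : X o 0 j - k.+1%:R^-1 < X o 0 j + k.+1%:R^-1.
      by rewrite ltrD2l (lt_trans _ k0)// oppr_lt0.
    rewrite in_itv/= => h; exists q; move: h k0; rewrite ltr_norml.
    by move: (ratr q) (_^-1) => r s /andP[h1 h2] s0; apply/andP; split; lra.
  have [qf qfP] := choice q.
  exists (\row_j qf j, k) => //.
  rewrite (_ : inside _ = true); last first.
    apply/asboolP => x xq; apply: eF; split=> // i j; rewrite ord1.
    have := xq j; have := qfP j; rewrite /= mxE => h1 h2.
    rewrite /ball /= -(subrK (ratr (qf j)) (X o 0 j)) -addrA.
    apply: le_lt_trans (ler_normD _ _) _; rewrite (distrC _ (x 0 j)).
    apply: le_lt_trans ke; rewrite mulr_natl mulr2n.
    exact/ltW/ltrD.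
  by move=> j; rewrite /= mxE; exact: qfP.
move=> [c _]; case: ifPn => // /asboolP h bo.
by rewrite ?in_itv/= ?andbT; apply: h.
Qed.

End VectorMeasurability.

(** * Square integrable random vectors *)

Section Expectation.
Variables (R : realType) (dO : measure_display) (Om : measurableType dO).
Variable P : probability Om R.
Implicit Types X Y : Om -> R.

Definition integ X := P.-integrable setT (EFin \o X).
Definition Ex X : R := \int[P]_o X o.

Lemma integD X Y : integ X -> integ Y -> integ (fun o => X o + Y o).
Proof. by move=> iX iY; exact: (integrableD measurableT iX iY). Qed.

Lemma integZ a X : integ X -> integ (fun o => a * X o).
Proof. by move=> iX; exact: (integrableZl measurableT a iX). Qed.

Lemma integN X : integ X -> integ (fun o => - X o).
Proof.
move=> iX; rewrite (_ : (fun _ => _) = (fun o => -1 * X o)); first exact: integZ.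
by apply/funext => o; rewrite mulN1r.
Qed.

Lemma integB X Y : integ X -> integ Y -> integ (fun o => X o - Y o).
Proof. by move=> iX iY; apply: integD => //; exact: integN. Qed.

Lemma integC a : integ (fun=> a).
Proof. exact: (@finite_measure_integrable_cst _ _ _ P setT a measurableT). Qed.

Lemma integ_sum (K : finType) (X : K -> Om -> R) :
  (forall k, integ (X k)) -> integ (fun o => \sum_k X k o).
Proof.
move=> iX; rewrite /integ (_ : _ \o _ = fun o => (\sum_k (X k o)%:E)%E).
  by apply: integrable_sum => // k _; exact: iX.
by apply/funext => o; rewrite /= sumEFin.
Qed.

Lemma integ_le X Y : measurable_fun setT X -> integ Y ->
  (forall o, `|X o| <= Y o) -> integ X.
Proof.
move=> mX iY XY; apply: (le_integrable _ _ _ iY) => //; first exact/measurable_EFinP.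
by move=> o _ /=; rewrite lee_fin (le_trans (XY o))// ler_norm.
Qed.

Lemma integ_meas X : integ X -> measurable_fun setT X.
Proof. by move=> /integrableP[/measurable_EFinP]. Qed.

Lemma EFin_Ex X : integ X -> (\int[P]_o (X o)%:E)%E = (Ex X)%:E.
Proof. by move=> iX; rewrite /Ex /Rintegral fineK//; exact: integrable_fin_num iX. Qed.

Lemma ExD X Y : integ X -> integ Y -> Ex (fun o => X o + Y o) = Ex X + Ex Y.
Proof. by move=> iX iY; exact: RintegralD. Qed.

Lemma ExZ a X : integ X -> Ex (fun o => a * X o) = a * Ex X.
Proof. by move=> iX; exact: RintegralZl. Qed.

Lemma ExB X Y : integ X -> integ Y -> Ex (fun o => X o - Y o) = Ex X - Ex Y.
Proof. by move=> iX iY; exact: RintegralB. Qed.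

Lemma ExC a : Ex (fun=> a) = a.
Proof.
rewrite /Ex Rintegral_cst// -[RHS]mulr1; congr (_ * _).
exact: (congr1 fine (@probability_setT _ _ _ P)).
Qed.

Lemma Ex_sum (K : finType) (X : K -> Om -> R) :
  (forall k, integ (X k)) -> Ex (fun o => \sum_k X k o) = \sum_k Ex (X k).
Proof.
move=> iX; apply: EFin_inj; rewrite -EFin_Ex; last exact: integ_sum.
under eq_integral => o _ do rewrite -sumEFin.
rewrite integral_sum//.
by rewrite -sumEFin; apply: eq_bigr => k _; exact: EFin_Ex.
Qed.

Lemma Ex_le X Y : integ X -> integ Y -> (forall o, X o <= Y o) -> Ex X <= Ex Y.
Proof. by move=> iX iY XY; apply: le_Rintegral. Qed.

Lemma Ex_ge0 X : (forall o, 0 <= X o) -> 0 <= Ex X.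
Proof. by move=> X0; exact: Rintegral_ge0. Qed.

End Expectation.

Section SquareIntegrable.
Variables (R : realType) (dO : measure_display) (Om : measurableType dO).
Variables (P : probability Om R) (I : Type) (G : I -> set (set Om)).
Hypothesis G_algebra : forall i, sigma_algebra setT (G i).
Hypothesis G_measurable : forall i, G i `<=` measurable.
Hypothesis G_indep : mutually_independent P G.
Variable d : nat.
Implicit Types (J : set I) (X Y : Om -> 'rV[R]_d).

Local Notation OmJ J := (g_sigma_algebraType (sources G J)).

(** [J] lists the seeds on which X may depend: the domain carries the sigma-algebra they generate
    instead of the full one. Independence from a seed can then be read off from an inclusion of
    index sets. *)
Definition smeas J (X : Om -> R) := measurable_fun [set: OmJ J] (X : OmJ J -> R).
Definition vmeas J X := forall j, smeas J (fun o => X o 0 j).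
Definition L2 J X := vmeas J X /\ integ P (fun o => sqn (X o)).

Lemma smeas_mono J J' (X : Om -> R) : J `<=` J' -> smeas J X -> smeas J' X.
Proof.
by move=> JJ' mX _ A mA; rewrite setTI; apply: (sources_mono JJ');
  have := mX measurableT A mA; rewrite setTI.
Qed.

Lemma smeas_measurable J (X : Om -> R) : smeas J X -> measurable_fun setT X.
Proof.
move=> mX _ A mA; rewrite setTI; apply: (sources_sub_measurable G_measurable (J := J)).
by have := mX measurableT A mA; rewrite setTI.
Qed.

Lemma smeas_dotv J X Y : vmeas J X -> vmeas J Y -> smeas J (fun o => dotv (X o) (Y o)).
Proof.
move=> mX mY; apply: measurable_sum => j.
by apply: measurable_funM; [exact: mX|exact: mY].
Qed.

Lemma vmeas_mono J J' X : J `<=` J' -> vmeas J X -> vmeas J' X.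
Proof. by move=> JJ' mX j; exact: smeas_mono (mX j). Qed.

Lemma vmeasD J X Y : vmeas J X -> vmeas J Y -> vmeas J (fun o => X o + Y o).
Proof.
move=> mX mY j; rewrite (_ : (fun _ => _) = (fun o => X o 0 j + Y o 0 j)).
  by apply: measurable_funD; [exact: mX|exact: mY].
by apply/funext => o; rewrite mxE.
Qed.

Lemma vmeasZ J a X : vmeas J X -> vmeas J (fun o => a *: X o).
Proof.
move=> mX j; rewrite (_ : (fun _ => _) = (fun o => a * X o 0 j)).
  by apply: measurable_funM; [exact: measurable_cst|exact: mX].
by apply/funext => o; rewrite mxE.
Qed.

Lemma L2_mono J J' X : J `<=` J' -> L2 J X -> L2 J' X.
Proof. by move=> JJ' [mX iX]; split=> //; exact: vmeas_mono mX. Qed.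

Lemma L2_cst J (x : 'rV[R]_d) : L2 J (fun=> x).
Proof. by split=> [j|]; [exact: measurable_cst|exact: integC]. Qed.

Lemma L2_dominated J X (b : Om -> R) : vmeas J X -> integ P b ->
  (forall o, sqn (X o) <= b o) -> L2 J X.
Proof.
move=> mX ib Xb; split=> //; apply: (integ_le _ ib).
  by apply: (@smeas_measurable J); exact: smeas_dotv.
by move=> o; rewrite ger0_norm// sqn_ge0.
Qed.

Lemma L2D J X Y : L2 J X -> L2 J Y -> L2 J (fun o => X o + Y o).
Proof.
move=> [mX iX] [mY iY].
apply: (@L2_dominated _ _ (fun o => 2 * sqn (X o) + 2 * sqn (Y o))).
- exact: vmeasD.
- by apply: integD; exact: integZ.
- by move=> o; exact: sqnD_le2.
Qed.

Lemma L2Z J a X : L2 J X -> L2 J (fun o => a *: X o).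
Proof.
move=> [mX iX]; apply: (@L2_dominated _ _ (fun o => a ^+ 2 * sqn (X o))).
- exact: vmeasZ.
- exact: integZ.
- by move=> o; rewrite sqnZ.
Qed.

Lemma L2N J X : L2 J X -> L2 J (fun o => - X o).
Proof.
move=> /(L2Z (-1)); congr (L2 _ _).
by apply/funext => o; rewrite scaleN1r.
Qed.

Lemma L2B J X Y : L2 J X -> L2 J Y -> L2 J (fun o => X o - Y o).
Proof. by move=> LX LY; apply: L2D => //; exact: L2N. Qed.

Lemma L2_sum J (K : finType) (X : K -> Om -> 'rV[R]_d) :
  (forall k, L2 J (X k)) -> L2 J (fun o => \sum_k X k o).
Proof.
move=> LX; elim: (index_enum K) => [|k s ih].
  by under [fun=> _]eq_fun do rewrite big_nil; exact: L2_cst.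
by under [fun=> _]eq_fun do rewrite big_cons; exact: L2D.
Qed.

Lemma integ_dotv J J' X Y : L2 J X -> L2 J' Y -> integ P (fun o => dotv (X o) (Y o)).
Proof.
move=> [mX iX] [mY iY].
apply: (@integ_le _ _ _ _ _ (fun o => sqn (X o) + sqn (Y o))).
- apply: (@smeas_measurable setT); apply: smeas_dotv.
    exact: vmeas_mono mX.
  exact: vmeas_mono mY.
- exact: integD.
- move=> o; rewrite ler_norml; apply/andP; split.
    have := sqn_ge0 (X o + Y o); have := sqn_ge0 (X o); have := sqn_ge0 (Y o).
    rewrite sqnD; lra.
  have := sqn_ge0 (X o - Y o); have := sqn_ge0 (X o); have := sqn_ge0 (Y o).
  rewrite sqnD sqnN dotvNr; lra.
Qed.

Lemma L2_lipschitz J (g : 'rV[R]_d -> 'rV[R]_d) (L : R) X : 0 <= L ->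
  (forall x y, enorm (g x - g y) <= L * enorm (x - y)) -> L2 J X -> L2 J (g \o X).
Proof.
move=> L0 lip LX.
have cg j : continuous (fun x => g x 0 j).
  move=> x A /nbhs_ballP[e /= e0 eA].
  (* Neighbourhoods are sup-norm balls while g is Lipschitz for the Euclidean norm. M accounts for
     the change of norm, and M < (M + 1)^2 gives the strict bound at radius e / (M + 1). *)
  pose M := L ^+ 2 * d%:R; have M0 : 0 <= M by rewrite mulr_ge0 ?sqr_ge0.
  have M1 : 0 < M + 1 by lra.
  have de0 : 0 < e / (M + 1) by rewrite divr_gt0.
  suff : nbhs x ((fun x => g x 0 j) @^-1` A) by [].
  apply/nbhs_ballP; exists (e / (M + 1)) => //= y [_ xy].
  apply: eA; rewrite /ball/=.
  have sxy : sqn (x - y) <= d%:R * (e / (M + 1)) ^+ 2.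
    rewrite mulr_natl -[d in leRHS]card_ord -sumr_const; apply: ler_sum => k _.
    rewrite -expr2 -[leLHS]real_normK ?num_real// lerXn2r ?nnegrE ?(ltW de0)//.
    by rewrite !mxE; apply: ltW; exact: (xy 0 k).
  rewrite -(@ltr_pXn2r _ 2)// ?nnegrE ?(ltW e0)// real_normK ?num_real//.
  have -> : g x 0 j - g y 0 j = (g x - g y) 0 j by rewrite !mxE.
  apply: le_lt_trans (sqr_le_sqn _ _) _.
  apply: le_lt_trans (enorm_le_sqn L0 (lip _ _)) _.
  apply: le_lt_trans (ler_wpM2l (sqr_ge0 _) sxy) _.
  rewrite mulrA -/M exprMn mulrCA -[ltRHS]mulr1 ltr_pM2l ?exprn_gt0//.
  rewrite exprVn ltr_pdivrMr ?exprn_gt0// mul1r; nra.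
have [mX _] := LX.
apply: (@L2_dominated _ _ (fun o => 2 * (L ^+ 2 * sqn (X o - 0)) + 2 * sqn (g 0))).
- by move=> j; exact: (vmeasurable_continuous (cg j) mX).
- apply: integD; last exact: integC.
  by apply: integZ; apply: integZ; case: (L2B LX (L2_cst J 0)).
- move=> o /=; rewrite -[X in sqn X](subrK (g 0)).
  apply: le_trans (sqnD_le2 _ _) _.
  by rewrite lerD2r ler_pM2l//; exact: enorm_le_sqn (lip _ _).
Qed.

Lemma L2_if J (c : Om -> bool) X Y : measurable_fun [set: OmJ J] (c : OmJ J -> bool) ->
  L2 J X -> L2 J Y -> L2 J (fun o => if c o then X o else Y o).
Proof.
move=> mc [mX iX] [mY iY].
apply: (@L2_dominated _ _ (fun o => sqn (X o) + sqn (Y o))).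
- move=> j; rewrite (_ : (fun _ => _) = (fun o => if c o then X o 0 j else Y o 0 j)).
    by apply: measurable_fun_ifT => //; [exact: mX|exact: mY].
  by apply/funext => o; case: (c o).
- exact: integD.
- by move=> o; case: (c o); rewrite ?lerDl ?lerDr sqn_ge0.
Qed.

End SquareIntegrable.

Section RandomSources.
Variables (R : realType) (dO : measure_display) (Om : measurableType dO).
Variables (P : probability Om R) (I : Type) (G : I -> set (set Om)).
Hypothesis G_algebra : forall i, sigma_algebra setT (G i).
Hypothesis G_measurable : forall i, G i `<=` measurable.
Hypothesis G_indep : mutually_independent P G.
Variable d : nat.

Local Notation OmJ J := (g_sigma_algebraType (sources G J)).

Section OneSource.
Variables (i : I) (dS : measure_display) (S : measurableType dS).
Variables (xi : Om -> S) (nu : probability S R).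
Hypothesis xi_meas : measurable_fun setT xi.
Hypothesis xi_source : sigma_of xi `<=` G i.
Hypothesis xi_law : forall A, measurable A -> P (xi @^-1` A) = nu A.

Let T := OmJ (~` [set i]).
(** The identity, seen as a random element of Om under the sigma-algebra of all sources but i. Every
    quantity measurable without seed i is a measurable function of it, so freezing applies to all of
    them at once. *)
Let coarse : Om -> T := id.
Let coarse_meas : measurable_fun setT coarse.
Proof. by move=> _ A mA; rewrite setTI; exact: (sources_sub_measurable G_measurable) mA. Qed.

Let coarse_indep A B : measurable A -> measurable B ->
  P (coarse @^-1` A `&` xi @^-1` B) = (P (coarse @^-1` A) * nu B)%E.
Proof.
move=> mA mB; rewrite -xi_law//.
apply: (independent_of_others G_algebra G_measurable G_indep mA).
by apply: xi_source; exists B.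
Qed.

Lemma source_measurable (J : set I) : J i -> measurable_fun [set: OmJ J] (xi : OmJ J -> S).
Proof.
move=> Ji _ A mA; rewrite setTI; apply: sub_sigma_algebra.
by exists i => //; apply: xi_source; exists A.
Qed.

Section Compressor.
Variable C : S -> 'rV[R]_d -> 'rV[R]_d.
Hypothesis C_meas : compressor_measurable C.

Let C_comp (dU : measure_display) (U : measurableType dU) (s : U -> S) (X : U -> 'rV[R]_d) :
  measurable_fun setT s -> vmeasurable X -> vmeasurable (fun u => C (s u) (X u)).
Proof.
move=> ms mX j; pose tup (u : U) := [tuple X u 0 k | k < d].
have mtup : measurable_fun setT tup.
  apply/measurable_fun_tnthP => k.
  rewrite (_ : _ \o _ = fun u => X u 0 k)//.
  by apply/funext => u; rewrite /= tnth_mktuple.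
have := measurableT_comp (C_meas j) (measurable_fun_pair ms mtup).
congr (measurable_fun _ _); apply/funext => u /=; congr (C _ _ 0 j).
by apply/rowP => k; rewrite mxE tnth_mktuple.
Qed.

Lemma compressor_vmeas (J : set I) (X : Om -> 'rV[R]_d) : J i -> vmeas G J X ->
  vmeas G J (fun o => C (xi o) (X o)).
Proof. by move=> Ji mX; apply: (@C_comp _ (OmJ J)) => //; exact: source_measurable. Qed.

Let err_meas (X : Om -> 'rV[R]_d) : vmeas G (~` [set i]) X ->
  vmeasurable (fun p : T * S => C p.2 (X p.1) - X p.1).
Proof.
move=> mX j.
have mX1 : vmeasurable (fun p : T * S => X p.1).
  by move=> k; exact: (measurableT_comp (mX k) measurable_fst).
rewrite (_ : (fun _ => _) = (fun p : T * S => C p.2 (X p.1) 0 j - X p.1 0 j)).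
  apply: measurable_funB; last exact: mX1.
  exact: (C_comp measurable_snd mX1 j).
by apply/funext => p; rewrite !mxE.
Qed.

Let dotv_meas (dU : measure_display) (U : measurableType dU) (X Y : U -> 'rV[R]_d) :
  vmeasurable X -> vmeasurable Y -> measurable_fun setT (fun u => dotv (X u) (Y u)).
Proof.
move=> mX mY; apply: measurable_sum => j.
by apply: measurable_funM; [exact: mX|exact: mY].
Qed.

(** Freezing the input yields the bound pointwise and produces integrability of the error at the
    same time. With c = omega it serves the unbiased compressors, with c = 1 - alpha the contractive
    one. *)
Lemma second_moment_bound (c : R) (X : Om -> 'rV[R]_d) : 0 <= c ->
  (forall x, (\int[nu]_s (sqn (C s x - x))%:E <= (c * sqn x)%:E)%E) ->
  L2 P G (~` [set i]) X ->
  integ P (fun o => sqn (C (xi o) (X o) - X o)) /\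
  Ex P (fun o => sqn (C (xi o) (X o) - X o)) <= c * Ex P (fun o => sqn (X o)).
Proof.
move=> c0 hC [mX iX].
pose phi (p : T * S) := (sqn (C p.2 (X p.1) - X p.1))%:E.
have mphi : measurable_fun setT phi.
  by apply/measurable_EFinP; apply: dotv_meas; exact: err_meas.
have phi0 p : (0 <= phi p)%E by rewrite lee_fin sqn_ge0.
have frz := freezing_ge0 coarse_meas xi_meas coarse_indep mphi phi0.
have icX := integZ c iX.
have le : (\int[P]_o (sqn (C (xi o) (X o) - X o))%:E <= (c * Ex P (fun o => sqn (X o)))%:E)%E.
  rewrite -ExZ// -EFin_Ex//; rewrite [leLHS]frz; apply: ge0_le_integral => //.
  - by move=> o _; apply: integral_ge0 => s _.
  - apply: (@measurableT_comp _ _ _ _ _ _ (fun o : T => (\int[nu]_s phi (o, s))%E)) => //.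
    exact: measurable_fun_fubini_tonelli_F.
  - exact/measurable_EFinP/(integ_meas icX).
  - move=> o _; exact: (hC (X o)).
have ie : integ P (fun o => sqn (C (xi o) (X o) - X o)).
  apply/integrableP; split.
    exact: (measurableT_comp mphi (measurable_fun_pair coarse_meas xi_meas)).
  under eq_integral => o _ do rewrite /= ger0_norm ?sqn_ge0//.
  by apply: le_lt_trans le _; rewrite ltry.
split=> //; by rewrite -lee_fin -EFin_Ex.
Qed.

Lemma L2_error (J : set I) (c : R) (X : Om -> 'rV[R]_d) : 0 <= c ->
  (forall x, (\int[nu]_s (sqn (C s x - x))%:E <= (c * sqn x)%:E)%E) ->
  L2 P G (~` [set i]) X -> J i -> vmeas G J X ->
  L2 P G J (fun o => C (xi o) (X o) - X o).
Proof.
move=> c0 hC LX Ji mX; split; last by have [] := second_moment_bound c0 hC LX.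
apply: vmeasD; first exact: compressor_vmeas.
rewrite (_ : (fun _ => _) = (fun o => -1 *: X o)); first exact: vmeasZ.
by apply/funext => o; rewrite scaleN1r.
Qed.

(** Both X and Y are frozen; the inner integral over the seed then vanishes coordinate by
    coordinate, by unbiasedness. *)
Lemma error_orthogonal (om : R) (X Y : Om -> 'rV[R]_d) : 0 <= om -> in_U nu C om ->
  L2 P G (~` [set i]) X -> L2 P G (~` [set i]) Y ->
  Ex P (fun o => dotv (C (xi o) (X o) - X o) (Y o)) = 0.
Proof.
move=> om0 CU LX LY; have [mX _] := LX; have [mY _] := LY.
pose phi (p : T * S) := (dotv (C p.2 (X p.1) - X p.1) (Y p.1))%:E.
have mphi : measurable_fun setT phi.
  apply/measurable_EFinP; apply: dotv_meas; first exact: err_meas.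
  by move=> j; exact: (measurableT_comp (mY j) measurable_fst).
have LN : L2 P G setT (fun o => C (xi o) (X o) - X o).
  apply: (@L2_error _ om) => //; first by move=> x; have [] := CU x.
  exact: vmeas_mono mX.
have ip : integ P (fun o => dotv (C (xi o) (X o) - X o) (Y o)).
  exact: (integ_dotv G_measurable LN LY).
have frz := freezing_integrable coarse_meas xi_meas coarse_indep mphi ip.
apply: EFin_inj; rewrite -EFin_Ex// [LHS]frz.
rewrite [LHS](_ : _ = \int[P]_o (cst 0 o))%E; last first.
  apply: eq_integral => o _; rewrite /phi /=.
  have iC j : integ nu (fun s => C s (X o) 0 j) by have [/(_ j)[]] := CU (X o).
  have eC j : Ex nu (fun s => C s (X o) 0 j) = X o 0 j.
    by apply: EFin_inj; rewrite -EFin_Ex//; have [/(_ j)[]] := CU (X o).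
  have it j : integ nu (fun s => Y o 0 j * (C s (X o) 0 j - X o 0 j)).
    by apply: integZ; apply: integB => //; exact: integC.
  rewrite [LHS](_ : _ = \int[nu]_s (\sum_j Y o 0 j * (C s (X o) 0 j - X o 0 j))%:E)%E; last first.
    apply: eq_integral => s _; congr (_%:E); apply: eq_bigr => j _.
    by rewrite !mxE mulrC.
  rewrite EFin_Ex; last exact: integ_sum.
  rewrite Ex_sum// big1// => j _; rewrite ExZ; last by apply: integB => //; exact: integC.
  by rewrite ExB//; [rewrite eC ExC subrr mulr0|exact: integC].
by rewrite integral_cst// mul0e.
Qed.

End Compressor.

End OneSource.

Section Coin.
Variables (i : I) (c : Om -> bool) (p : R).
Hypothesis c_meas : measurable_fun setT c.
Hypothesis c_source : sigma_of c `<=` G i.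
Hypothesis c_law : P (c @^-1` [set true]) = p%:E.

HB.instance Definition _ := isMeasurableFun.Build _ _ _ _ c c_meas.

Let T := OmJ (~` [set i]).
Let coarse : Om -> T := id.
Let coarse_meas : measurable_fun setT coarse.
Proof. by move=> _ A mA; rewrite setTI; exact: (sources_sub_measurable G_measurable) mA. Qed.

Let nu := distribution P c.

Let coarse_indep A B : measurable A -> measurable B ->
  P (coarse @^-1` A `&` c @^-1` B) = (P (coarse @^-1` A) * nu B)%E.
Proof.
move=> mA mB; apply: (independent_of_others G_algebra G_measurable G_indep mA).
by apply: c_source; exists B.
Qed.

Let Ex_bool (a b : R) : (\int[nu]_s (if s then a else b)%:E)%E = (p * a + (1 - p) * b)%:E.
Proof.
have i1 : integ nu (\1_[set true] : bool -> R) by exact: integrable_indic.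
have e : (fun s : bool => if s then a else b) =
         (fun s => b + (a - b) * \1_[set true] s).
  apply/funext => -[]; rewrite indicE.
    by rewrite mem_set// mulr1 addrC subrK.
  by rewrite memNset// mulr0 addr0.
have Ex1 : Ex nu (\1_[set true] : bool -> R) = p.
  by apply: EFin_inj; rewrite -EFin_Ex// integral_indic// setIT.
rewrite EFin_Ex e; last by apply: integD; [exact: integC|exact: integZ].
rewrite ExD; [|exact: integC|exact: integZ].
by rewrite ExC ExZ// Ex1; congr (_%:E); ring.
Qed.

(** The coin is a seed with values in [bool], so freezing applies to it as well; nonnegativity gives
    access to the Tonelli form. *)
Lemma Ex_coin (X Y : Om -> R) : smeas G (~` [set i]) X -> smeas G (~` [set i]) Y ->
  integ P X -> integ P Y -> (forall o, 0 <= X o) -> (forall o, 0 <= Y o) ->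
  Ex P (fun o => if c o then X o else Y o) = p * Ex P X + (1 - p) * Ex P Y.
Proof.
move=> mX mY iX iY X0 Y0.
pose phi (q : T * bool) := (if q.2 then X q.1 else Y q.1)%:E.
have mphi : measurable_fun setT phi.
  apply/measurable_EFinP; exact: (measurable_fun_if_pair mX mY).
have phi0 q : (0 <= phi q)%E by rewrite lee_fin; case: q.2.
have frz := freezing_ge0 coarse_meas c_meas coarse_indep mphi phi0.
have ic : integ P (fun o => if c o then X o else Y o).
  apply: (@integ_le _ _ _ _ _ (fun o => X o + Y o)).
  - exact: (measurable_fun_ifT c_meas (integ_meas iX) (integ_meas iY)).
  - exact: integD.
  - by move=> o; rewrite ger0_norm; case: (c o); rewrite ?lerDl ?lerDr.
apply: EFin_inj; rewrite -EFin_Ex// [LHS]frz.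
rewrite [LHS](_ : _ = \int[P]_o (p * X o + (1 - p) * Y o)%:E)%E; last first.
  by apply: eq_integral => o _; exact: (Ex_bool (X o) (Y o)).
by rewrite EFin_Ex; [rewrite ExD ?ExZ//; exact: integZ|apply: integD; exact: integZ].
Qed.

End Coin.
End RandomSources.

(** * The proximal step *)

Section QuadraticProx.
Variables (R : realType) (d : nat).
Implicit Types (g u y x : 'rV[R]_d) (a mu : R).

Definition prox_objective a mu g u y x := dotv g x + a / 2 * sqn (x - u) + mu / 2 * sqn (x - y).
Definition prox_point a mu g u y := (a + mu)^-1 *: (a *: u + mu *: y - g).

(** Completing the square. The equality serves twice: it identifies the minimizer, and taken at x*
    it is the three-point identity of the descent estimate. *)
Lemma prox_objectiveE a mu g u y x : a + mu != 0 ->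
  let m := prox_point a mu g u y in
  prox_objective a mu g u y x = prox_objective a mu g u y m + (a + mu) / 2 * sqn (x - m).
Proof.
move=> amu0 m.
have gE : g = a *: u + mu *: y - (a + mu) *: m.
  by rewrite /m scalerA mulfV// scale1r opprB addrCA subrr addr0.
pose e := x - m.
have xE v : x - v = (m - v) + e by rewrite /e [RHS]addrC addrA subrK.
have gx : dotv g x = dotv g m + dotv g e by rewrite -dotvDr /e [m + _]addrC subrK.
have ge : dotv g e = a * dotv u e + mu * dotv y e - (a + mu) * dotv m e.
  by rewrite {1}gE !dotvDl dotvNl !dotvZl.
rewrite /prox_objective gx ge !xE -/e subrr add0r !sqnD !dotvDl !dotvNl.
by field.
Qed.

Lemma argmin_prox a mu g u y : 0 < a + mu ->
  argmin (prox_objective a mu g u y) = prox_point a mu g u y.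
Proof.
move=> amu; set m := prox_point _ _ _ _ _; rewrite /argmin.
have E x := @prox_objectiveE a mu g u y x (lt0r_neq0 amu).
case: xgetP => [x _ /= xmin|]; last first.
  by move=> /(_ m) [] x /=; rewrite [leRHS]E lerDl mulr_ge0 ?sqn_ge0// divr_ge0// ltW.
have := xmin m; rewrite E -/m gerDl pmulr_rle0 ?divr_gt0// => le0.
have : sqn (x - m) == 0 by rewrite eq_le le0 sqn_ge0.
by rewrite sqn_eq0 subr_eq0 => /eqP.
Qed.

End QuadraticProx.

(** [largest_root] is a choice with a default value, so a largest root has to be exhibited: [r]
    comes from the quadratic formula, and beyond it the polynomial increases. *)
Lemma largest_rootP (R : realType) (a b c : R) : 0 < a -> 0 < b -> 0 < c ->
  let t := largest_root a b c in 0 < t /\ a * t ^+ 2 + b * t = c.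
Proof.
move=> a0 b0 c0.
pose s := Num.sqrt (b ^+ 2 + 4 * a * c).
have s2 : s ^+ 2 = b ^+ 2 + 4 * a * c.
  by rewrite sqr_sqrtr// addr_ge0 ?sqr_ge0// !mulr_ge0// ltW.
have sb : b < s.
  rewrite -(@ltr_pXn2r _ 2)// ?nnegrE ?sqrtr_ge0 ?(ltW b0)// s2 ltrDl !mulr_gt0//.
pose r := (s - b) / (2 * a).
have r0 : 0 < r by rewrite divr_gt0 ?mulr_gt0// subr_gt0.
have rE : a * r ^+ 2 + b * r = c.
  have -> : a * r ^+ 2 + b * r = (s ^+ 2 - b ^+ 2) / (4 * a).
    by rewrite /r; field; rewrite gt_eqF.
  by rewrite s2; field; rewrite gt_eqF.
rewrite /largest_root; case: xgetP => [t _ /= [tE tmax]|/(_ r) []]; last first.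
  split=> [|t tE]; first by rewrite rE subrr.
  rewrite leNgt; apply/negP => rt; have : c < a * t ^+ 2 + b * t; last by lra.
  have : r ^+ 2 < t ^+ 2 by rewrite ltr_pXn2r// ?nnegrE ltW//; exact: lt_trans rt.
  rewrite -rE; nra.
split; last by lra.
by apply: lt_le_trans r0 _; apply: tmax; rewrite rE subrr.
Qed.

(** * Averages over the workers and the pointwise descent inequality *)

Section Averages.
Variables (R : realType) (n d : nat) (f : 'I_n -> 'rV[R]_d -> R).
Variable grad : 'I_n -> 'rV[R]_d -> 'rV[R]_d.

Let gf x := avgv (fun i => grad i x).

Lemma avgv_dotv (F : 'I_n -> 'rV[R]_d) x : dotv (avgv F) x = n%:R^-1 * \sum_i dotv (F i) x.
Proof. by rewrite /avgv dotvZl dotv_suml. Qed.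

Lemma bregman_avg x y :
  bregman (avgf f) gf x y = n%:R^-1 * \sum_i bregman (f i) (grad i) x y.
Proof. by rewrite /bregman avgv_dotv /avgf -!mulrBr !sumrB. Qed.

Lemma le_avg (a b : 'I_n -> R) : (forall i, a i <= b i) ->
  n%:R^-1 * \sum_i a i <= n%:R^-1 * \sum_i b i.
Proof. by move=> ab; rewrite ler_wpM2l ?invr_ge0 ?ler0n//; exact: ler_sum. Qed.

Lemma avg_cocoercive (Li : 'I_n -> R) x y :
  (forall i, smooth_with (f i) (grad i) (Li i)) -> (forall i, convex_fun (f i)) ->
  n%:R^-1 * \sum_i sqn (grad i x - grad i y) <= 2 * Lmax_of Li * bregman (avgf f) gf x y.
Proof.
move=> sm cv; rewrite bregman_avg [leRHS]mulrCA [in leRHS]mulr_sumr; apply: le_avg => i.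
have LiM : Li i <= Lmax_of Li by apply: le_bigmax.
have M0 : 0 <= Lmax_of Li by apply: bigmax_ge_id.
apply: cocoercive => //; have [h lip] := sm i; split=> // u v.
by apply: le_trans (lip _ _) _; rewrite ler_wpM2r// sqrtr_ge0.
Qed.

End Averages.

(** Smoothness is used between y and x', whose difference is theta (u' - w), and the linear term is
    split by x' - y = theta (u' - y) + (1 - theta)(z - y). The z part is f z - f y minus a Bregman
    term; the u' part is handled by the prox identity at x*. The prox point [ub] does not involve N,
    so its inner product with N will average to zero, and passing from u' to [ub] costs only (a +
    mu)^-1 |N|^2. *)
Lemma descent_pointwise (R : realType) (d : nat) (f : 'rV[R]_d -> R)
  (gf : 'rV[R]_d -> 'rV[R]_d) (L mu a th : R) (w z u N xs y u' ub x' : 'rV[R]_d) :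
  0 <= L -> smooth_with f gf L -> strongly_convex mu f -> 0 < a + mu -> 0 <= mu ->
  0 <= th <= 1 ->
  y = th *: w + (1 - th) *: z ->
  u' = prox_point a mu (gf y + N) u y ->
  ub = prox_point a mu (gf y) u y ->
  x' = th *: u' + (1 - th) *: z ->
  f x' - f xs <= (1 - th) * (f z - f xs - bregman f gf z y)
    + th * (a / 2 * sqn (u - xs) - (a + mu) / 2 * sqn (u' - xs) - a / 2 * sqn (u' - u)
            - dotv N (ub - xs) + (a + mu)^-1 * sqn N)
    + L / 2 * th ^+ 2 * sqn (u' - w).
Proof.
move=> L0 fL fmu amu mu0 /andP[th0 th1] yE u'E ubE x'E.
have xyE : x' - y = th *: (u' - w).
  by rewrite x'E yE opprD addrACA subrr addr0 -scalerBr.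
have xyE2 : x' - y = th *: (u' - y) + (1 - th) *: (z - y).
  rewrite x'E !scalerBr [in RHS]addrACA -opprD -[in RHS]scalerDl.
  by rewrite [th + (1 - th)]addrC subrK scale1r.
have h1 := smooth_le y x' fL.
have h2 := strongly_convex_bregman y xs L0 fL fmu.
have h3 := @prox_objectiveE _ _ a mu (gf y + N) u y xs (lt0r_neq0 amu).
have u'xE : u' - xs = (ub - xs) - (a + mu)^-1 *: N.
  rewrite addrAC; congr (_ - _).
  by rewrite u'E ubE /prox_point opprD addrA scalerBr.
have h4 : dotv N (u' - xs) = dotv N (ub - xs) - (a + mu)^-1 * sqn N.
  by rewrite u'xE dotvDr dotvNr dotvZr.
have sq : sqn (x' - y) = th ^+ 2 * sqn (u' - w) by rewrite xyE sqnZ.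
move: h1 h2 h3 h4; rewrite /bregman sq xyE2 /prox_objective -u'E.
rewrite (sqnBC xs u') (sqnBC xs u) !(dotvDr, dotvDl, dotvNr, dotvZr).
have := mulr_ge0 mu0 (sqn_ge0 (u' - y)).
set Dgz := dotv (gf y) z; set Dgy := dotv (gf y) y; set Dgu := dotv (gf y) u'.
set Dgs := dotv (gf y) xs; set DNu := dotv N u'; set DNs := dotv N xs.
move=> s0 h1 h2 h3 h4.
(* Three-point inequality: the term mu/2 |x* - y|^2 of the prox objective is exactly what strong
   convexity at y supplies. *)
have k : f y + (Dgu - Dgy) <= f xs + (a / 2 * sqn (u - xs) - (a + mu) / 2 * sqn (u' - xs)
   - a / 2 * sqn (u' - u) - dotv N (ub - xs) + (a + mu)^-1 * sqn N).
  move: h2 h3 h4 s0; rewrite !dotvDr !dotvNr => h2 h3 h4 s0; rewrite -/DNs; lra.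
have := ler_wpM2l th0 k; rewrite ?dotvDr ?dotvNr -?/DNs => {k}k.
lra.
Qed.

(** * The Lyapunov weights *)

Ltac nonneg := repeat first [assumption | exact: ler0n | exact: ler01
  | apply: ltW; assumption | apply: exprn_ge0 | apply: mulr_ge0
  | rewrite invr_ge0 | apply: addr_ge0].

(** The bookkeeping of the Lyapunov argument. Most coefficients are named by the quantity being
    bounded followed by the one they multiply; the last seven hypotheses compare the total
    coefficients of S, D, UU, W, H, K and V in turn. [sB] bounds the coefficient of S before S is
    traded for 2 UU + 2 W. *)
Lemma descent_combination (R : realFieldType)
  (E E' W W' H H' K K' V V' D S UU N Del del : R)
  (a dD n1 s1 w0 wD wK wN h0 hDel k0 kV kdel v0 vdel vH vDel : R)
  (nD nH DelD DelS delD delS sB wF hF kF vF : R) :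
  E' <= E - a * UU - dD * D + n1 * N + s1 * S ->
  W' <= w0 * W + wD * D + wK * K + wN * N ->
  H' <= h0 * H + hDel * Del ->
  K' <= k0 * K + kV * V + kdel * del ->
  V' <= v0 * V + vdel * del + vH * H + vDel * Del ->
  N <= nD * D + nH * H -> S <= 2 * UU + 2 * W ->
  Del <= DelD * D + DelS * S -> del <= delD * D + delS * S ->
  0 <= n1 + wN -> 0 <= hDel + vDel -> 0 <= kdel + vdel -> 0 <= sB ->
  [/\ 0 <= D, 0 <= S, 0 <= UU & [/\ 0 <= W, 0 <= H, 0 <= K & 0 <= V]] ->
  s1 + (hDel + vDel) * DelS + (kdel + vdel) * delS <= sB ->
  (n1 + wN) * nD + wD + (hDel + vDel) * DelD + (kdel + vdel) * delD <= dD ->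
  2 * sB <= a -> w0 + 2 * sB <= wF ->
  (n1 + wN) * nH + h0 + vH <= hF -> k0 + wK <= kF -> v0 + kV <= vF ->
  E' + W' + H' + K' + V' <= E + wF * W + hF * H + kF * K + vF * V.
Proof.
move=> e1 e2 e3 e4 e5 e6 e7 e8 e9 c1 c2 c3 c4 [D0 S0 U0 [W0 H0 K0 V0]] t1 t2 t3 t4 t5 t6 t7.
have := ler_wpM2l c1 e6; have := ler_wpM2l c2 e8; have := ler_wpM2l c3 e9.
have := ler_wpM2l c4 e7; have := ler_wpM2r S0 t1; have := ler_wpM2r D0 t2.
have := ler_wpM2r U0 t3; have := ler_wpM2r W0 t4; have := ler_wpM2r H0 t5.
have := ler_wpM2r K0 t6; have := ler_wpM2r V0 t7.
lra.
Qed.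

Section Weights.
Variables (R : realFieldType) (L Lm Lb om al p tau be nn eps : R).
Hypotheses (L0 : 0 < L) (Lm0 : 0 <= Lm) (Lb0 : 0 < Lb) (om0 : 0 <= om) (nn0 : 0 < nn).
Hypotheses (al01 : 0 < al <= 1) (p01 : 0 < p <= 1) (tau01 : 0 < tau <= 1) (be01 : 0 < be <= 1).
Hypothesis eps_small : 0 < eps <= (500 * 1000)^-1.

(** [x], [y], [b0], [b2] are terms of the maximum divided by Lbar; [g1] and [g2] are its two
    square-root terms divided by Lbar and then squared. *)
Let x := L / (al * Lb).
Let y := L * p / (al * tau * Lb).
Let b0 := Lm * om / (nn * Lb).
Let b2 := Lm * om * p ^+ 2 / (be ^+ 2 * nn * Lb).
Let g1 := L * Lm * om * p * tau / (al ^+ 2 * be * nn * Lb ^+ 2).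
Let g2 := L * Lm * om * p ^+ 2 * tau / (al ^+ 2 * be ^+ 2 * nn * Lb ^+ 2).
Hypotheses (x_eps : x <= eps) (y_eps : y <= eps) (b0_eps : b0 <= eps) (b2_eps : b2 <= eps).
Hypotheses (g1_eps : g1 <= eps) (g2_eps : g2 <= eps).

(* Each weight is (up to a constant) the smallest one letting the contraction of its own
   term pay for that term's contribution to the others: W must pay for the smoothness error
   L/2 |u' - w|^2, K for the drift of W, V for the refresh of k, and H for the compression
   variance of g and of v. *)
Definition weightW := 8 * L / (al * Lb).
Definition weightK := 6 * weightW / (al * Lb).
Definition weightV := 8 * p * weightK / tau.
Definition weightH := 4 / be * (4 * p * om / (nn * Lb) + 2 * weightV * tau ^+ 2 * om / nn).

Let al0 : 0 < al. Proof. by case/andP: al01. Qed.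
Let p0 : 0 < p. Proof. by case/andP: p01. Qed.
Let tau0 : 0 < tau. Proof. by case/andP: tau01. Qed.
Let be0 : 0 < be. Proof. by case/andP: be01. Qed.

Lemma weightW_ge0 : 0 <= weightW.
Proof. by rewrite /weightW; nonneg. Qed.

Lemma weightK_ge0 : 0 <= weightK.
Proof. by have := weightW_ge0; rewrite /weightK => ?; nonneg. Qed.

Lemma weightV_ge0 : 0 <= weightV.
Proof. by have := weightK_ge0; rewrite /weightV => ?; nonneg. Qed.

Lemma weightH_ge0 : 0 <= weightH.
Proof. by have := weightV_ge0; rewrite /weightH => ?; nonneg. Qed.

Let x0 : 0 <= x. Proof. by rewrite /x; nonneg. Qed.
Let y0 : 0 <= y. Proof. by rewrite /y; nonneg. Qed.
Let b00 : 0 <= b0. Proof. by rewrite /b0; nonneg. Qed.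
Let b20 : 0 <= b2. Proof. by rewrite /b2; nonneg. Qed.
Let g10 : 0 <= g1. Proof. by rewrite /g1; nonneg. Qed.

(** The weights also produce p / beta to the first power, which is not among the terms of the
    maximum: it is the geometric mean of [b0] and [b2]. *)
Let b1 := Lm * om * p / (be * nn * Lb).
Let b1_eps : b1 <= eps.
Proof.
have e : b1 ^+ 2 = b0 * b2 by rewrite /b1 /b0 /b2; field; rewrite !gt_eqF.
have b10 : 0 <= b1 by rewrite /b1; nonneg.
have : b1 ^+ 2 <= eps ^+ 2 by rewrite e expr2 ler_pM.
by rewrite ler_pXn2r ?nnegrE// ltW//; case/andP: eps_small.
Qed.

Let g0 := L * Lm * om * p * tau / (al ^+ 2 * nn * Lb ^+ 2).
Let g0_eps : g0 <= eps.
Proof.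
have -> : g0 = be * g1 by rewrite /g0 /g1; field; rewrite !gt_eqF.
by apply: le_trans g1_eps; rewrite ler_piMl//; case/andP: be01.
Qed.

Let eps1 : eps <= 1 / (500 * 1000).
Proof. by rewrite div1r; case/andP: eps_small. Qed.

Let prod_eps (u v : R) : 0 <= u -> 0 <= v -> u <= eps -> v <= eps -> u * v <= eps.
Proof.
move=> u0 v0 ue ve; apply: le_trans ue; rewrite ler_piMr//.
by apply: le_trans ve _; move: eps1; lra.
Qed.

(** Total coefficient of the Bregman term, after division by p Gamma', against the 1 - theta
    supplied by the descent. *)
Lemma weights_D (th : R) : th <= 1 / 4 ->
  (1 / Lb + weightW / Lb) * (4 * om * Lm / nn) + weightW / Lb * (8 * L / al)
  + (weightH * (1 + 2 * p / be) + weightV * tau ^+ 2 * om / nn * 2) * (4 * Lm)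
  + (weightK * 2 + weightV * (1 + 2 * p / tau)) * (4 * L) <= 1 - th.
Proof.
move=> th4.
(* Every monomial is at most eps and the numerical coefficients add up to 45220, far below 3/4 of
   500000. *)
rewrite [leLHS](_ : _ = 4 * b0 + 32 * (x * b0) + 64 * (x * x) + 64 * b1 + 64 * 192 * g1
  + 128 * b2 + 128 * 192 * g2 + 16 * 192 * g0 + 384 * (x * x) + 8 * 192 * (x * y) + 16 * 192 * (y * y)).
  have := prod_eps x0 b00 x_eps b0_eps; have := prod_eps x0 x0 x_eps x_eps.
  have := prod_eps x0 y0 x_eps y_eps; have := prod_eps y0 y0 y_eps y_eps.
  move: (x * b0) (x * x) (x * y) (y * y) => *.
  move: eps1 b0_eps b1_eps b2_eps g1_eps g2_eps g0_eps; lra.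
rewrite /weightH /weightV /weightK /weightW /x /y /b0 /b1 /b2 /g1 /g2 /g0.
by field; rewrite !gt_eqF.
Qed.

(** One half of L is the smoothness error; the other half is the room left for the drifts of h, k
    and v caused by |u' - w|^2. *)
Lemma weights_S :
  L / 2 + (weightH * (1 + 2 * p / be) + weightV * tau ^+ 2 * om / nn * 2) * (2 * L * Lm)
  + (weightK * 2 + weightV * (1 + 2 * p / tau)) * (2 * L ^+ 2) <= L.
Proof.
rewrite [leLHS](_ : _ = L * (1 / 2 + 32 * b1 + 32 * 192 * g1
  + 64 * b2 + 64 * 192 * g2 + 8 * 192 * g0 + 192 * (x * x) + 4 * 192 * (x * y) + 8 * 192 * (y * y))).
  rewrite -[leRHS]mulr1 ler_pM2l//.
  have := prod_eps x0 x0 x_eps x_eps.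
  have := prod_eps x0 y0 x_eps y_eps; have := prod_eps y0 y0 y_eps y_eps.
  move: (x * x) (x * y) (y * y) => *.
  move: eps1 b0_eps b1_eps b2_eps g1_eps g2_eps g0_eps; lra.
rewrite /weightH /weightV /weightK /weightW /x /y /b0 /b1 /b2 /g1 /g2 /g0.
by field; rewrite !gt_eqF.
Qed.

(** Of the contraction alpha / 2, half is spent on the growth of A, since p theta <= alpha / 4; the
    remaining alpha / 4 pays for S. The same split gives beta / 4 and tau / 4 below, and the 3/4 for
    K, where theta <= 1/4. *)
Lemma weights_W : 2 * L / Lb = weightW * al / 4.
Proof. by rewrite /weightW; field; rewrite !gt_eqF. Qed.

Lemma weightW_le1 : weightW <= 1.
Proof.
have -> : weightW = 8 * x by rewrite /weightW /x; field; rewrite !gt_eqF.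
by move: x_eps eps1; lra.
Qed.

Lemma weights_U : L / Lb <= 1 / 4.
Proof.
have -> : L / Lb = al * x by rewrite /x; field; rewrite !gt_eqF.
have : al * x <= x by rewrite ler_piMl//; case/andP: al01.
by move: x_eps eps1; lra.
Qed.

Lemma weights_H : p * (1 / Lb + weightW / Lb) * (2 * om / nn)
  + weightV * tau ^+ 2 * om / nn * 2 <= weightH * be / 4.
Proof.
have -> : weightH * be / 4 = p * (1 / Lb + 1 / Lb) * (2 * om / nn)
  + weightV * tau ^+ 2 * om / nn * 2.
  by rewrite /weightH; field; rewrite !gt_eqF.
rewrite lerD2r ler_wpM2r//; first by nonneg.
by rewrite ler_pM2l// lerD2l ler_wpM2r ?invr_ge0 ?(ltW Lb0)// weightW_le1.
Qed.

Lemma weights_K : weightW / Lb * (4 / al) <= weightK * (3 / 4).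
Proof.
have -> : weightK * (3 / 4) = weightW / Lb * (4 / al) * (9 / 8).
  by rewrite /weightK; field; rewrite !gt_eqF.
have : 0 <= weightW / Lb * (4 / al) by have := weightW_ge0 => ?; nonneg.
lra.
Qed.

Lemma weights_V : weightV * (tau / 4) = weightK * (2 * p).
Proof. by rewrite /weightV; field; rewrite !gt_eqF. Qed.

End Weights.

(** * Second moments, and the order in which seeds are consumed *)

Section SecondMoments.
Variables (R : realType) (dO : measure_display) (Om : measurableType dO).
Variables (P : probability Om R) (I : Type) (G : I -> set (set Om)).
Hypothesis G_measurable : forall i, G i `<=` measurable.
Variable d : nat.
Implicit Types (J : set I) (X Y : Om -> 'rV[R]_d).

Definition M2 X : R := Ex P (fun o => sqn (X o)).

Lemma M2_ge0 X : 0 <= M2 X.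
Proof. by apply: Ex_ge0 => o; exact: sqn_ge0. Qed.

Lemma M2Z J a X : L2 P G J X -> M2 (fun o => a *: X o) = a ^+ 2 * M2 X.
Proof.
move=> [_ iX]; rewrite /M2 -ExZ//; congr (Ex P _).
by apply/funext => o; rewrite sqnZ.
Qed.

Lemma M2_orth J J' X Y : L2 P G J X -> L2 P G J' Y ->
  Ex P (fun o => dotv (X o) (Y o)) = 0 -> M2 (fun o => X o + Y o) = M2 X + M2 Y.
Proof.
move=> LX LY XY0; have [_ iX] := LX; have [_ iY] := LY.
have iXY := integZ 2 (integ_dotv G_measurable LX LY).
rewrite /M2 (_ : (fun o => sqn (X o + Y o)) =
  fun o => (sqn (X o) + 2 * dotv (X o) (Y o)) + sqn (Y o)); last first.
  by apply/funext => o; rewrite sqnD.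
rewrite ExD//; last exact: integD.
by rewrite ExD// ExZ ?XY0 ?mulr0 ?addr0//; exact: (integ_dotv G_measurable LX LY).
Qed.

Lemma M2_young J s X Y : 0 < s -> L2 P G J X -> L2 P G J Y ->
  M2 (fun o => X o + Y o) <= (1 + s) * M2 X + (1 + s^-1) * M2 Y.
Proof.
move=> s0 LX LY; have [_ iX] := LX; have [_ iY] := LY.
have [_ iXY] := L2D G_measurable LX LY.
rewrite -!ExZ// -ExD; [|exact: integZ..].
apply: Ex_le => //; first by apply: integD; exact: integZ.
by move=> o; exact: sqnD_young.
Qed.

Lemma M2_le2 J X Y : L2 P G J X -> L2 P G J Y ->
  M2 (fun o => X o + Y o) <= 2 * M2 X + 2 * M2 Y.
Proof. by move=> LX LY; have := M2_young ltr01 LX LY; rewrite invr1. Qed.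

Lemma Ex_avg n J (X : 'I_n -> Om -> 'rV[R]_d) : (forall i, L2 P G J (X i)) ->
  integ P (fun o => n%:R^-1 * \sum_i sqn (X i o)) /\
  Ex P (fun o => n%:R^-1 * \sum_i sqn (X i o)) = n%:R^-1 * \sum_i M2 (X i).
Proof.
move=> LX; have iX i : integ P (fun o => sqn (X i o)) by case: (LX i).
have iS := integ_sum iX.
by split; [exact: integZ|rewrite ExZ// Ex_sum].
Qed.

Lemma L2_avg n J (X : 'I_n -> Om -> 'rV[R]_d) : (forall i, L2 P G J (X i)) ->
  L2 P G J (fun o => avgv (fun i => X i o)).
Proof. by move=> LX; apply: (L2Z G_measurable); exact: L2_sum. Qed.

(** The cross terms vanish; this is the origin of the factor 1/n in every variance term. *)
Lemma M2_avg_orth n J (X : 'I_n -> Om -> 'rV[R]_d) : (forall i, L2 P G J (X i)) ->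
  (forall i j, i != j -> Ex P (fun o => dotv (X i o) (X j o)) = 0) ->
  M2 (fun o => avgv (fun i => X i o)) = n%:R^-1 * (n%:R^-1 * \sum_i M2 (X i)).
Proof.
move=> LX ort; have iD i j := integ_dotv G_measurable (LX i) (LX j).
rewrite /M2 (_ : (fun o => _) =
    fun o => n%:R^-1 * (n%:R^-1 * \sum_i \sum_j dotv (X i o) (X j o))); last first.
  apply/funext => o; rewrite /avgv sqnZ expr2 mulrA /sqn dotv_suml; congr (_ * _).
  by apply: eq_bigr => i _; rewrite dotv_sumr.
have iDS i := integ_sum (iD i).
rewrite !ExZ; [|exact: integ_sum|by apply: integZ; exact: integ_sum].
rewrite Ex_sum//; congr (_ * (_ * _)); apply: eq_bigr => i _.
by rewrite Ex_sum// (bigD1 i)//= big1 ?addr0// => j ji; rewrite ort// eq_sym.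
Qed.

Lemma Ex_dotv_avg0 n J J' (X : 'I_n -> Om -> 'rV[R]_d) Y :
  (forall i, L2 P G J (X i)) -> L2 P G J' Y ->
  (forall i, Ex P (fun o => dotv (X i o) (Y o)) = 0) ->
  Ex P (fun o => dotv (avgv (fun i => X i o)) (Y o)) = 0.
Proof.
move=> LX LY ort; have iD i := integ_dotv G_measurable (LX i) LY.
rewrite (_ : (fun o => _) = fun o => n%:R^-1 * \sum_i dotv (X i o) (Y o)); last first.
  by apply/funext => o; rewrite avgv_dotv.
by rewrite ExZ ?Ex_sum//; [rewrite big1 ?mulr0|exact: integ_sum].
Qed.

End SecondMoments.

Section Filtration.
Variable n : nat.

(* Within iteration t the seeds are consumed in the order C^{D,y}, C^P, coin, C^{D,z}. *)
Definition stage (s : rsource n) : nat :=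
  match s with
  | SrcY t _ => 4 * t
  | SrcP t => 4 * t + 1
  | SrcCoin t => 4 * t + 2
  | SrcZ t _ => 4 * t + 3
  end.

Definition upto (k : nat) : set (rsource n) := [set s | (stage s < k)%N].

Lemma upto_mono k k' : (k <= k')%N -> upto k `<=` upto k'.
Proof. by move=> kk' s /leq_trans; apply. Qed.

(** This inclusion is how the order of the seeds is turned into independence. *)
Lemma upto_avoid k s : (k <= stage s)%N -> upto k `<=` ~` [set s].
Proof. by move=> ks s' s'k ss'; move: s'k; rewrite /upto /= ss' ltnNge ks. Qed.

End Filtration.

Lemma sigma_of_algebra (dO dS : measure_display) (O : measurableType dO)
  (S : measurableType dS) (X : O -> S) : sigma_algebra setT (sigma_of X).
Proof.
split.
- by exists set0; [exact: measurable0|exact: preimage_set0].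
- move=> _ [A mA <-]; exists (~` A); first exact: measurableC.
  by rewrite preimage_setC setTD.
- move=> F hF; have [B BP] := choice (fun k => let: ex_intro2 B mB BE := hF k in
    ex_intro (fun B => measurable B /\ X @^-1` B = F k) B (conj mB BE)).
  exists (\bigcup_k B k); first by apply: bigcupT_measurable => k; case: (BP k).
  by rewrite preimage_bigcup; apply: eq_bigcupr => k _; case: (BP k).
Qed.

Section CompressedAverage.
Variables (R : realType) (dO : measure_display) (Om : measurableType dO).
Variables (P : probability Om R) (n d : nat) (G : rsource n -> set (set Om)).
Hypothesis Ga : forall i, sigma_algebra setT (G i).
Hypothesis Gm : forall i, G i `<=` measurable.
Hypothesis Gi : mutually_independent P G.

Variables (dS : measure_display) (S : measurableType dS) (nu : 'I_n -> probability S R).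
Variables (C : 'I_n -> S -> 'rV[R]_d -> 'rV[R]_d) (om : R).
Hypothesis om0 : 0 <= om.
Hypothesis C_meas : forall i, compressor_measurable (C i).
Hypothesis C_U : forall i, in_U (nu i) (C i) om.

Variables (k : nat) (src : 'I_n -> rsource n) (xi : 'I_n -> Om -> S).
Hypothesis src_stage : forall i, stage (src i) = k.
Hypothesis src_inj : injective src.
Hypothesis xi_meas : forall i, measurable_fun setT (xi i).
Hypothesis xi_source : forall i, sigma_of (xi i) `<=` G (src i).
Hypothesis xi_law : forall i A, measurable A -> P (xi i @^-1` A) = nu i A.

Variable X : 'I_n -> Om -> 'rV[R]_d.
Hypothesis LX : forall i, L2 P G (upto k) (X i).

Let N i o := C i (xi i o) (X i o) - X i o.

Let LXi i : L2 P G (~` [set src i]) (X i).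
Proof. by apply: L2_mono (LX i); apply: upto_avoid; rewrite src_stage. Qed.

(** The index set is kept to the past and the worker's own seed. All workers share stage k, and the
    noise of one must be seen not to use the seed of another for the cross terms to vanish. *)
Let L2_noise1 i : L2 P G (upto k `|` [set src i]) (N i).
Proof.
apply: (L2_error Ga Gm Gi (xi_meas i) (@xi_source i) (@xi_law i) (C_meas i) om0 _ (LXi i)).
- by move=> x; have [] := C_U i x.
- by right.
- by case: (LX i) => mX _; apply: vmeas_mono mX => s ?; left.
Qed.

Lemma L2_noise i : L2 P G (upto k.+1) (N i).
Proof.
apply: L2_mono (L2_noise1 i) => s [|->]; last by rewrite /upto /= src_stage.
exact: upto_mono.
Qed.

Lemma M2_noise i : M2 P (N i) <= om * M2 P (X i).
Proof.
have hC x : (\int[nu i]_s (sqn (C i s x - x))%:E <= (om * sqn x)%:E)%E by have [] := C_U i x.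
by have [] := second_moment_bound Ga Gm Gi (xi_meas i) (@xi_source i) (@xi_law i) (C_meas i)
  om0 hC (LXi i).
Qed.

Let noise_orth i Y : L2 P G (~` [set src i]) Y -> Ex P (fun o => dotv (N i o) (Y o)) = 0.
Proof.
exact: (error_orthogonal Ga Gm Gi (xi_meas i) (@xi_source i) (@xi_law i) (C_meas i)
  om0 (C_U i) (LXi i)).
Qed.

Lemma noise_past_orth i Y : L2 P G (upto k) Y -> Ex P (fun o => dotv (N i o) (Y o)) = 0.
Proof. by move=> LY; apply: noise_orth; apply: L2_mono LY; apply: upto_avoid; rewrite src_stage. Qed.

Lemma L2_avg_noise : L2 P G (upto k.+1) (fun o => avgv (fun i => N i o)).
Proof. by apply: (L2_avg Gm) => i; exact: L2_noise. Qed.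

Lemma avg_noise_past_orth Y : L2 P G (upto k) Y ->
  Ex P (fun o => dotv (avgv (fun i => N i o)) (Y o)) = 0.
Proof.
move=> LY; apply: (Ex_dotv_avg0 Gm L2_noise LY) => i.
exact: noise_past_orth.
Qed.

Lemma M2_avg_noise :
  M2 P (fun o => avgv (fun i => N i o)) <= om / n%:R * (n%:R^-1 * \sum_i M2 P (X i)).
Proof.
rewrite (M2_avg_orth Gm L2_noise); last first.
  move=> i j ij; apply: noise_orth; apply: L2_mono (L2_noise1 j) => s [|->].
    by apply: upto_avoid; rewrite src_stage.
  by move=> /src_inj ji; rewrite ji eqxx in ij.
rewrite [om / _]mulrC -!mulrA ler_wpM2l ?invr_ge0 ?ler0n//.
rewrite [leRHS]mulrCA [in leRHS]mulr_sumr; apply: le_avg => i; exact: M2_noise.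
Qed.

End CompressedAverage.

(** * The Lyapunov decrease as an inequality between real numbers *)

Section ScalarStep.
Variables (R : realFieldType) (L Lm Lb om al p tau be nn eps mu Gam th a : R).
Hypotheses (L0 : 0 < L) (Lm0 : 0 <= Lm) (Lb0 : 0 < Lb) (om0 : 0 <= om) (nn0 : 0 < nn).
Hypotheses (mu0 : 0 < mu) (Gam0 : 0 < Gam).
Hypotheses (al01 : 0 < al <= 1) (p01 : 0 < p <= 1) (tau01 : 0 < tau <= 1) (be01 : 0 < be <= 1).
Hypothesis eps_small : 0 < eps <= (500 * 1000)^-1.
Hypothesis x_eps : L / (al * Lb) <= eps.
Hypothesis y_eps : L * p / (al * tau * Lb) <= eps.
Hypothesis b0_eps : Lm * om / (nn * Lb) <= eps.
Hypothesis b2_eps : Lm * om * p ^+ 2 / (be ^+ 2 * nn * Lb) <= eps.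
Hypothesis g1_eps : L * Lm * om * p * tau / (al ^+ 2 * be * nn * Lb ^+ 2) <= eps.
Hypothesis g2_eps : L * Lm * om * p ^+ 2 * tau / (al ^+ 2 * be ^+ 2 * nn * Lb ^+ 2) <= eps.
Hypotheses (th0 : 0 < th) (th4 : th <= 1 / 4).
Hypotheses (th_al : p * th <= al / 4) (th_tau : p * th <= tau / 4) (th_be : p * th <= be / 4).
Hypothesis th_root : p * Lb * Gam * th ^+ 2 <= (Lb + Gam * mu) * (1 - p * th).

Let Gam' := Gam / (1 - p * th).
Let A := Lb + Gam * mu.
Let A' := Lb + Gam' * mu.
Let gam := p * th * Gam'.
Hypothesis aE : a = A / gam.

Let rho := weightW L Lb al.
Let lam := weightK L Lb al.
Let nu := weightV L Lb al p tau.
Let kap := weightH L Lb om al p tau be nn.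

Variables (F U W H K V F' U' W' H' K' V' Fx D S UU N Del del : R).
Hypotheses (D0 : 0 <= D) (S0 : 0 <= S) (UU0 : 0 <= UU) (W0 : 0 <= W) (H0 : 0 <= H).
Hypotheses (K0 : 0 <= K) (V0 : 0 <= V) (N0 : 0 <= N).
Hypothesis F'E : F' = p * Fx + (1 - p) * F.
Hypothesis Fx_le : Fx <= (1 - th) * (F - D)
    + th * (a / 2 * U - (a + mu) / 2 * U' - a / 2 * UU + (a + mu)^-1 * N)
    + L / 2 * th ^+ 2 * S.
Hypothesis N_le : N <= 4 * om * Lm / nn * D + 2 * om / nn * H.
Hypothesis S_le : S <= 2 * UU + 2 * W.
Hypothesis Del_le : Del <= 4 * Lm * D + 2 * L * Lm * th ^+ 2 * S.
Hypothesis del_le : del <= 4 * L * D + 2 * L ^+ 2 * th ^+ 2 * S.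
Hypothesis H_le : H' <= (1 - be / 2) * H + p * (1 + 2 * p / be) * Del.
Hypothesis W_le : W' <= (1 - al / 2) * W
  + (a + mu)^-1 ^+ 2 * (2 / al) * (4 * L * D + 2 * K) + (a + mu)^-1 ^+ 2 * N.
Hypothesis K_le : K' <= (1 - p) * K + 2 * p * V + 2 * p * del.
Hypothesis V_le : V' <= (1 - tau / 2) * V + p * (1 + 2 * p / tau) * del
  + tau ^+ 2 * om / nn * (2 * H + 2 * p * Del).

Let al0 : 0 < al. Proof. by case/andP: al01. Qed.
Let p0 : 0 < p. Proof. by case/andP: p01. Qed.
Let p1 : p <= 1. Proof. by case/andP: p01. Qed.
Let tau0 : 0 < tau. Proof. by case/andP: tau01. Qed.
Let be0 : 0 < be. Proof. by case/andP: be01. Qed.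
Let pth : 0 < 1 - p * th. Proof. by case/andP: al01 => _ h; move: th_al; lra. Qed.
Let Gam'0 : 0 < Gam'. Proof. by rewrite /Gam' divr_gt0. Qed.
Let A0 : 0 < A. Proof. by rewrite /A addr_gt0// mulr_gt0. Qed.
Let A'0 : 0 < A'. Proof. by rewrite /A' addr_gt0// mulr_gt0. Qed.
Let gam0 : 0 < gam. Proof. exact: mulr_gt0 (mulr_gt0 p0 th0) Gam'0. Qed.
Let GamE : Gam = Gam' * (1 - p * th). Proof. by rewrite /Gam' divfK// gt_eqF. Qed.
Let agam : gam * a = A. Proof. by rewrite aE mulrC divfK// gt_eqF. Qed.
(** Gamma' = Gamma + gam gives A' = A + gam mu: multiplied by gam, the prox weights a and a + mu
    become consecutive values of A, so the |u - x*|^2 terms telescope. *)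
Let amugam : gam * (a + mu) = A'.
Proof. by rewrite mulrDr agam /A /A' GamE /gam; ring. Qed.
Let amu0 : 0 < a + mu. Proof. by rewrite -(pmulr_rgt0 _ gam0) amugam. Qed.

Let rho0 : 0 <= rho. Proof. exact: weightW_ge0. Qed.
Let lam0 : 0 <= lam. Proof. exact: weightK_ge0. Qed.
Let nu0 : 0 <= nu. Proof. exact: weightV_ge0. Qed.
Let kap0 : 0 <= kap. Proof. exact: weightH_ge0. Qed.
Let rho1 : rho <= 1. Proof. exact: (weightW_le1 Lb0 al01 eps_small x_eps). Qed.

Let Gth : p * Gam' * th ^+ 2 <= A / Lb.
Proof.
rewrite ler_pdivlMr// -(ler_pM2r pth).
apply: le_trans th_root; rewrite GamE le_eqVlt; apply/orP; left; apply/eqP; ring.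
Qed.

(** The noise enters with factor gam / (a + mu) = gam^2 / A'. The quadratic for theta bounds gam^2
    by p Gamma' A / Lbar, and A <= A'. *)
Let gam_le : gam * (a + mu)^-1 <= p * Gam' / Lb.
Proof.
have -> : gam * (a + mu)^-1 = gam ^+ 2 / A'.
  by rewrite -amugam; field; rewrite !gt_eqF.
rewrite ler_pdivrMr// [leRHS]mulrAC ler_pdivlMr//.
have AA' : A <= A'.
  rewrite /A' lerD2l ler_pM2r// {1}GamE; apply: ler_piMr; first exact: ltW.
  by rewrite gerBl ltW// mulr_gt0.
have -> : gam ^+ 2 * Lb = p * Gam' * (p * Gam' * th ^+ 2 * Lb) by rewrite /gam; ring.
apply: ler_wpM2l; first by rewrite mulr_ge0// ltW.
by apply: le_trans AA'; move: Gth; rewrite ler_pdivlMr.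
Qed.

(** With F' = p Fx + (1 - p) F, the total coefficient of F is Gamma' (1 - p theta) = Gamma; this is
    what dictates the growth of Gamma. *)
Let E_le : Gam' * F' + A' / 2 * U' <= (Gam * F + A / 2 * U) - A / 2 * UU
  - p * Gam' * (1 - th) * D + p * Gam' / Lb * N + p * Gam' * th ^+ 2 * (L / 2) * S.
Proof.
have pG : 0 <= p * Gam' by rewrite mulr_ge0// ltW.
have h1 := ler_wpM2l pG Fx_le; have h2 := ler_wpM2r N0 gam_le.
have e : p * Gam' * ((1 - th) * (F - D)
    + th * (a / 2 * U - (a + mu) / 2 * U' - a / 2 * UU + (a + mu)^-1 * N)
    + L / 2 * th ^+ 2 * S) = p * Gam' * (1 - th) * (F - D)
    + (gam * a / 2 * U - gam * (a + mu) / 2 * U' - gam * a / 2 * UU + gam * (a + mu)^-1 * N)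
    + p * Gam' * th ^+ 2 * (L / 2) * S.
  by rewrite /gam; move: ((a + mu)^-1) => r; ring.
rewrite e agam amugam in h1.
rewrite F'E {1}GamE; lra.
Qed.

Let wN := rho * (p * Gam' / Lb).
Let wN0 : 0 <= wN.
Proof. by rewrite /wN; have ? := Gam'0; nonneg. Qed.

(** A' (a + mu)^-2 equals gam (a + mu)^-1, so [gam_le] controls the errors of u - w exactly as it
    controls the noise. *)
Let Wt_le : rho * A' * W' <= rho * A' * (1 - al / 2) * W + wN * (8 * L / al) * D
   + wN * (4 / al) * K + wN * N.
Proof.
have rA : 0 <= rho * A' by rewrite mulr_ge0// ltW.
have := ler_wpM2l rA W_le.
have X0 : 0 <= (2 / al) * (4 * L * D + 2 * K) + N.
  by nonneg.
have := ler_wpM2r X0 (ler_wpM2l rho0 gam_le); rewrite -/wN.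
have -> : rho * A' * ((1 - al / 2) * W
  + (a + mu)^-1 ^+ 2 * (2 / al) * (4 * L * D + 2 * K) + (a + mu)^-1 ^+ 2 * N)
  = rho * A' * (1 - al / 2) * W
  + rho * (gam * (a + mu)^-1) * ((2 / al) * (4 * L * D + 2 * K) + N).
  by rewrite -amugam; field; rewrite !gt_eqF.
have -> : wN * (2 / al * (4 * L * D + 2 * K) + N)
  = wN * (8 * L / al) * D + wN * (4 / al) * K + wN * N by field; rewrite gt_eqF.
move: (rho * (gam * _) * _) => X h1 h2; lra.
Qed.

Lemma scalar_step :
  (Gam' * F' + A' / 2 * U') + rho * A' * W' + kap * Gam' * H' + lam * Gam' * K' + nu * Gam' * V'
  <= (Gam * F + A / 2 * U) + rho * A * W + kap * Gam * H + lam * Gam * K + nu * Gam * V.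
Proof.
have kG : 0 <= kap * Gam' by rewrite mulr_ge0// ltW.
have lG : 0 <= lam * Gam' by rewrite mulr_ge0// ltW.
have nG : 0 <= nu * Gam' by rewrite mulr_ge0// ltW.
have pG : 0 < p * Gam' by rewrite mulr_gt0.
have H1 : kap * Gam' * H' <= kap * Gam' * (1 - be / 2) * H
    + kap * Gam' * (p * (1 + 2 * p / be)) * Del.
  by have := ler_wpM2l kG H_le; move: (1 + 2 * p / be) => r; lra.
have K1 : lam * Gam' * K' <= lam * Gam' * (1 - p) * K + lam * Gam' * (2 * p) * V
    + lam * Gam' * (2 * p) * del.
  by have := ler_wpM2l lG K_le; lra.
have V1 : nu * Gam' * V' <= nu * Gam' * (1 - tau / 2) * V
    + nu * Gam' * (p * (1 + 2 * p / tau)) * del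
    + nu * Gam' * (tau ^+ 2 * om / nn * 2) * H
    + nu * Gam' * (tau ^+ 2 * om / nn * (2 * p)) * Del.
  by have := ler_wpM2l nG V_le; move: (1 + 2 * p / tau) (tau ^+ 2 * om / nn) => r1 r2; lra.
have wS := weights_S L0 Lm0 Lb0 om0 nn0 al01 p01 tau01 be01 eps_small x_eps y_eps b0_eps b2_eps g1_eps g2_eps.
have wD := weights_D L0 Lm0 Lb0 om0 nn0 al01 p01 tau01 be01 eps_small x_eps y_eps b0_eps b2_eps g1_eps g2_eps th4.
have wU := weights_U L0 Lb0 al01 eps_small x_eps.
have wW := weights_W L Lb0 al01.
have wH := weights_H tau Lb0 om0 nn0 al01 p01 be01 eps_small x_eps.
have wK := weights_K L0 Lb0 al01.
have wV := weights_V L Lb al p tau01.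
rewrite -/rho -/lam -/nu -/kap in wS wD wW wH wK wV.
have sB0 : 0 <= A * (L / Lb) by rewrite mulr_ge0 ?divr_ge0// ltW.
apply: (@descent_combination _ _ _ _ _ _ _ _ _ _ _ D S UU N Del del (A / 2)
  (p * Gam' * (1 - th)) (p * Gam' / Lb) (p * Gam' * th ^+ 2 * (L / 2))
  (rho * A' * (1 - al / 2)) (wN * (8 * L / al)) (wN * (4 / al)) wN
  (kap * Gam' * (1 - be / 2)) (kap * Gam' * (p * (1 + 2 * p / be)))
  (lam * Gam' * (1 - p)) (lam * Gam' * (2 * p)) (lam * Gam' * (2 * p))
  (nu * Gam' * (1 - tau / 2)) (nu * Gam' * (p * (1 + 2 * p / tau)))
  (nu * Gam' * (tau ^+ 2 * om / nn * 2)) (nu * Gam' * (tau ^+ 2 * om / nn * (2 * p)))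
  (4 * om * Lm / nn) (2 * om / nn) (4 * Lm) (2 * L * Lm * th ^+ 2)
  (4 * L) (2 * L ^+ 2 * th ^+ 2) (A * (L / Lb))) => //.
- by rewrite addr_ge0// divr_ge0// ltW.
- by nonneg.
- by nonneg.
(* Coefficient of S: with p Gamma' theta^2 factored out, the bracket is at most L, and the quadratic
   for theta turns the product into A L / Lbar. *)
- apply: le_trans (_ : p * Gam' * th ^+ 2 * L <= _); last first.
    have -> : A * (L / Lb) = A / Lb * L by rewrite mulrA mulrAC.
    by apply: ler_wpM2r Gth; exact: ltW.
  have X0 : 0 <= p * Gam' * th ^+ 2 by rewrite mulr_ge0 ?sqr_ge0 ?ltW.
  apply: le_trans (ler_wpM2l X0 wS).
  rewrite le_eqVlt; apply/orP; left; apply/eqP.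
  by move: (1 + 2 * p / be) (1 + 2 * p / tau) (nn^-1) => r1 r2 r3; ring.
- apply: le_trans (ler_wpM2l (ltW pG) wD).
  rewrite le_eqVlt; apply/orP; left; apply/eqP; rewrite /wN.
  by move: (1 + 2 * p / be) (1 + 2 * p / tau) (nn^-1) (Lb^-1) (al^-1) => r1 r2 r3 r4 r5; ring.
- have := ler_wpM2l (ltW A0) wU; lra.
- have h1 : A' * (1 - p * th) <= A.
    have -> : A' * (1 - p * th) = Lb * (1 - p * th) + Gam * mu by rewrite /A' [in RHS]GamE; ring.
    by rewrite lerD2r ler_piMr ?(ltW Lb0)// gerBl ltW// mulr_gt0.
  (* The growth of A uses up half of the contraction: 1 - alpha/2 <= (1 - alpha/4)^2, and 1 -
     alpha/4 <= 1 - p theta. *)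
  have h2 : A' * (1 - al / 2) <= A * (1 - al / 4).
    have q1 : 0 <= 1 - al / 4 by case/andP: al01 => _; lra.
    apply: le_trans (ler_wpM2r q1 h1); rewrite -mulrA; apply: ler_wpM2l; first exact: ltW.
    apply: le_trans (_ : (1 - al / 4) * (1 - al / 4) <= _).
      by have := sqr_ge0 al; lra.
    by apply: ler_wpM2r => //; rewrite lerD2l lerN2.
  have := ler_wpM2l rho0 h2.
  have -> : 2 * (A * (L / Lb)) = A * (2 * L / Lb) by rewrite mulrCA !mulrA.
  rewrite wW.
  by lra.
- have h1 := ler_wpM2l (ltW Gam'0) wH; have h2 := ler_wpM2l kG th_be.
  rewrite GamE /wN; move: h1 h2; move: (nn^-1) (Lb^-1) (Gam') => r3 r4 g; lra.
- have h1 := ler_wpM2l (ltW pG) wK; have h2 := ler_wpM2l (mulr_ge0 lG (ltW p0)) th4.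
  rewrite GamE /wN; move: h1 h2; move: (al^-1) (Lb^-1) (Gam') => r3 r4 g; lra.
- have h2 := ler_wpM2l nG th_tau; have h1 : nu * Gam' * (tau / 4) = lam * Gam' * (2 * p).
    by rewrite mulrAC wV mulrAC.
  rewrite GamE; move: h1 h2; move: (Gam') => g; lra.
Qed.

End ScalarStep.

Ltac integrable_sum := repeat first [assumption | apply: integD | apply: integN
  | apply: integZ | exact: integC].

(** * One iteration *)

Section ScalarBounds.
Variable R : realFieldType.
Implicit Types (p s r m b V H K D S A L c t : R).

(** The change D occurs only with probability p, so the Young parameter s inflates V by p s only.
    The choice s = b / (2 p) makes this b / 2 at the price p (1 + 2 p / b). *)
Lemma mix_le p s r m V D : 0 <= p -> m <= (1 + s) * V + (1 + r) * D ->
  p * m + (1 - p) * V <= (1 + p * s) * V + p * (1 + r) * D.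
Proof. by move=> p0 /(ler_wpM2l p0); lra. Qed.

Lemma contract_le b m V c : 0 <= b <= 1 -> 0 <= V -> 0 <= c ->
  m <= (1 + b / 2) * V + c -> (1 - b) * m <= (1 - b / 2) * V + c.
Proof.
move=> /andP[b0 b1] V0 c0 mV; have b1' : 0 <= 1 - b by lra.
have := ler_wpM2l b1' mV; have := mulr_ge0 (sqr_ge0 b) V0; have := mulr_ge0 b0 c0.
lra.
Qed.

Lemma two_steps_le L A b m1 m2 D S t : 0 <= A -> m1 <= 2 * A * b -> b <= L / 2 * (t * S) ->
  m2 <= 2 * A * D -> 2 * m1 + 2 * m2 <= 4 * A * D + 2 * L * A * t * S.
Proof. by move=> A0 h1 /(ler_wpM2l A0) h2 h3; lra. Qed.

Lemma one_step_le L m Y D K : m <= 2 * L * D -> Y <= 2 * m + 2 * K -> Y <= 4 * L * D + 2 * K.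
Proof. by lra. Qed.

Lemma coin_le p m K V D : 0 <= p -> m <= 2 * D + 2 * V ->
  p * m + (1 - p) * K <= (1 - p) * K + 2 * p * V + 2 * p * D.
Proof. by move=> p0 /(ler_wpM2l p0); lra. Qed.

Lemma double_le p m H D : p <= 1 -> 0 <= H -> m <= (1 + p * 1) * H + p * (1 + 1) * D ->
  m <= 2 * H + 2 * p * D.
Proof. by move=> p1 /(ler_wpM2r)/(_ _ _ p1); lra. Qed.

End ScalarBounds.

Section SmoothGap.
Variables (R : realType) (dO : measure_display) (Om : measurableType dO).
Variables (P : probability Om R) (I : Type) (G : I -> set (set Om)).
Hypothesis Gm : forall i, G i `<=` measurable.
Variables (d : nat) (f : 'rV[R]_d -> R) (g : 'rV[R]_d -> 'rV[R]_d) (L : R) (xs : 'rV[R]_d).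
Hypothesis fL : smooth_with f g L.
Hypothesis f_min : forall x, f xs <= f x.

Lemma smooth_continuous : continuous f.
Proof. by move=> x; case: fL => /(_ x)[df _] _; exact: differentiable_continuous. Qed.

Lemma smeas_gap J X : vmeas G J X -> smeas G J (fun o => f (X o) - f xs).
Proof.
move=> mX; apply: measurable_funB; last exact: measurable_cst.
exact: (vmeasurable_continuous smooth_continuous mX).
Qed.

(** Minimality makes the gap nonnegative, and smoothness at x* dominates it by a quadratic in X -
    x*. *)
Lemma integ_gap J X : L2 P G J X -> integ P (fun o => f (X o) - f xs).
Proof.
move=> LX; have LX2 := L2B Gm LX (L2_cst P G J xs); have [mX _] := LX.
apply: (@integ_le _ _ _ _ _ (fun o => dotv (X o - xs) (g xs) + L / 2 * sqn (X o - xs))).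
- exact: (smeas_measurable Gm (smeas_gap mX)).
- apply: integD; first exact: (integ_dotv Gm LX2 (L2_cst P G J (g xs))).
  by apply: integZ; case: LX2.
- move=> o; rewrite ger0_norm ?subr_ge0//.
  have := smooth_le xs (X o) fL; rewrite /bregman (dotvC (g xs)); lra.
Qed.

End SmoothGap.

Section OneStep.
Variables (R : realType) (n d : nat).
Hypothesis n0 : (0 < n)%N.
Variables (f : 'I_n -> 'rV[R]_d -> R) (grad : 'I_n -> 'rV[R]_d -> 'rV[R]_d).
Variables (Li : 'I_n -> R) (L mu : R) (xs : 'rV[R]_d).
Let fb := avgf f.
Let gf x := avgv (fun i => grad i x).
Let Lm := Lmax_of Li.
Hypothesis f_smooth : forall i, smooth_with (f i) (grad i) (Li i).
Hypothesis fb_smooth : smooth_with fb gf L.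
Hypothesis f_convex : forall i, convex_fun (f i).
Hypothesis L0 : 0 < L.
Hypothesis mu0 : 0 < mu.
Hypothesis fb_strong : strongly_convex mu fb.
Hypothesis fb_min : forall x, fb xs <= fb x.

Variables (om al p tau : R).
Hypothesis om0 : 0 <= om.
Hypothesis al01 : 0 < al <= 1.
Hypothesis p01 : 0 < p <= 1.
Hypothesis tau01 : 0 < tau <= 1.
Let be := (om + 1)^-1.

Variables (dO : measure_display) (Om : measurableType dO) (P : probability Om R).
Variable G : rsource n -> set (set Om).
Hypothesis Ga : forall i, sigma_algebra setT (G i).
Hypothesis Gm : forall i, G i `<=` measurable.
Hypothesis Gi : mutually_independent P G.
Variables (dy dz dp : measure_display).
Variables (Sy : measurableType dy) (Sz : measurableType dz) (SP : measurableType dp).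
Variables (muy : 'I_n -> probability Sy R) (muz : 'I_n -> probability Sz R).
Variable muP : probability SP R.
Variables (Cy : 'I_n -> Sy -> 'rV[R]_d -> 'rV[R]_d) (Cz : 'I_n -> Sz -> 'rV[R]_d -> 'rV[R]_d).
Variable CP : SP -> 'rV[R]_d -> 'rV[R]_d.
Hypothesis Cy_meas : forall i, compressor_measurable (Cy i).
Hypothesis Cz_meas : forall i, compressor_measurable (Cz i).
Hypothesis CP_meas : compressor_measurable CP.
Hypothesis Cy_U : forall i, in_U (muy i) (Cy i) om.
Hypothesis Cz_U : forall i, in_U (muz i) (Cz i) om.
Hypothesis CP_B : in_B muP CP al.

Variable t : nat.
Variables (xiy : 'I_n -> Om -> Sy) (xiz : 'I_n -> Om -> Sz) (xip : Om -> SP) (coin : Om -> bool).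
Hypothesis xiy_meas : forall i, measurable_fun setT (xiy i).
Hypothesis xiz_meas : forall i, measurable_fun setT (xiz i).
Hypothesis xip_meas : measurable_fun setT xip.
Hypothesis coin_meas : measurable_fun setT coin.
Hypothesis xiy_source : forall i, sigma_of (xiy i) `<=` G (SrcY t i).
Hypothesis xiz_source : forall i, sigma_of (xiz i) `<=` G (SrcZ t i).
Hypothesis xip_source : sigma_of xip `<=` G (SrcP n t).
Hypothesis coin_source : sigma_of coin `<=` G (SrcCoin n t).
Hypothesis xiy_law : forall i A, measurable A -> P (xiy i @^-1` A) = muy i A.
Hypothesis xiz_law : forall i A, measurable A -> P (xiz i @^-1` A) = muz i A.
Hypothesis xip_law : forall A, measurable A -> P (xip @^-1` A) = muP A.
Hypothesis coin_law : P (coin @^-1` [set true]) = p%:E.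

Variables (th a : R).
Hypothesis th01 : 0 <= th <= 1.
Hypothesis a0 : 0 < a.

Variables (w z u k v : Om -> 'rV[R]_d) (hi : 'I_n -> Om -> 'rV[R]_d).
Local Notation k0 := (4 * t)%N.
Local Notation L2u k := (@L2 R dO Om P (rsource n) G d (upto k)).
Hypothesis Lw : L2u k0 w.
Hypothesis Lz : L2u k0 z.
Hypothesis Lu : L2u k0 u.
Hypothesis Lk : L2u k0 k.
Hypothesis Lv : L2u k0 v.
Hypothesis Lhi : forall i, L2u k0 (hi i).

Let y o := th *: w o + (1 - th) *: z o.
Let Ny i o := Cy i (xiy i o) (grad i (y o) - hi i o) - (grad i (y o) - hi i o).
Let N o := avgv (fun i => Ny i o).
Let u' o := prox_point a mu (gf (y o) + N o) (u o) (y o).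
Let ub o := prox_point a mu (gf (y o)) (u o) (y o).
Let q o := prox_point a mu (k o) (w o) (y o).
Let w' o := q o + CP (xip o) (u' o - q o).
Let x' o := th *: u' o + (1 - th) *: z o.
Let k' o := if coin o then v o else k o.
Let z' o := if coin o then x' o else z o.
Let Z i o := grad i (z' o) - hi i o.
Let M i o := Cz i (xiz i o) (Z i o) - Z i o.
Let hi' i o := hi i o + be *: (Z i o + M i o).
Let v' o := (1 - tau) *: v o + tau *: (gf (z' o) + avgv (fun i => M i o)).

Let Lm0 : 0 <= Lm. Proof. exact: bigmax_ge_id. Qed.

Let gradL i x1 x2 : enorm (grad i x1 - grad i x2) <= Lm * enorm (x1 - x2).
Proof.
have [_ lip] := f_smooth i; apply: le_trans (lip _ _) _.
by rewrite ler_wpM2r ?sqrtr_ge0//; apply: le_bigmax.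
Qed.

Let gfL x1 x2 : enorm (gf x1 - gf x2) <= L * enorm (x1 - x2).
Proof. by case: fb_smooth. Qed.

Let up (j m : nat) X : (j <= m)%N -> L2u j X -> L2u m X.
Proof. by move=> jm; apply: L2_mono; exact: upto_mono. Qed.

Let L2grad i j X : L2u j X -> L2u j (fun o => grad i (X o)).
Proof. exact: (L2_lipschitz Gm Lm0 (gradL i)). Qed.

Let L2gf j X : L2u j X -> L2u j (fun o => gf (X o)).
Proof. exact: (L2_lipschitz Gm (ltW L0) gfL). Qed.

Let amu0 : 0 < a + mu. Proof. exact: addr_gt0. Qed.

Let L2prox j g1 u1 y1 : L2u j g1 -> L2u j u1 -> L2u j y1 ->
  L2u j (fun o => prox_point a mu (g1 o) (u1 o) (y1 o)).
Proof.
move=> L1 L2' L3; apply: (L2Z Gm); apply: (L2B Gm) => //.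
by apply: (L2D Gm); exact: (L2Z Gm).
Qed.

Let Ly : L2u k0 y. Proof. by apply: (L2D Gm); exact: (L2Z Gm). Qed.

Let LX i : L2u k0 (fun o => grad i (y o) - hi i o).
Proof. by apply: (L2B Gm) => //; exact: L2grad. Qed.

Let stageY (i : 'I_n) : stage (SrcY t i) = k0. Proof. by []. Qed.
Let injY : injective (SrcY t : 'I_n -> rsource n). Proof. by move=> i j []. Qed.
Let stageZ (i : 'I_n) : stage (SrcZ t i) = (k0 + 3)%N. Proof. by []. Qed.
Let injZ : injective (SrcZ t : 'I_n -> rsource n). Proof. by move=> i j []. Qed.

Let LN : L2u k0.+1 N.
Proof. exact: (L2_avg_noise Ga Gm Gi om0 Cy_meas Cy_U stageY xiy_meas xiy_source xiy_law LX). Qed.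

Let Lub : L2u k0 ub. Proof. by apply: L2prox => //; exact: L2gf. Qed.
Let Lq : L2u k0 q. Proof. exact: L2prox. Qed.

Let Lu' : L2u k0.+1 u'.
Proof.
apply: L2prox; [apply: (L2D Gm) => //|exact: up Lu|exact: up Ly].
by apply: up (L2gf Ly).
Qed.

Let Lx' : L2u k0.+1 x'.
Proof. by apply: (L2D Gm); apply: (L2Z Gm) => //; exact: up Lz. Qed.

Let Luq : L2u k0.+1 (fun o => u' o - q o).
Proof. by apply: (L2B Gm) => //; exact: up Lq. Qed.

Let al1 : 0 <= 1 - al. Proof. by rewrite subr_ge0; case/andP: al01. Qed.

Let Lqerr : L2u (k0 + 2) (fun o => CP (xip o) (u' o - q o) - (u' o - q o)).
Proof.
apply: (@L2_mono _ _ _ _ _ _ _ (upto k0.+1 `|` [set SrcP n t])).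
  by move=> s [|->]; [apply: upto_mono; rewrite addn2 ltnW|rewrite /upto /= addn1 addn2].
have av : upto k0.+1 `<=` ~` [set SrcP n t] by apply: upto_avoid; rewrite /= addn1.
apply: (L2_error Ga Gm Gi xip_meas xip_source xip_law CP_meas al1 CP_B (L2_mono av Luq)).
  by right.
by case: Luq => mX _; apply: vmeas_mono mX => s ?; left.
Qed.

Lemma L2_w' : L2u (k0 + 2) w'.
Proof.
rewrite (_ : w' = fun o => (CP (xip o) (u' o - q o) - (u' o - q o)) + u' o); last first.
  by apply/funext => o; rewrite /w' opprB addrA subrK addrC.
by apply: (L2D Gm) => //; apply: up Lu'; rewrite addn2 ltnW.
Qed.

Let coinm : measurable_fun [set: g_sigma_algebraType (sources G (upto (k0 + 3)))]
  (coin : g_sigma_algebraType (sources G (upto (k0 + 3))) -> bool).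
Proof. by apply: (source_measurable coin_source); rewrite /upto /= addn2 addn3. Qed.

Lemma L2_z' : L2u (k0 + 3) z'.
Proof.
apply: (L2_if Gm) => //; last by apply: up Lz; rewrite leq_addr.
by apply: up Lx'; rewrite addn3; do 2!apply: leqW.
Qed.

Lemma L2_k' : L2u (k0 + 3) k'.
Proof. by apply: (L2_if Gm) => //; [apply: up Lv|apply: up Lk]; rewrite leq_addr. Qed.

Let LZ i : L2u (k0 + 3) (Z i).
Proof.
apply: (L2B Gm); first by apply: L2grad; exact: L2_z'.
by apply: up (Lhi i); rewrite leq_addr.
Qed.

Let LM i : L2u (k0 + 3).+1 (M i).
Proof. exact: (L2_noise Ga Gm Gi om0 Cz_meas Cz_U stageZ xiz_meas xiz_source xiz_law LZ). Qed.

Let LMb : L2u (k0 + 3).+1 (fun o => avgv (fun i => M i o)).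
Proof. exact: (L2_avg_noise Ga Gm Gi om0 Cz_meas Cz_U stageZ xiz_meas xiz_source xiz_law LZ). Qed.

Lemma L2_hi' i : L2u (k0 + 3).+1 (hi' i).
Proof.
apply: (L2D Gm); first by apply: up (Lhi i); rewrite -addnS leq_addr.
by apply: (L2Z Gm); apply: (L2D Gm) => //; apply: up (LZ i).
Qed.

Lemma L2_v' : L2u (k0 + 3).+1 v'.
Proof.
apply: (L2D Gm); apply: (L2Z Gm); first by apply: up Lv; rewrite -addnS leq_addr.
by apply: (L2D Gm) => //; apply: (up _ (L2gf L2_z')).
Qed.

Lemma L2_u' : L2u (k0 + 3).+1 u'.
Proof. by apply: up Lu'; rewrite ltnS leq_addr. Qed.

Let Fq := Ex P (fun o => fb (z o) - fb xs).
Let Uq := M2 P (fun o => u o - xs).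
Let Wq := M2 P (fun o => u o - w o).
Let Hq := n%:R^-1 * \sum_i M2 P (fun o => hi i o - grad i (z o)).
Let Kq := M2 P (fun o => gf (z o) - k o).
Let Vq := M2 P (fun o => v o - gf (z o)).
Let Fq' := Ex P (fun o => fb (z' o) - fb xs).
Let Uq' := M2 P (fun o => u' o - xs).
Let Wq' := M2 P (fun o => u' o - w' o).
Let Hq' := n%:R^-1 * \sum_i M2 P (fun o => hi' i o - grad i (z' o)).
Let Kq' := M2 P (fun o => gf (z' o) - k' o).
Let Vq' := M2 P (fun o => v' o - gf (z' o)).
Let Dq := Ex P (fun o => bregman fb gf (z o) (y o)).
Let Sq := M2 P (fun o => u' o - w o).
Let UUq := M2 P (fun o => u' o - u o).
Let Nq := M2 P N.
(** Drift of the gradients from z to the candidate x', before the coin; the probability p enters in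
    [ZZ_bound], [k_bound] and [v_bound]. *)
Let Delq := n%:R^-1 * \sum_i M2 P (fun o => grad i (x' o) - grad i (z o)).
Let delq := M2 P (fun o => gf (x' o) - gf (z o)).
Let ZZq := n%:R^-1 * \sum_i M2 P (Z i).

Let smeas_fb j X : L2u j X -> smeas G (upto j) (fun o => fb (X o) - fb xs).
Proof. by case=> mX _; exact: (smeas_gap xs fb_smooth mX). Qed.

Let integ_fb j X : L2u j X -> integ P (fun o => fb (X o) - fb xs).
Proof. exact: (integ_gap Gm fb_smooth fb_min). Qed.

Let integ_breg j X Y : L2u j X -> L2u j Y -> integ P (fun o => bregman fb gf (X o) (Y o)).
Proof.
move=> L1 L2'; rewrite (_ : (fun o => _) = fun o => (fb (X o) - fb xs) - (fb (Y o) - fb xs)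
   - dotv (gf (Y o)) (X o - Y o)).
  apply: integB; first by apply: integB; apply: integ_fb; eauto.
  by apply: (integ_dotv Gm (L2gf L2')); exact: (L2B Gm L1 L2').
by apply/funext => o; rewrite /bregman; ring.
Qed.

Let coin_M2 A B : L2u (k0 + 2) A -> L2u (k0 + 2) B ->
  M2 P (fun o => if coin o then A o else B o) = p * M2 P A + (1 - p) * M2 P B.
Proof.
have av : upto (k0 + 2) `<=` ~` [set SrcCoin n t] by apply: upto_avoid.
move=> [mA iA] [mB iB].
have sA : smeas G (~` [set SrcCoin n t]) (fun o => sqn (A o)).
  by apply: smeas_dotv; exact: vmeas_mono mA.
have sB : smeas G (~` [set SrcCoin n t]) (fun o => sqn (B o)).
  by apply: smeas_dotv; exact: vmeas_mono mB.
rewrite -(Ex_coin Ga Gm Gi coin_meas coin_source coin_law sA sB iA iB)//.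
- by congr (Ex P _); apply/funext => o; case: (coin o).
- by move=> o; exact: sqn_ge0.
- by move=> o; exact: sqn_ge0.
Qed.

Let Lx'2 : L2u (k0 + 2) x'. Proof. by apply: up Lx'; rewrite addn2 ltnW. Qed.
Let Lz2 : L2u (k0 + 2) z. Proof. by apply: up Lz; rewrite leq_addr. Qed.
Let Lv2 : L2u (k0 + 2) v. Proof. by apply: up Lv; rewrite leq_addr. Qed.
Let Lk2 : L2u (k0 + 2) k. Proof. by apply: up Lk; rewrite leq_addr. Qed.
Let Lhi2 i : L2u (k0 + 2) (hi i). Proof. by apply: up (Lhi i); rewrite leq_addr. Qed.

Let coin_fb : Fq' = p * Ex P (fun o => fb (x' o) - fb xs) + (1 - p) * Fq.
Proof.
have av : upto (k0 + 2) `<=` ~` [set SrcCoin n t] by apply: upto_avoid.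
rewrite -(Ex_coin Ga Gm Gi coin_meas coin_source coin_law (smeas_mono av (smeas_fb Lx'2))
  (smeas_mono av (smeas_fb Lz2)) (integ_fb Lx'2) (integ_fb Lz2)).
- by congr (Ex P _); apply/funext => o; rewrite /z'; case: (coin o).
- by move=> o; rewrite subr_ge0.
- by move=> o; rewrite subr_ge0.
Qed.

Lemma step_descent : Ex P (fun o => fb (x' o) - fb xs) <= (1 - th) * (Fq - Dq)
    + th * (a / 2 * Uq - (a + mu) / 2 * Uq' - a / 2 * UUq + (a + mu)^-1 * Nq)
    + L / 2 * th ^+ 2 * Sq.
Proof.
(* [ub] is determined before the seeds behind N are drawn. *)
have ort : Ex P (fun o => dotv (N o) (ub o - xs)) = 0.
  apply: (avg_noise_past_orth Ga Gm Gi om0 Cy_meas Cy_U stageY xiy_meas xiy_source xiy_law LX).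
  exact: (L2B Gm Lub (L2_cst _ _ _ _)).
have Lus j X : L2u j X -> L2u j (fun o => X o - xs).
  by move=> LX'; exact: (L2B Gm LX' (L2_cst _ _ _ _)).
have iF := integ_fb Lz; have iD := integ_breg Lz Ly; have iF' := integ_fb Lx'.
have [_ iU] := Lus _ _ Lu; have [_ iU'] := Lus _ _ Lu'.
have [_ iUU] : L2u k0.+1 (fun o => u' o - u o) by apply: (L2B Gm Lu'); exact: up Lu.
have [_ iS] : L2u k0.+1 (fun o => u' o - w o) by apply: (L2B Gm Lu'); exact: up Lw.
have [_ iN] := LN.
have iO : integ P (fun o => dotv (N o) (ub o - xs)) by exact: (integ_dotv Gm LN (Lus _ _ Lub)).
have -> : (1 - th) * (Fq - Dq)
    + th * (a / 2 * Uq - (a + mu) / 2 * Uq' - a / 2 * UUq + (a + mu)^-1 * Nq)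
    + L / 2 * th ^+ 2 * Sq = Ex P (fun o =>
    (1 - th) * (fb (z o) - fb xs - bregman fb gf (z o) (y o))
    + th * (a / 2 * sqn (u o - xs) - (a + mu) / 2 * sqn (u' o - xs) - a / 2 * sqn (u' o - u o)
            - dotv (N o) (ub o - xs) + (a + mu)^-1 * sqn (N o))
    + L / 2 * th ^+ 2 * sqn (u' o - w o)).
  rewrite ExD; [|by integrable_sum..]; rewrite ExD; [|by integrable_sum..].
  congr (_ + _ + _).
  - by rewrite ExZ; [|by integrable_sum..]; rewrite ExB.
  - rewrite ExZ; [|by integrable_sum..]; congr (_ * _).
    rewrite ExD; [|by integrable_sum..]; rewrite ExB; [|by integrable_sum..].
    rewrite ort subr0 ExB; [|by integrable_sum..]; rewrite ExB; [|by integrable_sum..].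
    by rewrite !ExZ.
  - by rewrite ExZ.
apply: Ex_le; [by []|by integrable_sum|] => o.
by apply: (descent_pointwise _ (ltW L0) fb_smooth fb_strong amu0 (ltW mu0) th01).
Qed.

Let eqM2 A B : (forall o, A o = B o) -> M2 P A = M2 P (B : Om -> 'rV[R]_d).
Proof. by move=> AB; congr (M2 P _); apply/funext. Qed.

Let M2BC A B : M2 P (fun o => A o - B o) = M2 P (fun o => B o - A o : 'rV[R]_d).
Proof. by congr (Ex P _); apply/funext => o; exact: sqnBC. Qed.

Let fb_convex : convex_fun fb.
Proof.
move=> x1 x2 l l01; apply: le_trans (fb_strong x1 x2 l01) _.
case/andP: l01 => l0 l1; rewrite gerBl !mulr_ge0 ?sqn_ge0 ?(ltW mu0) ?subr_ge0 ?invr_ge0//.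
Qed.

Let Lyu : L2u k0.+1 y. Proof. exact: up Ly. Qed.
Let Lzu : L2u k0.+1 z. Proof. exact: up Lz. Qed.

Let M2_grad_le j A B : L2u j A -> L2u j B ->
  n%:R^-1 * \sum_i M2 P (fun o => grad i (A o) - grad i (B o))
  <= 2 * Lm * Ex P (fun o => bregman fb gf (A o) (B o)).
Proof.
move=> LA LB; have iB := integ_breg LA LB.
have LD i : L2u j (fun o => grad i (A o) - grad i (B o)).
  by apply: (L2B Gm); exact: L2grad.
have [iS <-] := Ex_avg LD.
rewrite -ExZ//; apply: Ex_le => //; first exact: integZ.
by move=> o; exact: avg_cocoercive.
Qed.

Let M2_gf_le j A B : L2u j A -> L2u j B ->
  M2 P (fun o => gf (A o) - gf (B o)) <= 2 * L * Ex P (fun o => bregman fb gf (A o) (B o)).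
Proof.
move=> LA LB; have iB := integ_breg LA LB.
have [_ iD] := L2B Gm (L2gf LA) (L2gf LB).
rewrite -ExZ//; apply: Ex_le => //; first exact: integZ.
by move=> o; apply: (cocoercive _ _ (ltW L0) fb_smooth fb_convex).
Qed.

Let breg_x'y : Ex P (fun o => bregman fb gf (x' o) (y o)) <= L / 2 * (th ^+ 2 * Sq).
Proof.
have LS : L2u k0.+1 (fun o => u' o - w o) by apply: (L2B Gm Lu'); exact: up Lw.
rewrite -(M2Z th LS); have [_ iS] := L2Z Gm th LS; rewrite /M2 -ExZ//.
apply: Ex_le; [exact: integ_breg Lx' Lyu|exact: integZ|] => o.
apply: le_trans (smooth_le _ _ fb_smooth) _.
by rewrite /x' /y opprD addrACA subrr addr0 -scalerBr.
Qed.

Let avg_young j s (A B : 'I_n -> Om -> 'rV[R]_d) : 0 < s ->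
  (forall i, L2u j (A i)) -> (forall i, L2u j (B i)) ->
  n%:R^-1 * \sum_i M2 P (fun o => A i o + B i o) <=
  (1 + s) * (n%:R^-1 * \sum_i M2 P (A i)) + (1 + s^-1) * (n%:R^-1 * \sum_i M2 P (B i)).
Proof.
move=> s0 LA LB; rewrite mulrCA [X in _ <= _ + X]mulrCA -mulrDr !mulr_sumr -big_split/=.
by rewrite -mulr_sumr; apply: le_avg => i; exact: M2_young.
Qed.

(** The compressed vectors are split at grad f_i(z), because the shifts h_i track z and D_f(z, y) is
    the Bregman term that the descent makes available. *)
Lemma noise_bound : Nq <= 4 * om * Lm / n%:R * Dq + 2 * om / n%:R * Hq.
Proof.
have h1 := M2_avg_noise Ga Gm Gi om0 Cy_meas Cy_U stageY injY xiy_meas xiy_source xiy_law LX.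
have LA i : L2u k0 (fun o => grad i (y o) - grad i (z o)).
  by apply: (L2B Gm); exact: L2grad.
have LB i : L2u k0 (fun o => grad i (z o) - hi i o) by apply: (L2B Gm) => //; exact: L2grad.
have h2 := avg_young ltr01 LA LB; rewrite invr1 in h2.
have h3 := M2_grad_le Lz Ly; rewrite -/Dq in h3.
have e1 : \sum_i M2 P (fun o => grad i (y o) - hi i o) =
  \sum_i M2 P (fun o => grad i (y o) - grad i (z o) + (grad i (z o) - hi i o)).
  by apply: eq_bigr => i _; apply: eqM2 => o; rewrite addrA subrK.
have e2 : \sum_i M2 P (fun o => grad i (y o) - grad i (z o)) =
  \sum_i M2 P (fun o => grad i (z o) - grad i (y o)).
  by apply: eq_bigr => i _; exact: M2BC.
have e3 : n%:R^-1 * \sum_i M2 P (fun o => grad i (z o) - hi i o) = Hq.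
  by congr (_ * _); apply: eq_bigr => i _; exact: M2BC.
rewrite e2 e3 -e1 in h2; apply: le_trans h1 _.
have on0 : 0 <= om / n%:R by rewrite divr_ge0.
have h4 := one_step_le h3 h2; apply: le_trans (ler_wpM2l on0 h4) _.
by rewrite le_eqVlt; apply/orP; left; apply/eqP; move: (Dq) (Hq) (n%:R^-1) => D H r; ring.
Qed.

Lemma server_gap_bound : Sq <= 2 * UUq + 2 * Wq.
Proof.
rewrite /Sq (@eqM2 _ (fun o => (u' o - u o) + (u o - w o))); last first.
  by move=> o; rewrite addrA subrK.
apply: (M2_le2 Gm (J := upto k0.+1)); first by apply: (L2B Gm Lu'); exact: up Lu.
by apply: (@up k0) => //; exact: (L2B Gm).
Qed.

(** The path from x' to z goes through y: D_f(x', y) is small because x' - y = theta (u' - w), and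
    D_f(z, y) is available from the descent. *)
Lemma Del_bound : Delq <= 4 * Lm * Dq + 2 * L * Lm * th ^+ 2 * Sq.
Proof.
have LA i : L2u k0.+1 (fun o => grad i (x' o) - grad i (y o)).
  by apply: (L2B Gm); apply: L2grad.
have LB i : L2u k0.+1 (fun o => grad i (y o) - grad i (z o)).
  by apply: (L2B Gm); apply: L2grad.
have h := avg_young ltr01 LA LB; rewrite invr1 in h.
have e1 : \sum_i M2 P (fun o => grad i (x' o) - grad i (y o) + (grad i (y o) - grad i (z o))) =
  \sum_i M2 P (fun o => grad i (x' o) - grad i (z o)).
  by apply: eq_bigr => i _; apply: eqM2 => o; rewrite addrA subrK.
have e2 : \sum_i M2 P (fun o => grad i (y o) - grad i (z o)) =
  \sum_i M2 P (fun o => grad i (z o) - grad i (y o)).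
  by apply: eq_bigr => i _; exact: M2BC.
rewrite e1 e2 -/Delq in h; apply: le_trans h _.
have h1 := M2_grad_le Lx' Lyu; have h2 := M2_grad_le Lz Ly.
exact: two_steps_le Lm0 h1 breg_x'y h2.
Qed.

Lemma del_bound : delq <= 4 * L * Dq + 2 * L ^+ 2 * th ^+ 2 * Sq.
Proof.
have LA : L2u k0.+1 (fun o => gf (x' o) - gf (y o)) by apply: (L2B Gm); apply: L2gf.
have LB : L2u k0.+1 (fun o => gf (y o) - gf (z o)) by apply: (L2B Gm); apply: L2gf.
have := M2_le2 Gm LA LB.
rewrite (@eqM2 _ (fun o => gf (x' o) - gf (z o))); last by move=> o; rewrite addrA subrK.
rewrite (M2BC (fun o => gf (y o))) -/delq => h; apply: le_trans h _.
have h1 := M2_gf_le Lx' Lyu; have h2 := M2_gf_le Lz Ly.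
by rewrite expr2 mulrA; exact: two_steps_le (ltW L0) h1 breg_x'y h2.
Qed.

Let p0 : 0 < p. Proof. by case/andP: p01. Qed.
Let p1 : p <= 1. Proof. by case/andP: p01. Qed.

Let ZZ_bound s : 0 < s -> ZZq <= (1 + p * s) * Hq + p * (1 + s^-1) * Delq.
Proof.
move=> s0.
have LA i : L2u (k0 + 2) (fun o => grad i (z o) - hi i o).
  by apply: (L2B Gm) => //; exact: L2grad.
have LB i : L2u (k0 + 2) (fun o => grad i (x' o) - grad i (z o)).
  by apply: (L2B Gm); exact: L2grad.
have LC i : L2u (k0 + 2) (fun o => grad i (x' o) - hi i o).
  by apply: (L2B Gm) => //; exact: L2grad.
have h := avg_young s0 LA LB.
have e1 : \sum_i M2 P (fun o => grad i (z o) - hi i o + (grad i (x' o) - grad i (z o))) =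
  \sum_i M2 P (fun o => grad i (x' o) - hi i o).
  by apply: eq_bigr => i _; apply: eqM2 => o; rewrite addrC addrA subrK.
have e3 : n%:R^-1 * \sum_i M2 P (fun o => grad i (z o) - hi i o) = Hq.
  by congr (_ * _); apply: eq_bigr => i _; exact: M2BC.
have e4 : ZZq = p * (n%:R^-1 * \sum_i M2 P (fun o => grad i (x' o) - hi i o)) + (1 - p) * Hq.
  rewrite -e3 mulrCA [X in _ + X]mulrCA -mulrDr !mulr_sumr -big_split/=.
  congr (_ * _); apply: eq_bigr => i _; rewrite -coin_M2//.
  by apply: eqM2 => o; rewrite /Z /z'; case: (coin o).
rewrite e1 e3 -/Delq in h; rewrite e4.
exact: mix_le (ltW p0) h.
Qed.

Let om1 : 0 < om + 1. Proof. by rewrite ltr_wpDl. Qed.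
Let be0 : 0 < be. Proof. by rewrite invr_gt0. Qed.
Let be1 : be <= 1. Proof. by rewrite invf_le1// lerDr. Qed.

Let Hq0 : 0 <= Hq. Proof. by rewrite mulr_ge0 ?invr_ge0// sumr_ge0// => i _; exact: M2_ge0. Qed.
Let Delq0 : 0 <= Delq. Proof. by rewrite mulr_ge0 ?invr_ge0// sumr_ge0// => i _; exact: M2_ge0. Qed.

Lemma shift_bound : Hq' <= (1 - be / 2) * Hq + p * (1 + 2 * p / be) * Delq.
Proof.
have h1 i : M2 P (fun o => hi' i o - grad i (z' o)) <= (1 - be) * M2 P (Z i).
  have LZ' := up (leqnSn _) (LZ i).
  have L1 := L2Z Gm (be - 1) LZ'; have L2' := L2Z Gm be (LM i).
  have ort : Ex P (fun o => dotv (M i o) (Z i o)) = 0.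
    exact: (noise_past_orth Ga Gm Gi om0 Cz_meas Cz_U stageZ xiz_meas xiz_source xiz_law LZ).
  rewrite (@eqM2 _ (fun o => be *: M i o + (be - 1) *: Z i o)); last first.
    move=> o; rewrite /hi' {2}/Z scalerBl scale1r scalerDr !opprB.
    by rewrite -/(Z i o) [in RHS]addrA [be *: M i o + _]addrC -!addrA addrC -!addrA; congr (_ + (_ + _)); rewrite addrC.
  rewrite (M2_orth Gm L2' L1); last first.
    rewrite (_ : (fun o => _) = fun o => (be * (be - 1)) * dotv (M i o) (Z i o)).
      by rewrite ExZ ?ort ?mulr0//; exact: (integ_dotv Gm (LM i) LZ').
    by apply/funext => o; rewrite dotvZl dotvZr mulrA.
  rewrite (M2Z _ (LM i)) (M2Z _ LZ').
  have := M2_noise Ga Gm Gi om0 Cz_meas Cz_U stageZ xiz_meas xiz_source xiz_law LZ i.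
  rewrite -[X in M2 P X]/(M i) => h.
  have := ler_wpM2l (sqr_ge0 be) h.
  (* The choice beta = 1 / (omega + 1) acts here: beta^2 omega + (1 - beta)^2 = 1 - beta. *)
  have -> : (1 - be) * M2 P (Z i) = be ^+ 2 * (om * M2 P (Z i)) + (be - 1) ^+ 2 * M2 P (Z i).
    by rewrite /be; field; rewrite gt_eqF.
  by rewrite lerD2r.
have h2 : Hq' <= (1 - be) * ZZq.
  rewrite /ZZq mulrCA mulr_sumr; exact: le_avg.
have s0 : 0 < be / (2 * p) by rewrite divr_gt0 ?mulr_gt0.
have := ZZ_bound s0.
have -> : p * (be / (2 * p)) = be / 2 by field; rewrite gt_eqF.
have -> : (be / (2 * p))^-1 = 2 * p / be by field; rewrite !gt_eqF.
have c0 : 0 <= p * (1 + 2 * p / be) * Delq by nonneg.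
move=> h3; apply: le_trans h2 _; apply: (contract_le _ Hq0 c0 h3).
by rewrite (ltW be0).
Qed.

(** q is the prox step of u' with (g, u) replaced by (k, w), so u' - q is (a + mu)^-1 times a (u -
    w) minus the gradient mismatch, and compressing this difference gives the factor 1 - alpha. The
    noise is orthogonal to the rest, hence enters with coefficient 1 instead of 1 / alpha. *)
Lemma model_gap_bound : Wq' <= (1 - al / 2) * Wq
  + (a + mu)^-1 ^+ 2 * (2 / al) * (4 * L * Dq + 2 * Kq) + (a + mu)^-1 ^+ 2 * Nq.
Proof.
have al0 : 0 < al by case/andP: al01.
have av : upto k0.+1 `<=` ~` [set SrcP n t] by apply: upto_avoid; rewrite /= addn1.
have h1 : Wq' <= (1 - al) * M2 P (fun o => u' o - q o).
  have [_ h] := second_moment_bound Ga Gm Gi xip_meas xip_source xip_law CP_meas al1 CP_B (L2_mono av Luq).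
  apply: le_trans h; rewrite le_eqVlt; apply/orP; left; apply/eqP.
  congr (Ex P _); apply/funext => o; rewrite sqnBC /w'; congr sqn.
  by rewrite opprD addrA.
have LA : L2u k0 (fun o => (- a) *: (u o - w o)) by apply: (L2Z Gm); exact: (L2B Gm).
have LB : L2u k0 (fun o => gf (y o) - k o) by apply: (L2B Gm) => //; exact: L2gf.
have LR := L2D Gm LA LB.
have h2 : M2 P (fun o => u' o - q o) = (a + mu)^-1 ^+ 2 *
    (Nq + M2 P (fun o => (- a) *: (u o - w o) + (gf (y o) - k o))).
  have ort := avg_noise_past_orth Ga Gm Gi om0 Cy_meas Cy_U stageY xiy_meas xiy_source xiy_law LX LR.
  rewrite -(M2_orth Gm LN LR ort) -sqrrN -(M2Z _ (L2D Gm LN (up (leqnSn _) LR))).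
  apply: eqM2 => o; rewrite /u' /q /prox_point -scalerBr scaleNr -scalerN; congr (_ *: _).
  apply/rowP => j; rewrite !mxE; ring.
(* Young with alpha / 2, because (1 - alpha)(1 + alpha/2) <= 1 - alpha/2 and (1 - alpha)(1 +
   2/alpha) <= 2/alpha. *)
have s0 : 0 < al / 2 by rewrite divr_gt0.
have h3 := M2_young Gm s0 LA LB; rewrite (M2Z _ (L2B Gm Lu Lw)) sqrrN -/Wq in h3.
have h4 : M2 P (fun o => gf (y o) - k o) <= 4 * L * Dq + 2 * Kq.
  have h := M2_le2 Gm (L2B Gm (L2gf Ly) (L2gf Lz)) (L2B Gm (L2gf Lz) Lk).
  rewrite (@eqM2 _ (fun o => gf (y o) - k o)) in h; last by move=> o; rewrite addrA subrK.
  rewrite (M2BC (fun o => gf (y o)) (fun o => gf (z o))) -/Kq in h.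
  exact: one_step_le (M2_gf_le Lz Ly) h.
move: h1; rewrite h2 => h1; apply: le_trans h1 _.
have Y0 := M2_ge0 P (fun o => gf (y o) - k o).
have W0 : 0 <= Wq by exact: M2_ge0.
have N0 : 0 <= Nq by exact: M2_ge0.
have ab : a ^+ 2 * (a + mu)^-1 ^+ 2 <= 1.
  rewrite -exprMn exprn_ile1// ?divr_ge0 ?(ltW a0) ?(ltW amu0)//.
  by rewrite ler_pdivrMr// mul1r lerDl ltW.
set b := (a + mu)^-1 in ab *; have b0 : 0 <= b ^+ 2 by exact: sqr_ge0.
set Y := M2 P (fun o => gf (y o) - k o) in h3 h4 Y0.
set RR := M2 P _ in h3 *.
have {}h3 : (1 - al) * (b ^+ 2 * RR) <= (1 - al) * (1 + al / 2) * (a ^+ 2 * b ^+ 2 * Wq)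
    + (1 - al) * (1 + 2 / al) * (b ^+ 2 * Y).
  move: (ler_wpM2l al1 (ler_wpM2l b0 h3)); rewrite invf_div.
  by move: (b ^+ 2) (RR) (Wq) (Y) (al / 2) (2 / al) => B r W Y' s1 s2; lra.
have c1 : (1 - al) * (1 + al / 2) * (a ^+ 2 * b ^+ 2 * Wq) <= (1 - al / 2) * Wq.
  have c : a ^+ 2 * b ^+ 2 * Wq <= Wq by rewrite ler_piMl.
  apply: le_trans (ler_wpM2l _ c) _; first by rewrite mulr_ge0// addr_ge0// ltW.
  by rewrite ler_wpM2r//; have := sqr_ge0 al; lra.
have c2 : (1 - al) * (1 + 2 / al) * (b ^+ 2 * Y) <= 2 / al * (b ^+ 2 * Y).
  apply: ler_wpM2r; first by rewrite mulr_ge0.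
  have -> : (1 - al) * (1 + 2 / al) = 2 / al - 1 - al by field; rewrite gt_eqF.
  lra.
have c3 : (1 - al) * (b ^+ 2 * Nq) <= b ^+ 2 * Nq.
  by apply: ler_piMl; [exact: mulr_ge0|rewrite gerBl ltW].
have c4 : 2 / al * (b ^+ 2 * Y) <= b ^+ 2 * (2 / al) * (4 * L * Dq + 2 * Kq).
  move: (4 * L * Dq + 2 * Kq) h4 => X h4.
  rewrite mulrA [2 / al * _]mulrC; apply: ler_wpM2l h4.
  by rewrite mulr_ge0// divr_ge0// ltW.
rewrite [b ^+ 2 * (Nq + _)]mulrDr [in leLHS]mulrDr [leRHS]addrC.
exact: lerD c3 (le_trans h3 (lerD c1 (le_trans c2 c4))).
Qed.

Lemma k_bound : Kq' <= (1 - p) * Kq + 2 * p * Vq + 2 * p * delq.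
Proof.
have LA : L2u (k0 + 2) (fun o => gf (x' o) - gf (z o)) by apply: (L2B Gm); exact: L2gf.
have LB : L2u (k0 + 2) (fun o => gf (z o) - v o) by apply: (L2B Gm) => //; exact: L2gf.
have LC : L2u (k0 + 2) (fun o => gf (x' o) - v o) by apply: (L2B Gm) => //; exact: L2gf.
have LD : L2u (k0 + 2) (fun o => gf (z o) - k o) by apply: (L2B Gm) => //; exact: L2gf.
have h := M2_le2 Gm LA LB.
rewrite (@eqM2 _ (fun o => gf (x' o) - v o)) in h; last by move=> o; rewrite addrA subrK.
rewrite (M2BC (fun o => gf (z o))) -/delq -/Vq in h.
have -> : Kq' = p * M2 P (fun o => gf (x' o) - v o) + (1 - p) * Kq.
  rewrite -coin_M2//; apply: eqM2 => o.
  by rewrite /z' /k'; case: (coin o).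
exact: coin_le (ltW p0) h.
Qed.

(** v' - grad f(z') is (1 - tau)(v - grad f(z')) plus tau times an orthogonal compression error: the
    variance is damped by tau^2, while (1 - tau)^2 <= 1 - tau contracts the old error. *)
Lemma v_bound : Vq' <= (1 - tau / 2) * Vq + p * (1 + 2 * p / tau) * delq
  + tau ^+ 2 * om / n%:R * (2 * Hq + 2 * p * Delq).
Proof.
have tau0 : 0 < tau by case/andP: tau01.
have tau1 : 0 <= 1 - tau by rewrite subr_ge0; case/andP: tau01.
pose Mb o := avgv (fun i => M i o).
have Lvz : L2u (k0 + 3) (fun o => v o - gf (z' o)).
  by apply: (L2B Gm); [apply: up Lv; rewrite leq_addr|exact: L2gf L2_z'].
have ort : Ex P (fun o => dotv (Mb o) (v o - gf (z' o))) = 0.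
  exact: (avg_noise_past_orth Ga Gm Gi om0 Cz_meas Cz_U stageZ xiz_meas xiz_source xiz_law LZ Lvz).
have h1 := M2_avg_noise Ga Gm Gi om0 Cz_meas Cz_U stageZ injZ xiz_meas xiz_source xiz_law LZ.
rewrite -[X in M2 P X]/Mb -/ZZq in h1.
have e1 : Vq' = tau ^+ 2 * M2 P Mb + (1 - tau) ^+ 2 * M2 P (fun o => v o - gf (z' o)).
  rewrite -(M2Z _ LMb) -(M2Z _ Lvz) -(M2_orth Gm (L2Z Gm _ LMb) (L2Z Gm _ Lvz)).
    apply: eqM2 => o; rewrite /v' -/(Mb o); apply/rowP => j; rewrite !mxE; ring.
  rewrite (_ : (fun o => _) = fun o => tau * (1 - tau) * dotv (Mb o) (v o - gf (z' o))).
    by rewrite ExZ ?ort ?mulr0//; exact: (integ_dotv Gm LMb Lvz).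
  by apply/funext => o; rewrite dotvZl dotvZr mulrA.
have LA : L2u (k0 + 2) (fun o => v o - gf (z o)) by apply: (L2B Gm) => //; exact: L2gf.
have LB : L2u (k0 + 2) (fun o => gf (z o) - gf (x' o)) by apply: (L2B Gm) => //; exact: L2gf.
have LC : L2u (k0 + 2) (fun o => v o - gf (x' o)) by apply: (L2B Gm) => //; exact: L2gf.
have s0 : 0 < tau / (2 * p) by rewrite divr_gt0 ?mulr_gt0.
have h2 := M2_young Gm s0 LA LB.
rewrite (@eqM2 _ (fun o => v o - gf (x' o))) in h2; last by move=> o; rewrite addrA subrK.
rewrite (M2BC (fun o => gf (z o))) -/delq -/Vq in h2.
have e2 : M2 P (fun o => v o - gf (z' o)) = p * M2 P (fun o => v o - gf (x' o)) + (1 - p) * Vq.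
  by rewrite -coin_M2//; apply: eqM2 => o; rewrite /z'; case: (coin o).
have h3 : M2 P (fun o => v o - gf (z' o)) <= (1 + tau / 2) * Vq + p * (1 + 2 * p / tau) * delq.
  have e3 : p * (tau / (2 * p)) = tau / 2 by field; rewrite gt_eqF.
  have e4 : (tau / (2 * p))^-1 = 2 * p / tau by field; rewrite !gt_eqF.
  rewrite e4 in h2; rewrite e2 -e3; exact: mix_le (ltW p0) h2.
have h4 := ZZ_bound ltr01; rewrite invr1 in h4.
have on0 : 0 <= om / n%:R by rewrite divr_ge0.
have h5 : tau ^+ 2 * M2 P Mb <= tau ^+ 2 * om / n%:R * (2 * Hq + 2 * p * Delq).
  rewrite -mulrA -mulrA ler_wpM2l ?sqr_ge0// mulrA; apply: le_trans h1 _.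
  by rewrite ler_wpM2l//; exact: double_le h4.
rewrite e1 addrC; apply: lerD => //.
have c0 : 0 <= p * (1 + 2 * p / tau) * delq.
  by have ? : 0 <= delq := M2_ge0 P _; nonneg.
have V0 : 0 <= Vq by exact: M2_ge0.
have t1 : (1 - tau) ^+ 2 <= 1 - tau by rewrite expr2 ler_piMl// gerBl ltW.
have m0 : 0 <= M2 P (fun o => v o - gf (z' o)) by exact: M2_ge0.
apply: le_trans (ler_wpM2r m0 t1) _; apply: (contract_le _ V0 c0 h3).
by rewrite (ltW tau0); case/andP: tau01.
Qed.

Variables (Gam Lb eps : R).
Hypotheses (Lb0 : 0 < Lb) (Gam0 : 0 < Gam).
Hypothesis eps_small : 0 < eps <= (500 * 1000)^-1.
Hypothesis x_eps : L / (al * Lb) <= eps.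
Hypothesis y_eps : L * p / (al * tau * Lb) <= eps.
Hypothesis b0_eps : Lm * om / (n%:R * Lb) <= eps.
Hypothesis b2_eps : Lm * om * p ^+ 2 / (be ^+ 2 * n%:R * Lb) <= eps.
Hypothesis g1_eps : L * Lm * om * p * tau / (al ^+ 2 * be * n%:R * Lb ^+ 2) <= eps.
Hypothesis g2_eps : L * Lm * om * p ^+ 2 * tau / (al ^+ 2 * be ^+ 2 * n%:R * Lb ^+ 2) <= eps.
Hypotheses (th0 : 0 < th) (th4 : th <= 1 / 4).
Hypotheses (th_al : p * th <= al / 4) (th_tau : p * th <= tau / 4) (th_be : p * th <= be / 4).
Hypothesis th_root : p * Lb * Gam * th ^+ 2 <= (Lb + Gam * mu) * (1 - p * th).
Hypothesis aE : a = (Lb + Gam * mu) / (p * th * (Gam / (1 - p * th))).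

Let Dq0 : 0 <= Dq.
Proof.
by apply: Ex_ge0 => o; exact: (convex_bregman_ge0 _ _ (ltW L0) fb_smooth fb_convex).
Qed.

Let be01 : 0 < be <= 1. Proof. by rewrite be0 be1. Qed.
Let nn0 : 0 < n%:R :> R. Proof. by rewrite ltr0n. Qed.

Let lyapunov_step : let Gam' := Gam / (1 - p * th) in
  let rho := weightW L Lb al in let lam := weightK L Lb al in
  let nu := weightV L Lb al p tau in let kap := weightH L Lb om al p tau be n%:R in
  (Gam' * Fq' + (Lb + Gam' * mu) / 2 * Uq') + rho * (Lb + Gam' * mu) * Wq'
    + kap * Gam' * Hq' + lam * Gam' * Kq' + nu * Gam' * Vq'
  <= (Gam * Fq + (Lb + Gam * mu) / 2 * Uq) + rho * (Lb + Gam * mu) * Wq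
    + kap * Gam * Hq + lam * Gam * Kq + nu * Gam * Vq.
Proof.
exact: (scalar_step L0 Lm0 Lb0 om0 nn0 mu0 Gam0 al01 p01 tau01 be01 eps_small x_eps y_eps
  b0_eps b2_eps g1_eps g2_eps th0 th4 th_al th_tau th_be th_root aE Dq0 (M2_ge0 P _)
  (M2_ge0 P _) (M2_ge0 P _) Hq0 (M2_ge0 P _) (M2_ge0 P _) (M2_ge0 P _) coin_fb step_descent
  noise_bound server_gap_bound Del_bound del_bound shift_bound model_gap_bound k_bound v_bound).
Qed.

Lemma one_step : let K := (4 * t.+1)%N in
  [/\ L2u K w', L2u K z', L2u K u', L2u K k' & L2u K v'] /\ (forall i, L2u K (hi' i)) /\
  let Gam' := Gam / (1 - p * th) in
  let rho := weightW L Lb al in let lam := weightK L Lb al in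
  let nu := weightV L Lb al p tau in let kap := weightH L Lb om al p tau be n%:R in
  (Gam' * Fq' + (Lb + Gam' * mu) / 2 * Uq') + rho * (Lb + Gam' * mu) * Wq'
    + kap * Gam' * Hq' + lam * Gam' * Kq' + nu * Gam' * Vq'
  <= (Gam * Fq + (Lb + Gam * mu) / 2 * Uq) + rho * (Lb + Gam * mu) * Wq
    + kap * Gam * Hq + lam * Gam * Kq + nu * Gam * Vq.
Proof.
(* The seeds of stage 4 t + 3 are the last ones of iteration t. *)
have KE : (4 * t.+1)%N = (k0 + 3).+1 by rewrite mulnS addnC addnS.
move=> K; rewrite /K KE; split; last by split; [exact: L2_hi'|exact: lyapunov_step].
split; last exact: L2_v'.
- by apply: up L2_w'; rewrite -addnS leq_add2l.
- by apply: up L2_z'.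
- exact: L2_u'.
- by apply: up L2_k'.
Qed.

End OneStep.

(** * The coupling parameter theta *)

Section Theta.
Variables (R : realType) (p mu Lb thmin : R).
Hypotheses (p0 : 0 < p) (mu0 : 0 < mu) (Lb0 : 0 < Lb) (thmin0 : 0 < thmin).

Definition theta (G : R) : R :=
  Num.min (largest_root (p * Lb * G) (p * (Lb + G * mu)) (Lb + G * mu)) thmin.

Variable G : R.
Hypothesis G0 : 0 < G.
Let A := Lb + G * mu.
Let A0 : 0 < A. Proof. exact: addr_gt0 Lb0 (mulr_gt0 G0 mu0). Qed.
Let t := largest_root (p * Lb * G) (p * A) A.

Let t_spec : 0 < t /\ p * Lb * G * t ^+ 2 + p * A * t = A.
Proof. by apply: largest_rootP => //; [exact: mulr_gt0 (mulr_gt0 p0 Lb0) G0|exact: mulr_gt0]. Qed.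

Lemma theta_gt0 : 0 < theta G.
Proof. by have [h _] := t_spec; rewrite lt_min h. Qed.

Lemma theta_le : theta G <= thmin.
Proof. by rewrite ge_min lexx orbT. Qed.

(** At the root this is an equality; capping theta decreases the left side and increases the right
    one. *)
Lemma theta_root : p * Lb * G * theta G ^+ 2 <= A * (1 - p * theta G).
Proof.
have [t0 tE] := t_spec; have th0 := theta_gt0.
have tht : theta G <= t by rewrite ge_min lexx.
have h1 : p * Lb * G * theta G ^+ 2 <= p * Lb * G * t ^+ 2.
  by rewrite ler_pM2l ?ler_pXn2r ?nnegrE ?(ltW t0) ?(ltW th0)//; exact: mulr_gt0 (mulr_gt0 p0 Lb0) G0.
have h2 : p * A * theta G <= p * A * t by rewrite ler_pM2l//; exact: mulr_gt0.
lra.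
Qed.

(* If the root is the active bound and p t < 1/2, the quadratic gives mu/2 <= p Lb t^2. *)
Lemma theta_rate (Q : R) : 0 < Q -> p <= 1 -> thmin <= 1 / 4 -> Q^-1 <= p * thmin ->
  4 * Lb <= p * mu * Q ^+ 2 -> Q^-1 <= p * theta G.
Proof.
move=> Q0 p1 thmin4 Q_thmin Q_Lb; have [t0 tE] := t_spec; rewrite /theta -/A -/t.
have [_|_] := leP t thmin; last exact: Q_thmin.
have [h|h] := leP (1 / 2) (p * t).
  apply: le_trans h; apply: le_trans Q_thmin _.
  have := ler_wpM2l (ltW p0) thmin4; lra.
have h1 : mu / 2 <= p * Lb * t ^+ 2.
  have h2 : G * (mu / 2) <= G * (p * Lb * t ^+ 2).
    have h3 : A / 2 <= A * (1 - p * t) by rewrite ler_pM2l//; lra.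
    have : A = Lb + G * mu by [].
    move: tE Lb0 h3; move: (A) (t) => B r; lra.
  by rewrite ler_pM2l in h2.
have h2 : p * mu / 2 <= Lb * (p * t) ^+ 2.
  have := ler_wpM2l (ltW p0) h1; rewrite exprMn; move: (t) => r; lra.
rewrite -(@ler_pXn2r _ 2)// ?nnegrE ?invr_ge0 ?(ltW Q0) ?mulr_ge0 ?(ltW p0) ?(ltW t0)//.
rewrite exprVn -[leLHS]mul1r ler_pdivrMr ?exprn_gt0//.
rewrite -(ler_pM2l Lb0) mulr1.
have := ler_wpM2r (sqr_ge0 Q) h2; move: Q_Lb.
move: ((p * t) ^+ 2) (Q ^+ 2) Lb0 => T q; lra.
Qed.

End Theta.

(** * Step sizes and the rate *)

Section StepSizes.
Variables (R : realType) (L Lm om al p tau mu : R) (n : nat).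
Hypotheses (L0 : 0 < L) (Lm0 : 0 <= Lm) (om0 : 0 <= om) (mu0 : 0 < mu) (n0 : (0 < n)%N).
Hypotheses (al01 : 0 < al <= 1) (p01 : 0 < p <= 1) (tau01 : 0 < tau <= 1).
Let be := (om + 1)^-1.
Let Lb := Lbar_thm7 L Lm om al p tau be n.
Let c : R := c660508 R.
Let Q := Q_thm7 L Lm om al p tau mu n.
Let thmin := thmin_thm7 al p tau be.

Let al0 : 0 < al. Proof. by case/andP: al01. Qed.
Let p0 : 0 < p. Proof. by case/andP: p01. Qed.
Let tau0 : 0 < tau. Proof. by case/andP: tau01. Qed.
Let om1 : 0 < om + 1. Proof. by rewrite ltr_wpDl. Qed.
Let be0 : 0 < be. Proof. by rewrite invr_gt0. Qed.
Let nn0 : 0 < n%:R :> R. Proof. by rewrite ltr0n. Qed.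

Let c_large : 500 * 1000 <= c. Proof. by rewrite /c /c660508; lra. Qed.
Let c0 : 0 < c. Proof. by move: c_large; lra. Qed.

Lemma eps_small : 0 < c^-1 <= (500 * 1000)^-1.
Proof.
have k0 : 0 < 500 * 1000 :> R by lra.
by rewrite invr_gt0 c0 lef_pV2.
Qed.

Let Lb_ge (s : R) : s <= Lb / c -> c * s <= Lb.
Proof. by rewrite ler_pdivlMr// mulrC. Qed.

Let LbE : Lb / c = Num.max (L / al) (Num.max (L * p / (al * tau))
   (Num.max (Num.sqrt (L * Lm) * p * Num.sqrt (om * tau) / (al * be * Num.sqrt n%:R))
   (Num.max (Num.sqrt (L * Lm) * Num.sqrt p * Num.sqrt (om * tau)
              / (al * Num.sqrt be * Num.sqrt n%:R))
   (Num.max (Lm * om * p ^+ 2 / (be ^+ 2 * n%:R)) (Lm * om / n%:R))))).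
Proof. by rewrite /Lb /Lbar_thm7 -/c mulrC mulKf// gt_eqF. Qed.

Lemma Lbar_gt0 : 0 < Lb.
Proof.
have : L / al <= Lb / c by rewrite LbE !le_max lexx.
move=> /Lb_ge; apply: lt_le_trans; by rewrite mulr_gt0 ?divr_gt0.
Qed.

Let Lb0 := Lbar_gt0.

(** For the two square-root terms of the maximum, which are used squared. Squaring gives c^-2, at
    most c^-1 because c >= 1. *)
Let sqr_bound (s : R) : 0 <= s -> s <= Lb / c -> s ^+ 2 / Lb ^+ 2 <= c^-1.
Proof.
move=> s0 /Lb_ge h; rewrite ler_pdivrMr ?exprn_gt0//.
have : s ^+ 2 <= (c^-1 * Lb) ^+ 2.
  rewrite ler_pXn2r ?nnegrE//; first by rewrite mulrC ler_pdivlMr// mulrC.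
  by rewrite mulr_ge0 ?invr_ge0// ltW.
move=> h2; apply: le_trans h2 _; rewrite exprMn ler_pM2r ?exprn_gt0//.
rewrite expr2 ler_piMl ?invr_ge0 ?(ltW c0)// invf_le1//.
by apply: le_trans c_large; lra.
Qed.

Lemma Lbar_x : L / (al * Lb) <= c^-1.
Proof.
have h : L / al <= Lb / c by rewrite LbE !le_max lexx.
rewrite invfM mulrA ler_pdivrMr//; apply: le_trans h _; by rewrite mulrC.
Qed.

Lemma Lbar_y : L * p / (al * tau * Lb) <= c^-1.
Proof.
have h : L * p / (al * tau) <= Lb / c by rewrite LbE !le_max lexx orbT.
rewrite invfM mulrA ler_pdivrMr//; apply: le_trans h _; by rewrite mulrC.
Qed.

Lemma Lbar_b0 : Lm * om / (n%:R * Lb) <= c^-1.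
Proof.
have h : Lm * om / n%:R <= Lb / c by rewrite LbE !le_max lexx !orbT.
rewrite invfM mulrA ler_pdivrMr//; apply: le_trans h _; by rewrite mulrC.
Qed.

Lemma Lbar_b2 : Lm * om * p ^+ 2 / (be ^+ 2 * n%:R * Lb) <= c^-1.
Proof.
have h : Lm * om * p ^+ 2 / (be ^+ 2 * n%:R) <= Lb / c by rewrite LbE !le_max lexx !orbT.
rewrite invfM mulrA ler_pdivrMr//; apply: le_trans h _; by rewrite mulrC.
Qed.

Lemma Lbar_g1 : L * Lm * om * p * tau / (al ^+ 2 * be * n%:R * Lb ^+ 2) <= c^-1.
Proof.
set s := Num.sqrt (L * Lm) * Num.sqrt p * Num.sqrt (om * tau) / (al * Num.sqrt be * Num.sqrt n%:R).
have s0 : 0 <= s by rewrite /s divr_ge0 ?mulr_ge0 ?sqrtr_ge0// ltW.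
have h : s <= Lb / c by rewrite LbE !le_max lexx !orbT.
apply: le_trans (sqr_bound s0 h); rewrite le_eqVlt; apply/orP; left; apply/eqP.
rewrite /s; move: (Lb) Lb0 (be) be0 => B B0 b b0.
rewrite exprMn exprVn !exprMn !sqr_sqrtr ?mulr_ge0 ?(ltW L0) ?(ltW p0) ?(ltW tau0) ?(ltW b0) ?(ltW nn0)//.
by field; rewrite !gt_eqF.
Qed.

Lemma Lbar_g2 : L * Lm * om * p ^+ 2 * tau / (al ^+ 2 * be ^+ 2 * n%:R * Lb ^+ 2) <= c^-1.
Proof.
set s := Num.sqrt (L * Lm) * p * Num.sqrt (om * tau) / (al * be * Num.sqrt n%:R).
have s0 : 0 <= s by rewrite /s divr_ge0 ?mulr_ge0 ?sqrtr_ge0// ltW.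
have h : s <= Lb / c by rewrite LbE !le_max lexx !orbT.
apply: le_trans (sqr_bound s0 h); rewrite le_eqVlt; apply/orP; left; apply/eqP.
rewrite /s; move: (Lb) Lb0 (be) be0 => B B0 b b0.
rewrite exprMn exprVn !exprMn !sqr_sqrtr ?mulr_ge0 ?(ltW L0) ?(ltW p0) ?(ltW tau0) ?(ltW b0) ?(ltW nn0)//.
by field; rewrite !gt_eqF.
Qed.

Lemma thmin_le : [/\ 0 < thmin, thmin <= 1 / 4, p * thmin <= al / 4, p * thmin <= tau / 4
  & p * thmin <= be / 4].
Proof.
have e x : p * (4^-1 * (x / p)) = x / 4 by field; rewrite gt_eqF.
rewrite /thmin /thmin_thm7; split.
- by rewrite mulr_gt0 ?invr_gt0// !lt_min ltr01 !divr_gt0.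
- by rewrite mulrC ler_pM2r// ge_min lexx.
- by rewrite -e ler_pM2l// ler_pM2l// !ge_min lexx !orbT.
- by rewrite -e ler_pM2l// ler_pM2l// !ge_min lexx !orbT.
- by rewrite -e ler_pM2l// ler_pM2l// !ge_min lexx !orbT.
Qed.

Let Q_ge (s : R) : s <= Num.max (Num.sqrt (L / (al * p * mu)))
  (Num.max (Num.sqrt (L / (al * tau * mu)))
  (Num.max (Num.sqrt (Num.sqrt (L * Lm) * (om + 1) * Num.sqrt (om * tau)
                        / (al * Num.sqrt n%:R * mu)))
  (Num.max (Num.sqrt (Num.sqrt (L * Lm) * Num.sqrt (om + 1) * Num.sqrt (om * tau)
                        / (al * Num.sqrt p * Num.sqrt n%:R * mu)))
  (Num.max (Num.sqrt (Lm * om * (om + 1) ^+ 2 * p / (n%:R * mu)))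
  (Num.max (Num.sqrt (Lm * om / (n%:R * p * mu)))
  (Num.max al^-1 (Num.max tau^-1 (Num.max (om + 1) p^-1)))))))) ->
  2 * Num.sqrt c * s <= Q.
Proof. by rewrite /Q /Q_thm7 -/c; apply: ler_wpM2l; rewrite mulr_ge0 ?sqrtr_ge0. Qed.

Let sqrtc : 2 <= Num.sqrt c.
Proof.
rewrite -(@ger0_norm _ (2 : R))// -sqrtr_sqr ler_wsqrtr//.
by apply: le_trans c_large; lra.
Qed.

Let Q_ge4 (s : R) : 0 < s -> 2 * Num.sqrt c * s^-1 <= Q -> Q^-1 <= s / 4.
Proof.
move=> s0 h; have h2 : 4 * s^-1 <= Q.
  apply: le_trans h; rewrite ler_pM2r ?invr_gt0//; move: sqrtc; lra.
have Q0 : 0 < Q by apply: lt_le_trans h2; rewrite mulr_gt0// invr_gt0.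
by rewrite -(invf_div 4 s) lef_pV2// posrE// divr_gt0.
Qed.

Lemma Q_gt0 : 0 < Q.
Proof.
apply: (@lt_le_trans _ _ (2 * Num.sqrt c * p^-1)); last by apply: Q_ge; rewrite !le_max lexx ?orbT.
by rewrite !mulr_gt0 ?invr_gt0//; apply: lt_le_trans sqrtc.
Qed.

(** The last four entries of the maximum in Q match the four entries of the minimum in theta_min,
    with 1 read as p / p. The prefactor 2 sqrt c >= 4 absorbs the 1/4. *)
Lemma Q_thmin : Q^-1 <= p * thmin.
Proof.
have e x : p * (4^-1 * (x / p)) = x / 4 by field; rewrite gt_eqF.
have le x : 0 < x -> 2 * Num.sqrt c * x^-1 <= Q -> p^-1 * (4 * Q^-1) <= x / p.
  move=> x0 /(Q_ge4 x0) h; rewrite mulrC ler_pM2r ?invr_gt0//; move: h; lra.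
rewrite -ler_pdivrMl// /thmin /thmin_thm7 -ler_pdivrMl ?invr_gt0// invrK mulrCA.
rewrite !le_min; apply/and4P; split.
- rewrite -[leRHS](mulVf (lt0r_neq0 p0)) [leRHS]mulrC; apply: le => //.
  by apply: Q_ge; rewrite !le_max lexx ?orbT.
- by apply: le => //; apply: Q_ge; rewrite !le_max lexx ?orbT.
- by apply: le => //; apply: Q_ge; rewrite !le_max lexx ?orbT.
- by apply: le => //; apply: Q_ge; rewrite invrK !le_max lexx !orbT.
Qed.

(** The first six entries of the maximum in Q are the square roots of the six terms of Lbar / c
    divided by p mu; squaring compares them one by one. *)
Lemma Q_Lb : 4 * Lb <= p * mu * Q ^+ 2.
Proof.
(* Naming the bound through an existential keeps it opaque while the maximum is split. *)
have [B BE] : exists B, B = p * mu * Q ^+ 2 / 4 by exists (p * mu * Q ^+ 2 / 4).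
have Q2 (s u : R) : 2 * Num.sqrt c * Num.sqrt s <= Q -> 0 <= s -> u = s * (p * mu) ->
    c * u <= B.
  rewrite BE => h s0 ->; have : (2 * Num.sqrt c * Num.sqrt s) ^+ 2 <= Q ^+ 2.
    apply: lerXn2r h; rewrite nnegrE; last exact: ltW Q_gt0.
    by have ? := sqrtr_ge0 c; have ? := sqrtr_ge0 s; nonneg.
  rewrite !exprMn !sqr_sqrtr ?(ltW c0)// => h2.
  have := ler_wpM2l (mulr_ge0 (ltW p0) (ltW mu0)) h2; lra.
suff : Lb / c <= B / c.
  by rewrite ler_pM2r ?invr_gt0// BE; move: (Lb) (Q ^+ 2) => x q; lra.
have bE : Num.sqrt be = (Num.sqrt (om + 1))^-1 by rewrite /be sqrtrV// ltW.
have sp : Num.sqrt p ^+ 2 = p by rewrite sqr_sqrtr// ltW.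
have s1 : 0 < Num.sqrt p by rewrite sqrtr_gt0.
have s2 : 0 < Num.sqrt (n%:R : R) by rewrite sqrtr_gt0.
have s3 : 0 < Num.sqrt (om + 1) by rewrite sqrtr_gt0.
rewrite LbE !ge_max !ler_pdivlMr// ![_ * c]mulrC.
apply/andP; split; [|apply/andP; split; [|apply/andP; split; [|apply/andP; split; [|apply/andP; split]]]].
- apply: (Q2 (L / (al * p * mu))); first by apply: Q_ge; rewrite !le_max lexx ?orbT.
    by nonneg.
  by field; rewrite !gt_eqF.
- apply: (Q2 (L / (al * tau * mu))); first by apply: Q_ge; rewrite !le_max lexx ?orbT.
    by nonneg.
  by field; rewrite !gt_eqF.
- apply: (Q2 (Num.sqrt (L * Lm) * (om + 1) * Num.sqrt (om * tau) / (al * Num.sqrt n%:R * mu))).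
  + by apply: Q_ge; rewrite !le_max lexx ?orbT.
  + by have ? := sqrtr_ge0 (L * Lm); have ? := sqrtr_ge0 (om * tau); nonneg.
  + by rewrite /be; field; rewrite !gt_eqF.
- apply: (Q2 (Num.sqrt (L * Lm) * Num.sqrt (om + 1) * Num.sqrt (om * tau)
               / (al * Num.sqrt p * Num.sqrt n%:R * mu))).
  + by apply: Q_ge; rewrite !le_max lexx ?orbT.
  + by have ? := sqrtr_ge0 (L * Lm); have ? := sqrtr_ge0 (om * tau); nonneg.
  + rewrite bE; move: (Num.sqrt p) sp s1 => r <- r0.
    by field; rewrite !gt_eqF.
- apply: (Q2 (Lm * om * (om + 1) ^+ 2 * p / (n%:R * mu))).
  + by apply: Q_ge; rewrite !le_max lexx ?orbT.
  + by nonneg.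
  + by rewrite /be; field; rewrite !gt_eqF.
- apply: (Q2 (Lm * om / (n%:R * p * mu))).
  + by apply: Q_ge; rewrite !le_max lexx ?orbT.
  + by nonneg.
  + by field; rewrite !gt_eqF.
Qed.

End StepSizes.

(** * Closed form of an iteration *)

Section ProxStep.
Variables (R : realType) (n d : nat) (Sy Sz SP : Type).
Variables (Cy : 'I_n -> Sy -> 'rV[R]_d -> 'rV[R]_d) (Cz : 'I_n -> Sz -> 'rV[R]_d -> 'rV[R]_d).
Variable CP : SP -> 'rV[R]_d -> 'rV[R]_d.
Variable grad : 'I_n -> 'rV[R]_d -> 'rV[R]_d.
Variables (mu tau beta : R).

(* One iteration in the form used by [one_step]: closed-form minimizers, and the
   compressed messages split into their mean and a centered error. *)
Definition prox_step (th a Gam' : R) (sy : 'I_n -> Sy) (sz : 'I_n -> Sz) (sp : SP) (c : bool)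
  (s : state R n d) : state R n d :=
  let gf x := avgv (fun i => grad i x) in
  let y := th *: st_w s + (1 - th) *: st_z s in
  let N := avgv (fun i => Cy i (sy i) (grad i y - st_hi s i) - (grad i y - st_hi s i)) in
  let u' := prox_point a mu (gf y + N) (st_u s) y in
  let q := prox_point a mu (st_k s) (st_w s) y in
  let w' := q + CP sp (u' - q) in
  let x' := th *: u' + (1 - th) *: st_z s in
  let k' := if c then st_v s else st_k s in
  let z' := if c then x' else st_z s in
  let Z i := grad i z' - st_hi s i in
  let M i := Cz i (sz i) (Z i) - Z i in
  let hi' i := st_hi s i + beta *: (Z i + M i) in
  let v' := (1 - tau) *: st_v s + tau *: (gf z' + avgv M) in
  State w' z' u' x' hi' (avgv hi') k' v' Gam'.

Lemma stepE (Lb p thmin : R) sy sz sp c (s : state R n d) :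
  0 < mu -> 0 < p -> 0 < Lb -> 0 < st_Gam s -> 0 < thmin -> p * thmin < 1 ->
  st_h s = avgv (st_hi s) ->
  let Gam := st_Gam s in let th := theta p mu Lb thmin Gam in
  let Gam' := Gam / (1 - p * th) in
  step Cy Cz CP grad Lb mu p tau beta thmin sy sz sp c s =
  prox_step th ((Lb + Gam * mu) / (p * th * Gam')) Gam' sy sz sp c s.
Proof.
move=> mu0 p0 Lb0 G0 t0 pt1 hE Gam th Gam'.
have th0 : 0 < th by exact: theta_gt0.
have pth : 0 < 1 - p * th.
  by rewrite subr_gt0; apply: le_lt_trans pt1; rewrite ler_pM2l// theta_le.
have gamE : p * th * Gam / (1 - p * th) = p * th * Gam' by rewrite /Gam' mulrA.
have GamE : Gam + p * th * Gam / (1 - p * th) = Gam'.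
  by rewrite /Gam'; field; rewrite gt_eqF.
have A0 : 0 < Lb + Gam * mu by rewrite addr_gt0// mulr_gt0.
have g0 : 0 < p * th * Gam' by rewrite mulr_gt0 ?divr_gt0// mulr_gt0.
set a := (Lb + Gam * mu) / (p * th * Gam').
have amu : 0 < a + mu by rewrite addr_gt0// divr_gt0.
rewrite /step /prox_step -/Gam -/(theta p mu Lb thmin Gam) -/th GamE gamE -/a.
set y := th *: st_w s + _.
(* Since h is the average of the h_i, the shifts cancel, and the server's estimate is the average
   gradient plus the average compression error. *)
have msgE (g C : 'I_n -> 'rV[R]_d) :
    st_h s + n%:R^-1 *: \sum_i C i = avgv g + avgv (fun i => C i - (g i - st_hi s i)).
  rewrite hE /avgv -!scalerDr -!big_split; congr (_ *: _); apply: eq_bigr => i _ /=.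
  by rewrite opprB [RHS]addrCA [g i + _]addrC subrK addrC.
have uE g u : argmin (fun x => dotv g x + a / 2 * sqn (x - u) + mu / 2 * sqn (x - y)) =
    prox_point a mu g u y by exact: argmin_prox.
rewrite !uE (msgE (fun i => grad i y)).
set u' := prox_point _ _ _ _ _; set q := prox_point _ _ _ _ _.
set z' := if c then _ else _; rewrite (msgE (fun i => grad i z')).
congr State.
- by apply/funext => i; rewrite [_ + (_ - _)]addrC subrK.
- rewrite hE /avgv [beta / _]mulrC -scalerA -scalerDr scaler_sumr -big_split.
  congr (_ *: _); apply: eq_bigr => i _ /=.
  by rewrite [_ + (Cz _ _ _ - _)]addrC subrK.
Qed.

End ProxStep.

(** * Convergence *)

Section Convergence.
Variables (R : realType) (n d : nat).
Hypothesis n0 : (0 < n)%N.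
Variables (f : 'I_n -> 'rV[R]_d -> R) (grad : 'I_n -> 'rV[R]_d -> 'rV[R]_d).
Variables (Li : 'I_n -> R) (L mu : R) (xs : 'rV[R]_d).
Let fb := avgf f.
Let gf x := avgv (fun i => grad i x).
Let Lm := Lmax_of Li.
Hypothesis f_smooth : forall i, smooth_with (f i) (grad i) (Li i).
Hypothesis fb_smooth : smooth_with fb gf L.
Hypothesis f_convex : forall i, convex_fun (f i).
Hypothesis L0 : 0 < L.
Hypothesis mu0 : 0 < mu.
Hypothesis fb_strong : strongly_convex mu fb.
Hypothesis fb_min : forall x, fb xs <= fb x.
Variables (om al p tau Gam0 : R).
Hypothesis om0 : 0 <= om.
Hypothesis al01 : 0 < al <= 1.
Hypothesis p01 : 0 < p <= 1.
Hypothesis tau01 : 0 < tau <= 1.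
Hypothesis Gam0_ge1 : 1 <= Gam0.
Variables (dO : measure_display) (Om : measurableType dO) (P : probability Om R).
Variables (dy dz dp : measure_display).
Variables (Sy : measurableType dy) (Sz : measurableType dz) (SP : measurableType dp).
Variables (muy : 'I_n -> probability Sy R) (muz : 'I_n -> probability Sz R).
Variable muP : probability SP R.
Variables (Cy : 'I_n -> Sy -> 'rV[R]_d -> 'rV[R]_d) (Cz : 'I_n -> Sz -> 'rV[R]_d -> 'rV[R]_d).
Variable CP : SP -> 'rV[R]_d -> 'rV[R]_d.
Hypothesis Cy_meas : forall i, compressor_measurable (Cy i).
Hypothesis Cz_meas : forall i, compressor_measurable (Cz i).
Hypothesis CP_meas : compressor_measurable CP.
Hypothesis Cy_U : forall i, in_U (muy i) (Cy i) om.
Hypothesis Cz_U : forall i, in_U (muz i) (Cz i) om.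
Hypothesis CP_B : in_B muP CP al.
Variables (xiy : nat -> 'I_n -> Om -> Sy) (xiz : nat -> 'I_n -> Om -> Sz).
Variables (xip : nat -> Om -> SP) (coin : nat -> Om -> bool).
Hypothesis xiy_meas : forall t i, measurable_fun setT (xiy t i).
Hypothesis xiz_meas : forall t i, measurable_fun setT (xiz t i).
Hypothesis xip_meas : forall t, measurable_fun setT (xip t).
Hypothesis coin_meas : forall t, measurable_fun setT (coin t).
Hypothesis xiy_law : forall t i (A : set Sy), measurable A -> P (xiy t i @^-1` A) = muy i A.
Hypothesis xiz_law : forall t i (A : set Sz), measurable A -> P (xiz t i @^-1` A) = muz i A.
Hypothesis xip_law : forall t (A : set SP), measurable A -> P (xip t @^-1` A) = muP A.
Hypothesis coin_law : forall t, P (coin t @^-1` [set true]) = p%:E.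
Let G := source_sigma xiy xiz xip coin.
Hypothesis Gi : mutually_independent P G.
Variable x0 : 'rV[R]_d.

Let be := (om + 1)^-1.
Let Lb := Lbar_thm7 L Lm om al p tau be n.
Let thmin := thmin_thm7 al p tau be.
Let Q := Q_thm7 L Lm om al p tau mu n.
Let S := run Cy Cz CP grad Lb mu p tau be thmin xiy xiz xip coin (init_thm7 grad x0 Gam0).

Let Ga s : sigma_algebra setT (G s).
Proof. by case: s => *; exact: sigma_of_algebra. Qed.

Let Gm s : G s `<=` measurable.
Proof.
by case: s => [t i|t i|t|t] A [B mB <-]; rewrite -[X in measurable X]setTI;
  [exact: xiy_meas|exact: xiz_meas|exact: xip_meas|exact: coin_meas].
Qed.

Let p0 : 0 < p. Proof. by case/andP: p01. Qed.
Let p1 : p <= 1. Proof. by case/andP: p01. Qed.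
Let Lm0 : 0 <= Lm. Proof. exact: bigmax_ge_id. Qed.
Let Lb0 : 0 < Lb. Proof. exact: Lbar_gt0. Qed.
Let thmin_spec := thmin_le om0 al01 p01 tau01.
Let thmin0 : 0 < thmin. Proof. by case: thmin_spec. Qed.
Let thmin4 : thmin <= 1 / 4. Proof. by case: thmin_spec. Qed.
Let pthmin1 : p * thmin < 1.
Proof.
by move: (ler_wpM2l (ltW p0) thmin4) p1; move: (thmin) => th; lra.
Qed.

Let th := theta p mu Lb thmin.

(** The step sizes do not depend on the seeds: Gamma_t is a number, and [one_step] may treat theta
    and a as constants. *)
Fixpoint Gamma t : R := if t is t'.+1 then Gamma t' / (1 - p * th (Gamma t')) else Gam0.

Let pth1 g : 0 < 1 - p * th g.
Proof.
by rewrite subr_gt0; apply: le_lt_trans pthmin1; rewrite ler_pM2l// theta_le.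
Qed.

Lemma Gamma_gt0 t : 0 < Gamma t.
Proof.
elim: t => [|t ih] /=; first exact: lt_le_trans Gam0_ge1.
exact: divr_gt0.
Qed.

(** 1 - p theta <= 1 - 1/Q <= exp(-1/Q) at every step. *)
Lemma Gamma_growth t : Gam0 * expR (t%:R / Q) <= Gamma t.
Proof.
have Q0 : 0 < Q by exact: Q_gt0.
elim: t => [|t ih]; first by rewrite mul0r expR0 mulr1.
have rate : Q^-1 <= p * th (Gamma t).
  apply: (theta_rate p0 mu0 Lb0 (Gamma_gt0 t) Q0 p1 thmin4).
    exact: Q_thmin.
  exact: Q_Lb.
rewrite /= ler_pdivlMr// -natr1 mulrDl mul1r expRD.
rewrite [leLHS](_ : _ = Gam0 * expR (t%:R / Q) * (expR Q^-1 * (1 - p * th (Gamma t)))); last first.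
  by rewrite !mulrA.
have h : expR Q^-1 * (1 - p * th (Gamma t)) <= 1.
  apply: le_trans (_ : expR Q^-1 * expR (- Q^-1) <= _); last by rewrite -expRD subrr expR0.
  rewrite ler_pM2l ?expR_gt0//; apply: le_trans (expR_ge1Dx _).
  by rewrite lerD2l lerN2.
apply: le_trans ih; rewrite ler_piMr// mulr_ge0 ?expR_ge0//.
by apply: le_trans Gam0_ge1.
Qed.

Definition lyapunov (X : Om -> state R n d) (g : R) : R :=
  g * Ex P (fun o => fb (st_z (X o)) - fb xs)
  + (Lb + g * mu) / 2 * M2 P (fun o => st_u (X o) - xs)
  + weightW L Lb al * (Lb + g * mu) * M2 P (fun o => st_u (X o) - st_w (X o))
  + weightH L Lb om al p tau be n%:R * g *
      (n%:R^-1 * \sum_i M2 P (fun o => st_hi (X o) i - grad i (st_z (X o))))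
  + weightK L Lb al * g * M2 P (fun o => gf (st_z (X o)) - st_k (X o))
  + weightV L Lb al p tau * g * M2 P (fun o => st_v (X o) - gf (st_z (X o))).

Local Notation L2u k := (@L2 R dO Om P (rsource n) G d (upto k)).

Definition adapted (k : nat) (X : Om -> state R n d) :=
  [/\ L2u k (fun o => st_w (X o)), L2u k (fun o => st_z (X o)), L2u k (fun o => st_u (X o)),
      L2u k (fun o => st_k (X o)) & L2u k (fun o => st_v (X o))]
  /\ forall i, L2u k (fun o => st_hi (X o) i).

(** The identity for [st_h] is carried along because [stepE] relies on it. The index 4 t says that
    the state uses only the seeds of iterations before t. *)
Lemma run_invariant t :
  [/\ forall o, st_Gam (S t o) = Gamma t, forall o, st_h (S t o) = avgv (st_hi (S t o)),
      adapted (4 * t) (S t) & lyapunov (S t) (Gamma t) <= lyapunov (S 0) Gam0].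
Proof.
elim: t => [|t [GE hE [[Lw Lz Lu Lk Lv] Lhi] ih]].
  split=> //; split; first by split; exact: L2_cst.
  by move=> i; exact: L2_cst.
pose g := Gamma t; pose a := (Lb + g * mu) / (p * th g * (g / (1 - p * th g))).
have g0 : 0 < g by exact: Gamma_gt0.
have th0 : 0 < th g by exact: theta_gt0.
have A0 : 0 < Lb + g * mu by rewrite addr_gt0// mulr_gt0.
have a0 : 0 < a := divr_gt0 A0 (mulr_gt0 (mulr_gt0 p0 th0) (divr_gt0 g0 (pth1 g))).
have thle : th g <= thmin by exact: theta_le.
have th4 : th g <= 1 / 4 by exact: le_trans thmin4.
have pthle : p * th g <= p * thmin by rewrite ler_pM2l.
have th01 : 0 <= th g <= 1.
  by rewrite (ltW th0)/=; apply: le_trans th4 _; rewrite ler_pdivrMr// mul1r ler1n.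
have SE : S t.+1 = fun o => prox_step Cy Cz CP grad mu tau be (th g) a (Gamma t.+1)
    (fun i => xiy t i o) (fun i => xiz t i o) (xip t o) (coin t o) (S t o).
  apply/funext => o; rewrite [LHS]/S /= -/(S t o).
  have Gs0 : 0 < st_Gam (S t o) by rewrite GE; exact: g0.
  rewrite (@stepE _ _ _ _ _ _ Cy Cz CP grad mu tau be Lb p thmin _ _ _ _ (S t o)
    mu0 p0 Lb0 Gs0 thmin0 pthmin1 (hE o)) GE.
  by [].
have [_ _ t1 t2 t3] := thmin_spec.
have := one_step n0 f_smooth fb_smooth f_convex L0 mu0 fb_strong fb_min om0 al01 p01 tau01
  Ga Gm Gi Cy_meas Cz_meas CP_meas Cy_U Cz_U CP_B (xiy_meas t) (xiz_meas t) (xip_meas t)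
  (coin_meas t) (fun i => @subset_refl _ _) (fun i => @subset_refl _ _) (@subset_refl _ _)
  (@subset_refl _ _) (xiy_law t) (xiz_law t) (@xip_law t) (coin_law t) th01 a0
  Lw Lz Lu Lk Lv Lhi Lb0 g0 (eps_small R) (Lbar_x Lm om p tau n L0 al01)
  (Lbar_y Lm om p tau n L0 al01) (Lbar_b0 Lm om p tau n L0 al01) (Lbar_b2 Lm om p tau n L0 al01)
  (Lbar_g1 L0 Lm0 om0 n0 al01 p01 tau01) (Lbar_g2 L0 Lm0 om0 n0 al01 p01 tau01) th0 th4
  (le_trans pthle t1) (le_trans pthle t2) (le_trans pthle t3)
  (theta_root p0 mu0 Lb0 thmin0 g0) erefl.
move=> [[Lw' Lz' Lu' Lk' Lv'] [Lhi' dec]].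
split; [by move=> o; rewrite SE|by move=> o; rewrite SE|rewrite SE|rewrite SE].
  by split; [split; [exact: Lw'|exact: Lz'|exact: Lu'|exact: Lk'|exact: Lv']|exact: Lhi'].
apply: le_trans ih; exact: dec.
Qed.

Lemma convergence T : (\int[P]_o ((fb (st_z (S T o)) - fb xs)%:E)
   + (mu / 2)%:E * \int[P]_o (sqn (st_u (S T o) - xs))%:E
   <= (2 * expR (- T%:R / Q) * ((fb x0 - fb xs) + (Lb / Gam0 + mu) * sqn (x0 - xs)))%:E)%E.
Proof.
have [_ _ [[Lw Lz Lu Lk Lv] Lhi] dec] := run_invariant T.
have [_ iU] := L2B Gm Lu (L2_cst P G (upto (4 * T)) xs).
have iF := integ_gap Gm fb_smooth fb_min Lz.
rewrite !EFin_Ex// -EFinM -EFinD lee_fin.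
set F := Ex P _; set U := Ex P _.
have F0 : 0 <= F by apply: Ex_ge0 => o; rewrite subr_ge0.
have U0 : 0 <= U by exact: M2_ge0.
have GT0 := Gamma_gt0 T; have grow := Gamma_growth T.
have G00 : 0 < Gam0 by exact: lt_le_trans Gam0_ge1.
have be01 : 0 < be <= 1 by rewrite invr_gt0 ltr_wpDl//= invf_le1 ?lerDr// ltr_wpDl.
have nn0 : 0 < n%:R :> R by rewrite ltr0n.
(* The four error terms and the Lbar part of A are dropped. *)
have low : Gamma T * (F + mu / 2 * U) <= lyapunov (S T) (Gamma T).
  have avg0 (X : 'I_n -> Om -> 'rV[R]_d) : 0 <= n%:R^-1 * \sum_i M2 P (X i).
    by rewrite mulr_ge0 ?invr_ge0// sumr_ge0// => i _; exact: M2_ge0.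
  have gT : 0 <= Gamma T := ltW GT0.
  have LbT : 0 <= Lb + Gamma T * mu by exact: addr_ge0 (ltW Lb0) (mulr_ge0 gT (ltW mu0)).
  have w1 := mulr_ge0 (mulr_ge0 (weightW_ge0 L0 Lb0 al01) LbT)
    (M2_ge0 P (fun o => st_u (S T o) - st_w (S T o))).
  have w2 := mulr_ge0 (mulr_ge0 (weightH_ge0 L0 Lb0 om0 nn0 al01 p01 tau01 be01) gT)
    (avg0 (fun i o => st_hi (S T o) i - grad i (st_z (S T o)))).
  have w3 := mulr_ge0 (mulr_ge0 (weightK_ge0 L0 Lb0 al01) gT)
    (M2_ge0 P (fun o => gf (st_z (S T o)) - st_k (S T o))).
  have w4 := mulr_ge0 (mulr_ge0 (weightV_ge0 L0 Lb0 al01 p01 tau01) gT)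
    (M2_ge0 P (fun o => st_v (S T o) - gf (st_z (S T o)))).
  have drop (b c : R) : 0 <= c -> b <= b + c by rewrite lerDl.
  apply: (le_trans _ (drop _ _ w4)); apply: (le_trans _ (drop _ _ w3)).
  apply: (le_trans _ (drop _ _ w2)); apply: (le_trans _ (drop _ _ w1)).
  rewrite -/F -[M2 P _]/U mulrDr lerD2l mulrA; apply: ler_wpM2r => //.
  by rewrite mulrA ler_wpM2r ?invr_ge0// lerDr ltW.
have init : lyapunov (S 0) Gam0 = Gam0 * (fb x0 - fb xs) + (Lb + Gam0 * mu) / 2 * sqn (x0 - xs).
  rewrite /lyapunov /S /= /M2 !ExC /gf.
  rewrite big1 => [|i _]; last by rewrite ExC subrr sqn0.
  by rewrite !subrr !sqn0 !mulr0 !addr0.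
set F1 := fb x0 - fb xs in init *; set U1 := sqn (x0 - xs) in init *.
have F10 : 0 <= F1 by rewrite subr_ge0.
have U10 : 0 <= U1 by exact: sqn_ge0.
set e := expR (- T%:R / Q).
have e0 : 0 < e by exact: expR_gt0.
have eE : expR (T%:R / Q) = e^-1 by rewrite /e mulNr expRN invrK.
rewrite eE ler_pdivrMr// in grow.
have rhs0 : 0 <= F1 + (Lb / Gam0 + mu) * U1.
  exact: addr_ge0 F10 (mulr_ge0 (addr_ge0 (divr_ge0 (ltW Lb0) (ltW G00)) (ltW mu0)) U10).
(* The factor 1/2 on A in the initial value is given up, to match the right-hand side. *)
have key : Gamma T * (F + mu / 2 * U) <= Gam0 * (F1 + (Lb / Gam0 + mu) * U1).
  apply: le_trans low (le_trans dec _); rewrite init.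
  have -> : Gam0 * (F1 + (Lb / Gam0 + mu) * U1) = Gam0 * F1 + (Lb + Gam0 * mu) * U1.
    by move: (Lb) => l; field; rewrite gt_eqF.
  rewrite lerD2l ler_wpM2r// ler_pdivrMr// ler_peMr ?ler1n//.
  exact: addr_ge0 (ltW Lb0) (mulr_ge0 (ltW G00) (ltW mu0)).
have X0 : 0 <= F + mu / 2 * U by rewrite addr_ge0// mulr_ge0// divr_ge0// ltW.
rewrite -(ler_pM2l G00).
apply: le_trans (ler_wpM2r X0 grow) _.
rewrite [Gamma T * e]mulrC -[e * _ * _]mulrA; apply: le_trans (ler_wpM2l (ltW e0) key) _.
rewrite [leRHS]mulrCA; apply: ler_wpM2r; first exact: mulr_ge0 (ltW G00) rhs0.
by rewrite ler_peMl ?ltW// ltr1n.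
Qed.

End Convergence.

(** On a nonzero vector the two quadratic bounds give mu <= L; such a vector exists only in positive
    dimension. *)
Lemma smoothness_gt0 (R : realType) (d : nat) (f : 'rV[R]_d -> R) (g : 'rV[R]_d -> 'rV[R]_d)
  (L mu : R) : (0 < d)%N -> smooth_with f g L -> 0 < mu -> strongly_convex mu f -> 0 < L.
Proof.
move=> d0 fL mu0 fmu; pose v : 'rV[R]_d := const_mx 1.
have v0 : 0 < sqn v.
  rewrite lt_def sqn_ge0 andbT sqn_eq0; apply/eqP => /rowP /(_ (Ordinal d0)).
  by rewrite !mxE => /eqP; rewrite oner_eq0.
have L0 : 0 <= L.
  have [_ /(_ v 0)] := fL; rewrite subr0 => h.
  by rewrite -(pmulr_lge0 _ (_ : 0 < enorm v)) ?sqrtr_gt0// (le_trans _ h)// sqrtr_ge0.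
have h1 := smooth_le 0 v fL; have h2 := strongly_convex_bregman 0 v L0 fL fmu.
have := le_trans h2 h1; rewrite subr0 ler_pM2r// ler_pM2r ?invr_gt0//.
exact: lt_le_trans.
Qed.

Unset Implicit Arguments.

Theorem theorem7
  (R : realType) (n d : nat) (hn : (0 < n)%N)
  (* Assumptions 1-3 *)
  (f : 'I_n -> 'rV[R]_d -> R) (grad : 'I_n -> 'rV[R]_d -> 'rV[R]_d)
  (Li : 'I_n -> R) (Lhat L mu : R) (xstar : 'rV[R]_d)
  (A1_smooth : forall i, smooth_with (f i) (grad i) (Li i))
  (A1_Lhat_pos : 0 < Lhat)
  (A1_Lhat : forall x y, n%:R^-1 * \sum_(i < n) sqn (grad i x - grad i y)
                         <= Lhat ^+ 2 * sqn (x - y))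
  (A2 : smooth_with (avgf f) (fun x => avgv (fun i => grad i x)) L)
  (A3_convex : forall i, convex_fun (f i))
  (mu_pos : 0 < mu)
  (A3_strong : strongly_convex mu (avgf f))
  (A3_min : forall x, avgf f xstar <= avgf f x)
  (* parameters *)
  (om al p tau Gam0 : R)
  (om_ge0 : 0 <= om) (al_range : 0 < al <= 1) (p_range : 0 < p <= 1)
  (tau_range : 0 < tau <= 1) (Gam0_ge1 : 1 <= Gam0)
  (* probability space, compressors (seed law + map) and randomness *)
  (dO : measure_display) (Om : measurableType dO) (P : probability Om R)
  (dy dz dp : measure_display)
  (Sy : measurableType dy) (Sz : measurableType dz) (SP : measurableType dp)
  (muy : 'I_n -> probability Sy R) (muz : 'I_n -> probability Sz R)
  (muP : probability SP R)
  (Cy : 'I_n -> Sy -> 'rV[R]_d -> 'rV[R]_d) (Cz : 'I_n -> Sz -> 'rV[R]_d -> 'rV[R]_d)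
  (CP : SP -> 'rV[R]_d -> 'rV[R]_d)
  (Cy_meas : forall i, compressor_measurable (Cy i))
  (Cz_meas : forall i, compressor_measurable (Cz i))
  (CP_meas : compressor_measurable CP)
  (Cy_U : forall i, in_U (muy i) (Cy i) om)
  (Cz_U : forall i, in_U (muz i) (Cz i) om)
  (CP_B : in_B muP CP al)
  (xiy : nat -> 'I_n -> Om -> Sy) (xiz : nat -> 'I_n -> Om -> Sz)
  (xip : nat -> Om -> SP) (coin : nat -> Om -> bool)
  (xiy_meas : forall t i, measurable_fun [set: Om] (xiy t i))
  (xiz_meas : forall t i, measurable_fun [set: Om] (xiz t i))
  (xip_meas : forall t, measurable_fun [set: Om] (xip t))
  (coin_meas : forall t, measurable_fun [set: Om] (coin t))
  (xiy_law : forall t i (A : set Sy), measurable A -> P (xiy t i @^-1` A) = muy i A)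
  (xiz_law : forall t i (A : set Sz), measurable A -> P (xiz t i @^-1` A) = muz i A)
  (xip_law : forall t (A : set SP), measurable A -> P (xip t @^-1` A) = muP A)
  (coin_law : forall t, P (coin t @^-1` [set true]) = p%:E)
  (A4 : mutually_independent P (source_sigma xiy xiz xip coin))
  (x0 : 'rV[R]_d) :
  let Lmax := Lmax_of Li in
  let beta := (om + 1)^-1 in
  let Lbar := Lbar_thm7 L Lmax om al p tau beta n in
  let thmin := thmin_thm7 al p tau beta in
  let Q := Q_thm7 L Lmax om al p tau mu n in
  let iter := run Cy Cz CP grad Lbar mu p tau beta thmin xiy xiz xip coin
                  (init_thm7 grad x0 Gam0) in
  forall T : nat,
  (\int[P]_o ((avgf f (st_z (iter T o)) - avgf f xstar)%:E)
   + (mu / 2)%:E * \int[P]_o (sqn (st_u (iter T o) - xstar))%:E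
   <= (2 * expR (- T%:R / Q) *
       ((avgf f x0 - avgf f xstar) + (Lbar / Gam0 + mu) * sqn (x0 - xstar)))%:E)%E.
Proof.
move=> Lmax beta Lbar thmin Q iter T.
(* In dimension 0 the number L may fail to be positive, but there is a single vector and both sides
   are 0. *)
have [d0|d0] := posnP d; last first.
  have L0 := smoothness_gt0 d0 A2 mu_pos A3_strong.
  exact: (convergence hn A1_smooth A2 A3_convex L0 mu_pos A3_strong A3_min om_ge0 al_range
    p_range tau_range Gam0_ge1 Cy_meas Cz_meas CP_meas Cy_U Cz_U CP_B xiy_meas xiz_meas
    xip_meas coin_meas xiy_law xiz_law xip_law coin_law A4 x0 T).
have point (x : 'rV[R]_d) : x = xstar by apply/rowP => j; have := leq_trans (ltn_ord j) (eq_leq d0).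
have -> : (\int[P]_o ((avgf f (st_z (iter T o)) - avgf f xstar)%:E) = 0)%E.
  by apply: integral0_eq => o _; rewrite (point (st_z _)) subrr.
have -> : (\int[P]_o (sqn (st_u (iter T o) - xstar))%:E = 0)%E.
  by apply: integral0_eq => o _; rewrite (point (st_u _)) subrr sqn0.
by rewrite mule0 adde0 (point x0) !subrr sqn0 mulr0 addr0 mulr0.
Qed.
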